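(* Assume Assumption (LS) and Assumption (UT) below hold, with $\alpha>0$ the exponent in Assumption (UT). Then there exist constants $c>0$, $\zeta\in(0,\tfrac{2}{25}]$, $r_0$ and $\theta_0$ (all depending on $\alpha$) such that for all $r>r_0$ and all $\theta_0\le\theta\le r^{\zeta}$, $$\mathbb{P}\left(X_r-\mathbb{E}[X_r]\ge \theta r^{1/3}\right)\le \exp\left(-c\,\theta^{3/2}(\log\theta)^{-1/2}\right).$$ Moreover, $\zeta=\zeta(\alpha)$ satisfies $\zeta(\alpha)\to 0$ as $\alpha\to 0$, and $\zeta(\alpha)=\tfrac{2}{25}$ if $\alpha\ge 1$.
   Context: Let $\{\xi_v:v\in\mathbb{Z}^2\}$ be i.i.d. random variables with a common law $\nu$ supported on $[0,\infty)$. A directed path is an up-right nearest-neighbour path in $\mathbb{Z}^2$, and its weight is $\ell(\gamma)=\sum_{u\in\gamma}\xi_u$. For $u\preceq v$ in the coordinatewise partial order, $X_{u,v}=\max_{\gamma:u\to v}\ell(\gamma)$ over directed paths from $u$ to $v$ ($X_{u,v}=-\infty$ if no such path exists). For $r\in\mathbb{N}$ and $z\in\mathbb{Z}$, $X_r^z=X_{(1,1),(r-z,r+z)}$ and $X_r=X_r^0$. It is assumed that $\mu=\lim_{r\to\infty}r^{-1}\mathbb{E}[X_r]<\infty$. Assumption (LS): there exist positive finite constants $\rho,G,H,g_1,g_2$ such that for all large enough $r$ and all $z\in[-\rho r,\rho r]$, $\mathbb{E}[X_r^z]\in \mu r-G\frac{z^2}{r}+\left[-H\frac{z^4}{r^3},0\right]+\left[-g_1r^{1/3},-g_2r^{1/3}\right]$.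 Assumption (UT): there exists $\alpha>0$ such that for every $\varepsilon>0$ there exist positive finite $c,\theta_0,r_0$ (depending only on $\varepsilon$) such that for all $r>r_0$, $\theta>\theta_0$ and $|z|\le(1-\varepsilon)r$, $\mathbb{P}(X_r^z-\mathbb{E}[X_r^z]>\theta r^{1/3})\le\exp(-c\theta^\alpha)$. *)

(* Defs.v *)
From HB Require Import structures.
From mathcomp Require Import all_boot all_order all_algebra.
From mathcomp Require Import all_classical all_reals all_analysis.
Set Implicit Arguments. Unset Strict Implicit. Unset Printing Implicit Defensive.
Import Order.TTheory GRing.Theory Num.Theory.
Import numFieldNormedType.Exports.
Local Open Scope ring_scope.
Local Open Scope classical_set_scope.

Definition vtx := (int * int)%type.

Definition step (u : vtx) (b : bool) : vtx :=
  if b then (u.1 + 1, u.2)%R else (u.1, u.2 + 1)%R.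

Fixpoint verts (u : vtx) (s : seq bool) : seq vtx :=
  u :: (if s is b :: s' then verts (step u b) s' else [::]).

(* Last passage value X_{u,v} for a deterministic environment [xi]:
   the maximum over all directed (up-right nearest-neighbour) paths from
   [u] to [v] of the sum of the weights of the vertices of the path;
   -oo if there is no such path (i.e. u is not <= v coordinatewise).
   A directed path from u to v is encoded by its sequence of steps, which has
   length (v.1-u.1)+(v.2-u.2) and contains exactly (v.1-u.1) first-coordinate
   steps. *)
Definition lpp {R : realType} (xi : vtx -> R) (u v : vtx) : \bar R :=
  if ((u.1 <= v.1) && (u.2 <= v.2))%R then
    let n1 := `|v.1 - u.1|%N in
    let n2 := `|v.2 - u.2|%N in
    (\big[Order.max/-oo]_(s : (n1 + n2).-tuple bool | count id s == n1)
        (\sum_(w <- verts u s) xi w)%:E)%E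
  else -oo%E.

Definition Xrz {R : realType} {T : Type} (xi : vtx -> T -> R) (r : nat) (z : int)
  : T -> \bar R :=
  fun w => lpp (fun v => xi v w) (1%R, 1%R) (r%:Z - z, r%:Z + z)%R.

Definition Ex {R : realType} {d} {T : measurableType d} (P : probability T R)
  (X : T -> \bar R) : \bar R := (\int[P]_w X w)%E.

Definition mutually_independent {R : realType} {d} {T : measurableType d}
  (P : probability T R) (xi : vtx -> T -> R) : Prop :=
  forall (s : seq vtx) (B : vtx -> set R), uniq s ->
    (forall v, measurable (B v)) ->
    P (\bigcap_(v in [set` s]) (xi v @^-1` B v)) =
      (\prod_(v <- s) P (xi v @^-1` B v))%E.

Definition has_law {R : realType} {d} {T : measurableType d}
  (P : probability T R) (X : T -> R) (nu : probability R R) : Prop :=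
  measurable_fun setT X /\
  forall B : set R, measurable B -> P (X @^-1` B) = nu B.

Definition Assumption_LS {R : realType} {d} {T : measurableType d}
  (P : probability T R) (xi : vtx -> T -> R) (mu : R) : Prop :=
  exists (rho G H g1 g2 : R), 0 < rho /\ 0 < G /\ 0 < H /\ 0 < g1 /\ 0 < g2 /\
  exists r1 : nat, forall r : nat, (r1 <= r)%N ->
  forall z : int, `|z%:~R| <= rho * r%:R ->
    let rr := r%:R in let zz : R := z%:~R in
    ((mu * rr - G * zz ^+ 2 / rr - H * zz ^+ 4 / rr ^+ 3 - g1 * rr `^ (3^-1))%:E
       <= Ex P (Xrz xi r z))%E /\
    (Ex P (Xrz xi r z) <= (mu * rr - G * zz ^+ 2 / rr - g2 * rr `^ (3^-1))%:E)%E.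

Definition Assumption_UT {R : realType} {d} {T : measurableType d}
  (P : probability T R) (xi : vtx -> T -> R) (alpha : R) : Prop :=
  forall eps : R, 0 < eps ->
  exists (c theta0 r0 : R), 0 < c /\ 0 < theta0 /\ 0 < r0 /\
  forall (r : nat) (theta : R) (z : int),
    r0 < r%:R -> theta0 < theta -> `|z%:~R| <= (1 - eps) * r%:R ->
    (P [set w | ((theta * r%:R `^ (3^-1))%:E <
                   Xrz xi r z w - Ex P (Xrz xi r z))%E]
      <= (expR (- (c * theta `^ alpha)))%:E)%E.

(* Main.v *)
Require Import Defs.
From HB Require Import structures.
From mathcomp Require Import all_boot all_order all_algebra.
From mathcomp Require Import all_classical all_reals all_analysis.
From mathcomp Require Import measurable_realfun ring lra zify.
Set Implicit Arguments.
Unset Strict Implicit.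
Unset Printing Implicit Defensive.
Import Order.TTheory GRing.Theory Num.Theory.
Import numFieldNormedType.Exports.
Local Open Scope ring_scope.
Local Open Scope classical_set_scope.

(* The path to [(r, r)] is cut by [k] antidiagonals into pieces of scale
   [n ~ r/k], whose endpoints are rounded to cells of width [n^(2/3)].  A piece
   running from cell to cell costs, in units of [n^(1/3)], a parabola in the cell
   increment, and its excess over this parabola has the same stretched
   exponential tail as the point-to-point weight: extending the piece backwards
   and forwards to fixed points loses only a constant factor in probability.
   Pieces in different strips are independent, so a union bound over the chains of
   cell increments and of integer excess levels, with the parabola paying for the
   increments, shows that a tail exponent [beta <= 1] at scale [n] produces the
   bound [exp (C k ln k - c (th k^(1/3))^beta)] at scale [r].  Taking [k = th^beta]
   improves [beta] to [beta + beta^2/3]; after finitely many rounds the exponent is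
   [1], and then [k ~ (th / ln th)^(3/2)] gives the exponent [3/2] with the
   logarithmic correction.  Each round only costs a power of [r] in the range of
   [th], whence [zeta]. *)

(** The argument runs on the canonical space [env R], where translation is a map and locality means
    belonging to the sigma-algebra of a set of vertices. Weights are truncated below at 0 there, so
    that extending a path never lowers its weight; for the given [xi] this changes nothing almost
    surely. The union bound is a Chernoff bound with weight [exp (c/2 m^beta)] on level [m]. It
    relies on subadditivity of [x^beta], which stops at [beta = 1]. Two costs limit [k]. Each piece
    loses a multiple of [n^(1/3)], in total about [k^(2/3) r^(1/3)], so [k] stays below a multiple
    of [th^(3/2)]. The parabola is available only for the sum of the squared increments; shared
    among [k] pieces it leaves each a decay of rate [1/k], so summing over one increment costs a
    power of [k]. At [beta = 1] the entropy [k ln k] must stay below the gain [th k^(1/3)]: this is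
    the origin of the logarithm. A tail known only for [th <= n^eta] says nothing sharper about
    larger excesses. They form a separate overflow event of probability about
    [exp (- n^(eta beta))], which confines [th] to a power of [r]. *)

Definition cylinder {R : realType} (S : set vtx) : set (set (vtx -> R)) :=
  [set A | exists (s : seq vtx) (B : vtx -> set R),
     [/\ forall v, measurable (B v), forall v, v \in s -> S v &
         A = [set w | forall v, v \in s -> B v (w v)]]].

(** With [setT] this is the product sigma-algebra; a smaller [S] gives the events determined by the
    weights in [S], between which independence is stated. *)
Definition env (R : realType) := g_sigma_algebraType (@cylinder R setT).

Definition iid_law {R : realType} (Q : probability (env R) R)
    (nu : probability R R) : Prop :=
  forall (s : seq vtx) (B : vtx -> set R), uniq s ->
    (forall v, measurable (B v)) ->
    Q [set w | forall v, v \in s -> B v (w v)] = (\prod_(v <- s) nu (B v))%E.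

Definition pr {R : realType} (Q : probability (env R) R) (E : set (env R)) : R :=
  fine (Q E).

(** * Cylinder sets and local sigma-algebras *)

Section cylinders.
Context {R : realType}.
Implicit Types (S : set vtx) (E : set (env R)).

Lemma cylinder_setI S : setI_closed (@cylinder R S).
Proof.
move=> _ _ [s [B [mB sS ->]]] [t [C [mC tS ->]]].
exists (s ++ t), (fun v => (if v \in s then B v else setT) `&`
                           (if v \in t then C v else setT)); split.
- by move=> v; apply: measurableI; case: ifP.
- by move=> v; rewrite mem_cat => /orP[/sS|/tS].
- apply/seteqP; split=> w /=.
    by move=> [hB hC] v _; split; case: ifP => // h; [exact: hB|exact: hC].
  move=> h; split=> v vs; have := h v; rewrite mem_cat vs ?orbT => /(_ isT) [];
    by [].
Qed.

Lemma cylinder_subset S S' : S `<=` S' -> @cylinder R S `<=` cylinder S'.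
Proof. by move=> SS' _ [s [B [mB sS ->]]]; exists s, B; split => // v /sS /SS'. Qed.

Lemma sigma_cylinder_subset S S' : S `<=` S' ->
  <<s @cylinder R S >> `<=` <<s cylinder S' >>.
Proof. move=> SS'; apply: sub_smallest2r; first exact: smallest_sigma_algebra.
exact: cylinder_subset. Qed.

Lemma sigma_cylinder_measurable S E : <<s cylinder S >> E -> measurable E.
Proof. exact: sigma_cylinder_subset. Qed.

Lemma cylinder_uniq S A : @cylinder R S A -> exists (s : seq vtx) (B : vtx -> set R),
  [/\ uniq s, forall v, measurable (B v), forall v, v \in s -> S v &
         A = [set w | forall v, v \in s -> B v (w v)]].
Proof.
move=> [s [B [mB sS ->]]]; exists (undup s), B; split => //.
- exact: undup_uniq.
- by move=> v; rewrite mem_undup; exact: sS.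
- by apply/seteqP; split=> w /= h v; have := h v; rewrite mem_undup.
Qed.

Lemma cylinder_setT S : @cylinder R S setT.
Proof. by exists [::], (fun=> setT); split => //; apply/seteqP; split. Qed.

End cylinders.

(** Dynkin's pi-lambda argument: cylinders over [S] are stable under intersection and include the
    whole space. *)
Lemma cylinder_measure_unique {R : realType} (S : set vtx)
    (m1 m2 : {measure set (env R) -> \bar R}) :
  (forall A, cylinder S A -> m1 A = m2 A) -> (m1 setT < +oo)%E ->
  forall E, <<s cylinder S >> E -> m1 E = m2 E.
Proof.
move=> m12 m1oo; apply: (@g_sigma_algebra_measure_unique _ R (env R)
  (cylinder S) _ (fun=> setT)) => //.
- by move=> A hA; apply: (@sigma_cylinder_measurable _ S); exact: sub_sigma_algebra.
- by move=> _; exact: cylinder_setT.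
- by rewrite bigcup_const//; exists 0%N.
- exact: cylinder_setI.
Qed.

(** * Independence and stationarity of the environment *)

Section independence.
Context {R : realType} {Q : probability (env R) R} {nu : probability R R}.
Hypothesis QE : iid_law Q nu.
Implicit Types (S : set vtx) (E : set (env R)).

Lemma cylinder_indep S S' E E' : S `&` S' = set0 ->
  cylinder S E -> cylinder S' E' -> Q (E `&` E') = (Q E * Q E')%E.
Proof.
move=> SS' /cylinder_uniq[s [B [us mB sS ->]]] /cylinder_uniq[t [C [ut mC tS ->]]].
have dis v : v \in s -> v \in t -> False.
  by move=> /sS Sv /tS Sv'; have : (S `&` S') v by []; rewrite SS'.
have ust : uniq (s ++ t).
  rewrite cat_uniq us ut andbT /=; apply/hasPn => v vt; apply/negP => vs.
  exact: dis vs vt.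
pose D v := if v \in s then B v else C v.
have mD v : measurable (D v) by rewrite /D; case: ifP.
have -> : [set w : env R | forall v, v \in s -> B v (w v)] `&`
          [set w : env R | forall v, v \in t -> C v (w v)] =
          [set w : env R | forall v, v \in s ++ t -> D v (w v)].
  apply/seteqP; split=> w /=.
    move=> [hB hC] v; rewrite mem_cat /D; case: ifP => /= vs; first by move=> _; exact: hB.
    exact: hC.
  move=> h; split=> v vs; have := h v; rewrite mem_cat /D vs ?orbT => /(_ isT) //.
  by case: ifP => // vs'; case: (dis v).
rewrite !QE// big_cat /=; congr (_ * _)%E.
  by apply: eq_big_seq => v vs; rewrite /D vs.
by apply: eq_big_seq => v vs; rewrite /D; case: ifP => // vs'; case: (dis v).
Qed.

(** Two uniqueness arguments. For a fixed cylinder [F], the restriction of [Q] to [F] and the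
    multiple [Q F] of [Q] agree on cylinders over [S'], hence on their sigma-algebra; then the roles
    are exchanged. *)
Lemma sigma_indep S S' E E' : S `&` S' = set0 ->
  <<s cylinder S >> E -> <<s cylinder S' >> E' -> Q (E `&` E') = (Q E * Q E')%E.
Proof.
move=> SS' hE hE'.
have step1 (F F' : set (env R)) : cylinder S F -> <<s cylinder S' >> F' -> Q (F `&` F') = (Q F * Q F')%E.
  move=> hF hF'.
  have mF : measurable F by apply: (@sigma_cylinder_measurable _ S); exact: sub_sigma_algebra.
  have QF : Q F = (fine (Q F))%:E by rewrite fineK// fin_num_measure.
  rewrite setIC QF.
  have := @cylinder_measure_unique _ S' (mrestr Q mF)
    (mscale (NngNum (fine_ge0 (measure_ge0 Q F))) Q) _ _ F' hF'.
  rewrite /mrestr/mscale/=; apply.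
    move=> A hA; rewrite /mrestr/mscale/= setIC -QF; exact: cylinder_indep SS' _ hA.
  by rewrite /mrestr setTI ltey_eq fin_num_measure.
have mE' : measurable E' by exact: (@sigma_cylinder_measurable _ S').
have QE'' : Q E' = (fine (Q E'))%:E by rewrite fineK// fin_num_measure.
rewrite muleC QE''.
have := @cylinder_measure_unique _ S (mrestr Q mE')
  (mscale (NngNum (fine_ge0 (measure_ge0 Q E'))) Q) _ _ E hE.
rewrite /mrestr/mscale/=; apply.
  by move=> A hA; rewrite /mrestr/mscale/= -QE'' muleC; exact: step1.
by rewrite /mrestr setTI ltey_eq fin_num_measure.
Qed.

Lemma pr_indep S S' E E' : S `&` S' = set0 ->
  <<s cylinder S >> E -> <<s cylinder S' >> E' -> pr Q (E `&` E') = pr Q E * pr Q E'.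
Proof.
move=> SS' hE hE'; rewrite /pr (sigma_indep SS' hE hE') fineM//.
  by apply: fin_num_measure; exact: (@sigma_cylinder_measurable _ S).
by apply: fin_num_measure; exact: (@sigma_cylinder_measurable _ S').
Qed.

Definition env_shift (a : vtx) (w : env R) : env R := fun v => w (v.1 + a.1, v.2 + a.2)%R.

Lemma measurable_shift a : measurable_fun setT (env_shift a).
Proof.
apply: (@measurability _ _ (env R) (env R) setT (env_shift a) (cylinder setT)) => //.
move=> _ [_ [s [B [mB _ ->]]] <-]; rewrite setTI; apply: sub_sigma_algebra.
exists [seq (v.1 + a.1, v.2 + a.2) | v <- s], (fun v => B (v.1 - a.1, v.2 - a.2)); split => //.
apply/seteqP; split=> w /= h.
  by move=> _ /mapP[v vs ->] /=; rewrite !addrK; have := h v vs; rewrite /env_shift; case: (v).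
move=> v vs; have := h (v.1 + a.1, v.2 + a.2) (map_f _ vs); rewrite /= !addrK /env_shift.
by case: (v).
Qed.

(** The preimage of a cylinder is a cylinder over translated sites with the same factors, and the
    product of marginals does not see positions. *)
Lemma shift_law a E : measurable E -> Q (env_shift a @^-1` E) = Q E.
Proof.
move=> mE.
have := @cylinder_measure_unique _ setT (pushforward Q (env_shift a)) Q _ _ E mE.
apply => //.
- exact: measurable_shift.
- move=> msh _ /cylinder_uniq[s [B [us mB _ ->]]]; rewrite /pushforward/= QE//.
  pose f (v : vtx) := (v.1 + a.1, v.2 + a.2).
  pose g (v : vtx) := (v.1 - a.1, v.2 - a.2).
  have fg : cancel f g by case=> x y; rewrite /f/g/= !addrK.
  transitivity (Q [set w | forall v, v \in map f s -> (B \o g) v (w v)]).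
    congr (Q _); apply/seteqP; split=> w /= h.
      by move=> _ /mapP[v vs ->]; rewrite /= fg; exact: h.
    by move=> v vs; have := h (f v) (map_f _ vs); rewrite /= fg.
  rewrite QE.
  + by rewrite big_map; apply: eq_bigr => v _ /=; rewrite fg.
  + by rewrite map_inj_uniq //; exact: can_inj fg.
  + by move=> v; exact: mB.
- move=> msh; change (Q (env_shift a @^-1` setT) < +oo)%E.
  by rewrite preimage_setT ltey_eq fin_num_measure.
Qed.

Lemma pr_shift a E : measurable E -> pr Q (env_shift a @^-1` E) = pr Q E.
Proof. by move=> mE; rewrite /pr shift_law. Qed.

End independence.

Lemma measurable_exists d (X : measurableType d) (I : countType) (F : I -> set X) :
  (forall i, measurable (F i)) -> measurable [set w | exists i, F i w].
Proof.
move=> hF; pose G n := if unpickle n is Some i then F i else set0.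
have -> : [set w | exists i, F i w] = \bigcup_n G n.
  apply/seteqP; split => w /=.
    by move=> [t Ft]; exists (pickle t) => //; rewrite /G pickleK.
  by move=> [n _]; rewrite /G; case: unpickle => // t Ft; exists t.
by apply: bigcupT_measurable => n; rewrite /G; case: unpickle.
Qed.

(** * Directed paths *)

Section paths.
Context {R : realType}.
Implicit Types (w : env R) (u v : vtx) (s t : seq bool).

(* The weight of the last vertex is left out, so that weights add under
   concatenation. *)
Fixpoint wt w u s : R :=
  if s is b :: s' then Num.max (w u) 0 + wt w (step u b) s' else 0.

Definition endp u s : vtx := foldl step u s.

Definition height u : int := u.1 + u.2.

(** Antidiagonal coordinates: [a] measures progress along the diagonal, [y] transversal
    displacement. Only vertices of even height have this form. *)
Definition pt (a y : int) : vtx := (a - y, a + y).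

Definition strip (a b : int) : set vtx := [set v | (a <= height v < b)%R].

Lemma endp_cat u s t : endp u (s ++ t) = endp (endp u s) t.
Proof. exact: foldl_cat. Qed.

Lemma wt_cat w u s t : wt w u (s ++ t) = wt w u s + wt w (endp u s) t.
Proof. by elim: s u => [|b s IH] u /=; rewrite ?add0r// IH addrA. Qed.

Lemma wt_ge0 w u s : 0 <= wt w u s.
Proof. by elim: s u => [|b s IH] u //=; rewrite addr_ge0// le_max lexx orbT. Qed.

Lemma height_step u b : height (step u b) = height u + 1.
Proof. by case: b; rewrite /height /step /=; lia. Qed.

Lemma height_endp u s : height (endp u s) = height u + (size s)%:Z.
Proof.
elim: s u => [|b s IH] u /=; first by rewrite addr0.
by rewrite /endp /= -/(endp _ _) IH height_step; lia.
Qed.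

Lemma height_pt a y : height (pt a y) = a * 2.
Proof. by rewrite /height/pt/=; lia. Qed.

Lemma endp_shift u (a : vtx) s :
  endp (u.1 + a.1, u.2 + a.2) s = ((endp u s).1 + a.1, (endp u s).2 + a.2).
Proof.
elim: s u => [|b s IH] u //; rewrite /endp /= -!/(endp _ _) -IH.
by congr (endp _ _); case: b; rewrite /step /=; congr pair; lia.
Qed.

Lemma wt_shift w u (a : vtx) s : wt (env_shift a w) u s = wt w (u.1 + a.1, u.2 + a.2) s.
Proof.
elim: s u => [|b s IH] u //=; rewrite {}IH; congr (_ + _).
by congr wt; case: b; rewrite /step /=; congr pair; lia.
Qed.

Lemma count_endp u s : (endp u s).1 = u.1 + (count id s)%:Z.
Proof.
elim: s u => [|b s IH] u /=; first by rewrite addr0.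
by rewrite /endp /= -/(endp _ _) IH; case: b; rewrite /step/=; lia.
Qed.

Lemma endp_eqP u v s : endp u s = v <->
  height u + (size s)%:Z = height v /\ u.1 + (count id s)%:Z = v.1.
Proof.
split=> [<-|[]]; first by rewrite height_endp count_endp.
rewrite -height_endp -count_endp /height; case: (endp u s) => x y /=.
by case: v => x' y' /= h1 h2; congr pair; lia.
Qed.

Lemma exists_path u v : (u.1 <= v.1)%R -> (u.2 <= v.2)%R -> exists s, endp u s = v.
Proof.
move=> h1 h2; exists (nseq `|v.1 - u.1|%N true ++ nseq `|v.2 - u.2|%N false).
apply/endp_eqP; rewrite size_cat !size_nseq count_cat !count_nseq /= /height; lia.
Qed.

Lemma endp_ge u s : (u.1 <= (endp u s).1)%R /\ (u.2 <= (endp u s).2)%R.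
Proof.
elim: s u => [|b s IH] u //; rewrite /endp /= -/(endp _ _).
by have := IH (step u b); case: b => /=; lia.
Qed.

(** The strip is half-open because [wt] omits the last vertex; this makes consecutive pieces of a
    path independent. *)
Lemma sigma_wt (S : set vtx) u s (x : R) :
  strip (height u) (height u + (size s)%:Z) `<=` S ->
  <<s cylinder S >> [set w : env R | x < wt w u s].
Proof.
move=> uS.
suff mf : @measurable_fun _ _ (g_sigma_algebraType (@cylinder R S)) _ setT (fun w => wt w u s).
  have := mf measurableT _ (measurable_itv (Interval (BRight x) (BInfty _ false))).
  rewrite setTI; congr (_ _); apply/seteqP; split=> w /=;
    by rewrite in_itv/= andbT.
elim: s u uS => [|b s IH] u uS /=; first exact: measurable_cst.
apply: measurable_funD; last first.
  apply: IH => v; rewrite /strip/= height_step => h; apply: uS.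
  by rewrite /strip /=; lia.
apply: measurable_maxr; last exact: measurable_cst.
move=> _ B mB; rewrite setTI; apply: sub_sigma_algebra.
exists [:: u], (fun=> B); split => //.
  by move=> v; rewrite inE => /eqP ->; apply: uS; rewrite /strip/=; lia.
apply/seteqP; split=> w /=; first by move=> h v; rewrite inE => /eqP ->.
by apply; rewrite inE.
Qed.

Lemma sigma_exists (S : set vtx) (T : countType) (F : T -> set (env R)) :
  (forall i, <<s cylinder S >> (F i)) -> <<s cylinder S >> [set w | exists i, F i w].
Proof. exact: (@measurable_exists _ (g_sigma_algebraType (@cylinder R S))). Qed.

Lemma sigma_andP (S : set vtx) (P : Prop) (F : set (env R)) :
  (P -> <<s cylinder S >> F) -> <<s cylinder S >> [set w | P /\ F w].
Proof.
move=> h; have [p|np] := pselect P.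
  have -> : [set w | P /\ F w] = F by apply/seteqP; split=> w /=; tauto.
  exact: h.
have -> : [set w | P /\ F w] = set0 by apply/seteqP; split=> w /=; tauto.
exact: sigma_algebra0.
Qed.

(* The extra final step of [rcons s true] serves to count the weight of [v]. *)
Definition lpt u v (x : R) : set (env R) :=
  [set w | exists s, endp u s = v /\ x < wt w u (rcons s true)].

Lemma sigma_lpt S u v x : strip (height u) (height v + 1) `<=` S ->
  <<s cylinder S >> (lpt u v x).
Proof.
move=> uvS; apply: sigma_exists => s; apply: sigma_andP => us.
apply: sigma_wt; rewrite size_rcons; apply: subset_trans uvS.
by rewrite -us height_endp => z; rewrite /strip/=; lia.
Qed.

Lemma measurable_lpt u v x : measurable (lpt u v x).
Proof. exact: (@sigma_lpt setT). Qed.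

Lemma lpt_le u v x y : x <= y -> lpt u v y `<=` lpt u v x.
Proof. by move=> xy w [s [us h]]; exists s; split => //; exact: le_lt_trans h. Qed.

Lemma wt_rcons_irr w u s b c : wt w u (rcons s b) = wt w u (rcons s c).
Proof. by rewrite -!cats1 !wt_cat. Qed.

Lemma lpt_mono u v v' x : (v.1 <= v'.1)%R -> (v.2 <= v'.2)%R ->
  lpt u v x `<=` lpt u v' x.
Proof.
move=> h1 h2 w [s [us h]]; have [t vt] := exists_path h1 h2.
exists (s ++ t); split; first by rewrite endp_cat us.
apply: (lt_le_trans h); rewrite -!cats1 -catA !wt_cat lerD2l us.
(* If [t] is nonempty, its first step carries the weight of [v] that the dummy last step counted
   before. *)
case: t vt => [|b t] /= _; first by rewrite add0r.
by rewrite addr0 -addrA lerDl addr_ge0 ?wt_ge0// addr0 le_max lexx orbT.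
Qed.

Lemma lpt_cat u v v' u' w x y b : step v b = v' ->
  lpt u v x w -> lpt v' u' y w -> lpt u u' (x + y) w.
Proof.
move=> vv' [s [us h]] [t [vt h']]; exists (s ++ b :: t); split.
  by rewrite -cat_rcons endp_cat -cats1 endp_cat us /= vv'.
rewrite rcons_cat rcons_cons -cat_rcons wt_cat -cats1 endp_cat us /= vv' cats1.
by rewrite (wt_rcons_irr _ _ _ _ true); exact: ltrD.
Qed.

Lemma lpt_shift u v (a : vtx) x :
  env_shift a @^-1` lpt u v x = lpt (u.1 + a.1, u.2 + a.2) (v.1 + a.1, v.2 + a.2) x.
Proof.
apply/seteqP; split=> w /= [s [us h]]; exists s; move: h; rewrite wt_shift => h;
  split => //; rewrite endp_shift in us *; first by rewrite us.
by move: us; case: (endp u s) => ? ?; case: (v) => ? ? /= [] /addIr -> /addIr ->.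
Qed.

Definition Xe (r : nat) (z : int) (x : R) := lpt (1, 1) (r%:Z - z, r%:Z + z) x.

End paths.

(** * Real-valued probabilities and stationarity of passage events *)

Section pr_lemmas.
Context {R : realType} (Q : probability (env R) R).
Implicit Types E F : set (env R).

Lemma pr_ge0 E : 0 <= pr Q E.
Proof. by rewrite /pr fine_ge0. Qed.

Lemma prE E : measurable E -> Q E = (pr Q E)%:E.
Proof. by move=> mE; rewrite /pr fineK// fin_num_measure. Qed.

Lemma pr_le1 E : measurable E -> pr Q E <= 1.
Proof. by move=> mE; rewrite -lee_fin -prE// probability_le1. Qed.

Lemma le_pr E F : measurable E -> measurable F -> E `<=` F -> pr Q E <= pr Q F.
Proof. by move=> mE mF EF; rewrite -lee_fin -!prE// le_measure// inE. Qed.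

Lemma pr0 : pr Q set0 = 0. Proof. by rewrite /pr measure0. Qed.

Lemma prT : pr Q setT = 1. Proof. by rewrite /pr probability_setT. Qed.

Lemma prU E F : measurable E -> measurable F -> pr Q (E `|` F) <= pr Q E + pr Q F.
Proof.
move=> mE mF; rewrite -lee_fin EFinD -!prE//; last exact: measurableU.
exact: measureU2.
Qed.

Lemma pr_exists (T : eqType) (s : seq T) (F : T -> set (env R)) :
  (forall t, measurable (F t)) ->
  pr Q [set w | exists2 t, t \in s & F t w] <= \sum_(t <- s) pr Q (F t).
Proof.
move=> mF.
have e t0 s0 : [set w | exists2 t, t \in t0 :: s0 & F t w] =
    F t0 `|` [set w | exists2 t, t \in s0 & F t w].
  apply/seteqP; split=> w /=.
    by move=> [t]; rewrite inE => /orP[/eqP -> |ts Ft]; [left|right; exists t].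
  move=> [Ft|[t ts Ft]]; first by exists t0 => //; rewrite mem_head.
  by exists t => //; rewrite inE ts orbT.
have e0 : [set w | exists2 t, t \in [::] & F t w] = set0.
  by apply/seteqP; split => w //= [].
have ms (s0 : seq T) : measurable [set w | exists2 t, t \in s0 & F t w].
  by elim: s0 => [|t0 s0 IH]; rewrite ?e0// e; exact: measurableU.
elim: s => [|t0 s IH]; first by rewrite e0 pr0 big_nil.
by rewrite e big_cons (le_trans (prU _ _))// lerD2l.
Qed.

Context {nu : probability R R} (QE : iid_law Q nu).

(** The [- 1] appears because [Xe r z] starts at [(1, 1) = pt 1 0] and ends at [pt r z]. *)
Lemma pr_lpt_pt (a y : int) (r : nat) (z : int) (x : R) :
  pr Q (lpt (pt a y) (pt (a + r%:Z - 1) (y + z)) x) = pr Q (Xe r z x).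
Proof.
rewrite -[RHS](pr_shift QE (a - y - 1, a + y - 1) (measurable_lpt _ _ _)) lpt_shift.
by congr (pr Q (lpt _ _ _)); rewrite /pt /=; congr pair; lia.
Qed.

End pr_lemmas.

(** * From points to cells *)

Section backup.
Context {R : realType} {Q : probability (env R) R} {nu : probability R R}.
Hypothesis QE : iid_law Q nu.

(* Splitting [\bigcup_n A n] according to the first index that occurs makes the
   pieces disjoint, so that independence of [A n] and [F n] suffices. *)
Lemma first_hit (S S' : set vtx) (A F : nat -> set (env R)) (p : R) :
  S `&` S' = set0 -> 0 <= p ->
  (forall i, <<s cylinder S >> (A i)) -> (forall i, <<s cylinder S' >> (F i)) ->
  (forall i, A i = set0 \/ p <= pr Q (F i)) ->
  p * pr Q (\bigcup_i A i) <= pr Q (\bigcup_i (A i `&` F i)).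
Proof.
move=> SS' p0 sA sF pF.
have mA i : measurable (A i) by exact: (@sigma_cylinder_measurable _ S).
have mF i : measurable (F i) by exact: (@sigma_cylinder_measurable _ S').
have mUA : measurable (\bigcup_i A i) by exact: bigcupT_measurable.
have mUAF : measurable (\bigcup_i (A i `&` F i)).
  by apply: bigcupT_measurable => i; exact: measurableI.
pose D := seqDU A.
have sD i : <<s cylinder S >> (D i).
  apply: (@measurableD _ (g_sigma_algebraType (@cylinder R S))); first exact: sA.
  by apply: (@bigsetU_measurable _ (g_sigma_algebraType (@cylinder R S))) => k _; exact: sA.
have mD i : measurable (D i) by exact: (@sigma_cylinder_measurable _ S).
have UD : \bigcup_i A i = \bigcup_i D i by rewrite /D seqDU_bigcup_eq.
rewrite -lee_fin EFinM -!prE//.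
have -> : Q (\bigcup_i A i) = (\sum_(0 <= i <oo) Q (D i))%E.
  rewrite UD; apply: measure_semi_bigcup => //; last by rewrite -UD.
  exact: trivIset_seqDU.
apply: (@le_trans _ _ (Q (\bigcup_i (D i `&` F i)))); last first.
  apply: le_measure; rewrite ?inE//.
    by apply: bigcupT_measurable => i; exact: measurableI.
  apply: subset_bigcup => i _ w [Dw Fw]; split => //.
  by case: Dw.
have -> : Q (\bigcup_i (D i `&` F i)) = (\sum_(0 <= i <oo) Q (D i `&` F i))%E.
  apply: measure_semi_bigcup => //; [by move=> i; exact: measurableI| |
    by apply: bigcupT_measurable => i; exact: measurableI].
  apply/trivIsetP => i k _ _ ik.
  have /trivIsetP/(_ i k Logic.I Logic.I ik) := @trivIset_seqDU _ A.
  rewrite -/D => DD; rewrite -subset0 => w [[Dw _] [Dw' _]].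
  by rewrite -DD.
rewrite -nneseriesZl//; apply: lee_nneseries => [i _ _|i _].
  by rewrite mule_ge0// lee_fin.
rewrite (sigma_indep QE SS' (sD i) (sF i)).
have [A0|pFi] := pF i.
  have -> : D i = set0 by rewrite -subset0 => w [] ; rewrite A0.
  by rewrite measure0 mule0 mul0e.
by rewrite muleC lee_pmul// [leRHS]prE// lee_fin.
Qed.

Lemma first_hit_countable (T : countType) (S S' : set vtx) (A F : T -> set (env R)) (p : R) :
  S `&` S' = set0 -> 0 <= p ->
  (forall i, <<s cylinder S >> (A i)) -> (forall i, <<s cylinder S' >> (F i)) ->
  (forall i, A i = set0 \/ p <= pr Q (F i)) ->
  p * pr Q [set w | exists i, A i w] <= pr Q [set w | exists i, A i w /\ F i w].
Proof.
move=> SS' p0 sA sF pF.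
pose A' k := if unpickle k is Some i then A i else set0.
pose F' k := if unpickle k is Some i then F i else setT.
have -> : [set w | exists i, A i w] = \bigcup_k A' k.
  apply/seteqP; split=> w /=.
    by move=> [i hi]; exists (pickle i) => //; rewrite /A' pickleK.
  by move=> [k _]; rewrite /A'; case: unpickle => [i hi|//]; exists i.
have -> : [set w | exists i, A i w /\ F i w] = \bigcup_k (A' k `&` F' k).
  apply/seteqP; split=> w /=.
    by move=> [i hi]; exists (pickle i) => //; rewrite /A'/F' pickleK.
  by move=> [k _]; rewrite /A'/F'; case: unpickle => [i hi|[]//]; exists i.
apply: (first_hit SS') => // k; rewrite /A'/F'; case: unpickle => [i|].
- exact: sA.
- exact: sigma_algebra0.
- exact: sF.
- exact: (@measurableT _ (g_sigma_algebraType (cylinder S'))).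
- exact: pF.
- by left.
Qed.

Lemma lpt_wt_cat (v v' u : vtx) s x y (w : env R) : endp v s = v' -> x < wt w v s ->
  lpt v' u y w -> lpt v u (x + y) w.
Proof.
move=> vs h [t [vt h']]; exists (s ++ t); split; first by rewrite endp_cat vs.
by rewrite rcons_cat wt_cat vs; exact: ltrD.
Qed.

Definition in_cell (wd : nat) (j y : int) : bool :=
  (j * wd%:Z <= y) && (y < (j + 1) * wd%:Z).

Definition cross_path (wd n : nat) (a j j' : int) (p : int * int * seq bool) : bool :=
  [&& in_cell wd j p.1.1, in_cell wd j' p.1.2 &
      endp (pt a p.1.1) p.2 == pt (a + n%:Z) p.1.2].

(** The endpoints vary over their cells inside the event: a union bound over them would cost a power
    of [n], whereas [backup] costs a constant factor. *)
Definition cross (wd n : nat) (a j j' : int) (x : R) : set (env R) :=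
  [set w | exists p, cross_path wd n a j j' p /\ x < wt w (pt a p.1.1) p.2].

Lemma cross_size wd n a j j' p : cross_path wd n a j j' p -> size p.2 = (n * 2)%N.
Proof.
move=> /and3P[_ _ /eqP /endp_eqP[h _]].
by move: h; rewrite !height_pt; lia.
Qed.

Lemma sigma_cross S wd n a j j' x : strip (a * 2) ((a + n%:Z) * 2) `<=` S ->
  <<s cylinder S >> (cross wd n a j j' x).
Proof.
move=> hS; apply: sigma_exists => p; apply: sigma_andP => hp.
apply: sigma_wt; apply: subset_trans hS.
by rewrite (cross_size hp) height_pt => z; rewrite /strip/=; lia.
Qed.

Lemma measurable_cross wd n a j j' x : measurable (cross wd n a j j' x).
Proof. exact: (@sigma_cross setT). Qed.

(* A crossing exceeding [x] is completed to a point-to-point path by two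
   independent pieces, each exceeding [b] with probability at least [1/2]. *)
Lemma backup (n wd : nat) (a j j' : int) (x b : R) :
  (forall z : int, (`|z|%N <= wd)%N -> 2^-1 <= pr Q (Xe n z b)) ->
  pr Q (cross wd n a j j' x) <=
    4 * pr Q (Xe (3 * n) ((j' - j) * wd%:Z) (b + x + b)).
Proof.
move=> hb.
(* Both completing pieces have scale [n], so the completed path has scale [3 * n]. Displacements
   inside a cell are below [wd], which puts both pieces in the range of the hypothesis. *)
pose lo (p : int * int * seq bool) : set (env R) :=
  lpt (pt (a - n%:Z) (j * wd%:Z)) (pt (a - 1) p.1.1) b.
pose hi (p : int * int * seq bool) : set (env R) :=
  lpt (pt (a + n%:Z) p.1.2) (pt (a + n%:Z + n%:Z - 1) (j' * wd%:Z)) b.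
pose S := strip (a * 2) ((a + n%:Z) * 2).
pose Slo : set vtx := [set v | (height v < a * 2)%R].
pose Shi : set vtx := [set v | ((a + n%:Z) * 2 <= height v)%R].
have slo p : <<s cylinder Slo >> (lo p).
  by apply: sigma_lpt => v; rewrite /strip/Slo/= !height_pt; lia.
have shi p : <<s cylinder Shi >> (hi p).
  by apply: sigma_lpt => v; rewrite /strip/Shi/= !height_pt; lia.
pose A p : set (env R) :=
  [set w | cross_path wd n a j j' p /\ x < wt w (pt a p.1.1) p.2].
have SS' : S `&` (Slo `|` Shi) = set0.
  rewrite -subset0 => v; rewrite /S /strip/Slo/Shi/= => -[/andP[h1 h2] [|]]; lia.
have LH : Slo `&` Shi = set0.
  by rewrite -subset0 => v; rewrite /Slo/Shi/= => -[]; lia.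
have sA p : <<s cylinder S >> (A p).
  apply: sigma_andP => hp; apply: sigma_wt.
  by rewrite (cross_size hp) height_pt /S => z; rewrite /strip/=; lia.
have side (p : int * int * seq bool) : A p = set0 \/ 4^-1 <= pr Q (lo p `&` hi p).
  have [hp|np] := boolP (cross_path wd n a j j' p); last first.
    by left; rewrite -subset0 => w -[hp]; rewrite hp in np.
  right; rewrite (pr_indep QE LH (slo p) (shi p)).
  move/and3P: hp => [/andP[h1 h2] /andP[h3 h4] _].
  have e1 : pr Q (lo p) = pr Q (Xe n (p.1.1 - j * wd%:Z) b).
    rewrite -(pr_lpt_pt QE (a - n%:Z) (j * wd%:Z)) /lo.
    by congr (pr Q (lpt _ _ _)); congr pt; lia.
  have e2 : pr Q (hi p) = pr Q (Xe n (j' * wd%:Z - p.1.2) b).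
    rewrite -(pr_lpt_pt QE (a + n%:Z) p.1.2) /hi.
    by congr (pr Q (lpt _ _ _)); congr pt; lia.
  have -> : 4^-1 = 2^-1 * 2^-1 :> R by lra.
  by apply: ler_pM; rewrite ?e1 ?e2//; apply: hb; lia.
have main : 4^-1 * pr Q (cross wd n a j j' x) <=
    pr Q [set w | exists p, A p w /\ (lo p `&` hi p) w].
  apply: (first_hit_countable SS') => //.
  move=> p.
  apply: (@measurableI _ (g_sigma_algebraType (cylinder (Slo `|` Shi)))).
    by apply: sigma_cylinder_subset (slo p) => v; left.
  by apply: sigma_cylinder_subset (shi p) => v; right.
rewrite -ler_pdivrMl// (le_trans main)//.
rewrite -(pr_lpt_pt QE (a - n%:Z) (j * wd%:Z)).
apply: le_pr; [|exact: measurable_lpt|].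
  apply: (@sigma_exists _ setT) => p.
  apply: (@measurableI _ (env R) (A p) (lo p `&` hi p)).
    exact: (@sigma_cylinder_measurable _ S).
  by apply: measurableI; exact: measurable_lpt.
move=> w [p [[/and3P[_ _ /eqP hs] hx] [low hiw]]].
(* [lo] ends two antidiagonals before the crossing starts. It is first extended by one vertex at the
   odd height in between, then joined by a single step. *)
have low' : lpt (pt (a - n%:Z) (j * wd%:Z)) (a - p.1.1, a - 1 + p.1.1) b w.
  by apply: lpt_mono low => /=; lia.
have := lpt_wt_cat hs hx hiw.
have st : step (a - p.1.1, a - 1 + p.1.1) false = pt a p.1.1.
  by rewrite /step/pt/=; congr pair; lia.
move=> /(lpt_cat st low'); rewrite addrA.
by congr (lpt _ _ _ _); rewrite /pt; congr pair; lia.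
Qed.

End backup.

(** * Union bound over chains of cells *)

Section chain.
Context {R : realType} {Q : probability (env R) R} {nu : probability R R}.
Hypothesis QE : iid_law Q nu.
Variables (n : nat) (L : seq (int * nat)) (Ev : int -> int -> int * nat -> set (env R)).
Variables (v p : int * nat -> R).
Hypothesis sEv : forall a j q, <<s cylinder (strip (a * 2) ((a + n%:Z) * 2)) >> (Ev a j q).
Hypothesis pEv : forall a j q, q \in L -> pr Q (Ev a j q) <= p q.
Hypothesis v_gt0 : forall q, 0 < v q.

(* Some sequence of [k] labels of [L] occurs along consecutive strips with the
   product of its weights [v] at least [y]. *)
Fixpoint chain (k : nat) (a j : int) (y : R) : set (env R) :=
  if k is k'.+1 then
    [set w | exists2 q, q \in L &
      (Ev a j q `&` chain k' (a + n%:Z) (j + q.1) (y / v q)) w]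
  else [set w | y <= 1].

Lemma sigma_chain k a j y : <<s cylinder [set u | a * 2 <= height u]%R >> (chain k a j y).
Proof.
elim: k a j y => [|k IH] a j y.
  have [y1|y1] := leP y 1.
    have -> : chain 0 a j y = setT by apply/seteqP; split => w.
    exact: (@measurableT _ (g_sigma_algebraType (cylinder _))).
  have -> : chain 0 a j y = set0 by rewrite -subset0 => w /=; rewrite leNgt y1.
  exact: sigma_algebra0.
rewrite /=; have -> (F : int * nat -> set (env R)) :
    [set w | exists2 q, q \in L & F q w] = [set w | exists q, q \in L /\ F q w].
  by apply/seteqP; split=> w [q]; [exists q|case; exists q].
apply: sigma_exists => q; apply: sigma_andP => _.
apply: (@measurableI _ (g_sigma_algebraType (@cylinder R [set u | a * 2 <= height u]%R))).
  by apply: sigma_cylinder_subset (@sEv a j q) => u; rewrite /strip/=; lia.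
by apply: sigma_cylinder_subset (IH _ _ _) => u /=; lia.
Qed.

Lemma measurable_chain k a j y : measurable (chain k a j y).
Proof. exact: sigma_cylinder_measurable (@sigma_chain k a j y). Qed.

Lemma measurable_Ev a j q : measurable (Ev a j q).
Proof. exact: sigma_cylinder_measurable (@sEv a j q). Qed.

(** Chernoff bound by induction: a first label [q] has probability at most [p q], is independent of
    the later strips, and lowers their target to [y / v q], which yields the factor [v q * p q].
    With no piece left, [y <= 1] gives [1 <= 1 / y]. *)
Lemma pr_chain k a j y : 0 < y ->
  pr Q (chain k a j y) <= (\sum_(q <- L) v q * p q) ^+ k / y.
Proof.
elim: k a j y => [|k IH] a j y y0.
  rewrite expr0 div1r; have [y1|y1] := leP y 1.
    by rewrite (le_trans (pr_le1 _ (measurable_chain _ _ _ _)))// invf_ge1.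
  have -> : chain 0 a j y = set0 by rewrite -subset0 => w /=; rewrite leNgt y1.
  by rewrite pr0 invr_ge0 ltW.
apply: (le_trans (pr_exists _ L _)) => [q|].
  by apply: measurableI; [exact: measurable_Ev|exact: measurable_chain].
rewrite exprS -mulrA mulr_suml; rewrite big_seq [leRHS]big_seq.
apply: ler_sum => q qL.
rewrite (@pr_indep _ _ _ QE (strip (a * 2) ((a + n%:Z) * 2))
  [set u | (a + n%:Z) * 2 <= height u]%R) //; last exact: sigma_chain.
  have yv : 0 < y / v q by rewrite divr_gt0.
  apply: (@le_trans _ _ (p q * ((\sum_(q <- L) v q * p q) ^+ k / (y / v q)))).
    by apply: ler_pM; rewrite ?pr_ge0 ?pEv// IH.
  by rewrite invf_div le_eqVlt; apply/orP; left; apply/eqP; ring.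
by rewrite -subset0 => u; rewrite /strip/= => -[]; lia.
Qed.

Fixpoint follows (a j : int) (qs : seq (int * nat)) (w : env R) : Prop :=
  if qs is q :: qs' then
    [/\ q \in L, Ev a j q w & follows (a + n%:Z) (j + q.1) qs' w]
  else True.

Lemma follows_chain a j qs w y : follows a j qs w ->
  y <= \prod_(q <- qs) v q -> chain (size qs) a j y w.
Proof.
elim: qs a j y => [|q qs IH] a j y /=; first by rewrite big_nil.
move=> [qL Eq fol]; rewrite big_cons => hy; exists q => //; split => //.
by apply: IH => //; rewrite ler_pdivrMr// mulrC.
Qed.

End chain.

(* [0] is listed twice, which is harmless in a union bound. *)
Definition int_range (N : nat) : seq int :=
  [seq i%:Z | i <- iota 0 N.+1] ++ [seq - i%:Z | i <- iota 0 N.+1].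

Arguments int_range : simpl never.

Lemma mem_int_range N (i : int) : (i \in int_range N) = (`|i|%N <= N)%N.
Proof.
rewrite mem_cat; apply/orP/idP => [[]/mapP[k]|h]; first by rewrite mem_iota; lia.
  by rewrite mem_iota; lia.
have [i0|i0] := leP 0 i; [left|right]; apply/mapP; exists `|i|%N.
all: rewrite ?mem_iota; lia.
Qed.

Lemma size_int_range N : size (int_range N) = N.+1.*2.
Proof. by rewrite size_cat !size_map !size_iota addnn. Qed.

Lemma exists_cell (wd : nat) (y : int) : (0 < wd)%N -> exists j, in_cell wd j y.
Proof.
move=> wd_gt0; exists (y %/ wd%:Z)%Z; rewrite /in_cell; apply/andP; split.
  by rewrite lez_floor//; lia.
by apply: ltz_ceil; lia.
Qed.

(** * Cutting a path into labelled pieces *)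

Section decomposition.
Context {R : realType}.
Variables (n wd : nat) (thr : int -> nat -> R) (lvl : nat) (c : R).
Hypothesis wd_gt0 : (0 < wd)%N.
Hypothesis c_gt0 : 0 < c.
Hypothesis thrS : forall d m, thr d m.+1 = thr d m + c.

(** A piece of [2 n] steps moves transversally by at most [n]; since its endpoints lie inside cells,
    the index can change by [n + 1], even for cells of width 1. *)
Definition levels : seq (int * nat) :=
  [seq (d, m) | d <- int_range n.+1, m <- iota 0 lvl.+1].

(* Label [(d, m)]: the cell index increases by [d] and the level [m] is needed to
   bound the weight; level [0] imposes nothing. *)
Definition level_event (a j : int) (q : int * nat) : set (env R) :=
  if q.2 is m.+1 then cross wd n a j (j + q.1) (thr q.1 m) else setT.

(** Crossings beyond the last level [lvl]. Bounding the starting cell by [i * n.+1] keeps the number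
    of cases polynomial. *)
Definition overflow (k : nat) (a j : int) : set (env R) :=
  [set w | exists i j' d, [/\ (i < k)%N, (`|j' - j|%N <= i * n.+1)%N, (`|d|%N <= n.+1)%N &
     cross wd n (a + i%:Z * n%:Z) j' (j' + d) (thr d lvl) w]].

Lemma sigma_level_event a j q :
  <<s cylinder (strip (a * 2) ((a + n%:Z) * 2)) >> (level_event a j q).
Proof.
rewrite /level_event; case: q.2 => [|m]; last exact: sigma_cross.
exact: (@measurableT _ (g_sigma_algebraType (cylinder _))).
Qed.

Lemma exists_level d x : exists m, x <= thr d m /\ (if m is m'.+1 then thr d m' < x else True).
Proof.
have thrE m : thr d m = thr d 0%N + m%:R * c.
  by elim: m => [|m IH]; rewrite ?mul0r ?addr0// thrS IH -[m.+1]addn1 natrD; ring.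
have ex : exists m, x <= thr d m.
  exists (Num.truncn (`|x - thr d 0%N| / c)).+1; rewrite thrE.
  have : `|x - thr d 0%N| / c <= (Num.truncn (`|x - thr d 0%N| / c)).+1%:R.
    by rewrite ltW// truncnS_gt.
  by rewrite ler_pdivrMr// => h; rewrite -lerBlDl (le_trans (ler_norm _)).
case: (ex_minnP ex) => m xm mmin; exists m; split => //.
case: m xm mmin => // m xm mmin; rewrite ltNge; apply/negP => /mmin.
by rewrite ltnn.
Qed.

(** The path is cut every [2 n] steps and each piece receives the smallest level bounding its
    weight. By minimality the piece exceeds the previous level, which is the event attached to its
    label. The first piece needing a level above [lvl] witnesses the overflow. *)
Lemma decompose k a j y s (w : env R) y' j' :
  endp (pt a y) s = pt (a + k%:Z * n%:Z) y' -> in_cell wd j y -> in_cell wd j' y' ->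
  (exists qs, [/\ size qs = k, follows n levels level_event a j qs w,
     j + \sum_(q <- qs) q.1 = j' &
     wt w (pt a y) s <= \sum_(q <- qs) thr q.1 q.2]) \/
  overflow k a j w.
Proof.
elim: k a j y s => [|k IH] a j y s hs cj cj'.
  left; exists [::]; rewrite !big_nil; split => //.
    suff yy' : y = y' by move: cj cj'; rewrite yy' /in_cell; nia.
    move/endp_eqP : hs => -[]; rewrite !height_pt /pt /=; have := count_size id s; lia.
  move/endp_eqP : hs => -[]; rewrite !height_pt /=.
  by case: s => //= b s; lia.
pose s1 := take (n * 2) s; pose s2 := drop (n * 2) s.
have sz : size s = (k.+1 * n * 2)%N.
  by move/endp_eqP : hs => -[]; rewrite !height_pt; lia.
have sz1 : size s1 = (n * 2)%N by rewrite size_takel// sz; lia.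
pose y1 := (endp (pt a y) s1).2 - a - n%:Z.
have e1 : endp (pt a y) s1 = pt (a + n%:Z) y1.
  have := height_endp (pt a y) s1; rewrite sz1 height_pt /height /y1 /pt.
  by case: (endp _ _) => u1 u2 /= h; congr pair; lia.
have [j1 cj1] := exists_cell y1 wd_gt0.
have hs2 : endp (pt (a + n%:Z) y1) s2 = pt (a + n%:Z + k%:Z * n%:Z) y'.
  by rewrite -e1 -endp_cat cat_take_drop hs; congr pt; lia.
have y1y : (`|y1 - y|%N <= n)%N.
  move/endp_eqP : e1 => -[_]; rewrite /pt /=; have := count_size id s1; rewrite sz1; lia.
have j1j : (`|j1 - j|%N <= n.+1)%N.
  by move: cj cj1 y1y; rewrite /in_cell; clear -wd_gt0; nia.
have [m [hm hm']] := exists_level (j1 - j) (wt w (pt a y) s1).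
have crossm x : x < wt w (pt a y) s1 -> cross wd n a j (j + (j1 - j)) x w.
  move=> hx; exists (y, y1, s1); split => //=; rewrite /cross_path /= cj.
  by rewrite addrC subrK cj1 e1 eqxx.
have [mL|Lm] := leqP m lvl; last first.
  right; exists 0%N, j, (j1 - j); split => //; first by rewrite subrr.
  rewrite mul0r addr0; apply: crossm.
  case: m hm hm' Lm => // m _ hm'; rewrite ltnS => Lm; apply: le_lt_trans hm'.
  rewrite -(subnK Lm) addnC; elim: (m - lvl)%N => [|i IHi]; first by rewrite addn0.
  by rewrite addnS thrS (le_trans IHi)// lerDl ltW.
have [[qs [sqs fol sumq hw]]|ov] := IH _ _ _ _ hs2 cj1 cj'; last first.
  right; case: ov => i [j2 [d [ik j2j1 dn cr]]]; exists i.+1, j2, d; split => //.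
    by clear -j2j1 j1j; lia.
  by rewrite (_ : a + _ = a + n%:Z + i%:Z * n%:Z)//; lia.
left; exists ((j1 - j, m) :: qs); rewrite /= !big_cons /=; split.
- by rewrite sqs.
- split.
  + by apply/allpairsP; exists (j1 - j, m); rewrite mem_int_range mem_iota; split.
  + rewrite /level_event /=; case: m hm hm' mL => [//|m] hm hm' mL.
    exact: crossm.
  + by rewrite (_ : j + (j1 - j) = j1)//; lia.
- by rewrite addrA (_ : j + (j1 - j) = j1)//; lia.
- by rewrite -(cat_take_drop (n * 2) s) wt_cat -/s1 -/s2 e1 lerD.
Qed.

End decomposition.

Section union_bound.
Context {R : realType} {Q : probability (env R) R} {nu : probability R R}.
Hypothesis QE : iid_law Q nu.
Variables (n wd : nat) (thr : int -> nat -> R) (lvl : nat) (c : R).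
Hypothesis wd_gt0 : (0 < wd)%N.
Hypothesis c_gt0 : 0 < c.
Hypothesis thrS : forall d m, thr d m.+1 = thr d m + c.

Lemma measurable_overflow k a j : measurable (overflow n wd thr lvl k a j).
Proof.
have -> : overflow n wd thr lvl k a j = [set w | exists i j' d,
    ((i < k)%N /\ (`|j' - j|%N <= i * n.+1)%N /\ (`|d|%N <= n.+1)%N) /\
     cross wd n (a + i%:Z * n%:Z) j' (j' + d) (thr d lvl) w].
  apply/seteqP; split=> w [i [j' [d]]].
    by move=> [h1 h2 h3 h4]; exists i, j', d.
  by move=> [[h1 [h2 h3]] h4]; exists i, j', d.
do 3 apply: (@sigma_exists _ setT) => ?.
by apply: (@sigma_andP _ setT) => _; exact: measurable_cross.
Qed.

Lemma pr_overflow k (a j : int) (p0 : R) :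
  (forall a' j' d, pr Q (cross wd n a' j' (j' + d) (thr d lvl)) <= p0) ->
  pr Q (overflow n wd thr lvl k a j) <=
    (k * (k * n.+1).+1.*2 * n.+2.*2)%:R * p0.
Proof.
move=> hp.
pose I : seq (nat * int * int) := [seq (id, d) | id <- [seq (i, e) | i <- iota 0 k, e <- int_range (k * n.+1)],
   d <- int_range n.+1].
pose F (t : nat * int * int) := cross wd n (a + t.1.1%:Z * n%:Z) (j + t.1.2)
   (j + t.1.2 + t.2) (thr t.2 lvl).
have mF t : measurable (F t) by exact: measurable_cross.
apply: (@le_trans _ _ (pr Q [set w | exists2 t, t \in I & F t w])).
  apply: le_pr; first exact: measurable_overflow.
    rewrite (_ : [set w | _] = [set w | exists t, t \in I /\ F t w]).
      apply: (@sigma_exists _ setT) => t; apply: (@sigma_andP _ setT) => _.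
      exact: measurable_cross.
    by apply/seteqP; split=> w [t]; [exists t|case; exists t].
  move=> w [i [j' [d [ik h1 h2 cr]]]]; exists (i, j' - j, d).
    apply/allpairsP; exists ((i, j' - j), d); split => //.
      apply/allpairsP; exists (i, j' - j); split => //.
        by rewrite mem_iota.
      rewrite mem_int_range (leq_trans h1)// leq_mul2r; lia.
    by rewrite mem_int_range.
  by rewrite /F /= (_ : j + (j' - j) = j')//; lia.
apply: (le_trans (pr_exists _ _ mF)).
apply: (@le_trans _ _ (\sum_(t <- I) p0)); first by apply: ler_sum => t _; exact: hp.
rewrite big_const_seq count_predT iter_addr_0 !size_allpairs !size_int_range size_iota.
by rewrite mulr_natl.
Qed.

(** Because of the [1 +], the target lies strictly above [(r - z, r + z)]. The extension is
    therefore nonempty and carries the weight of that vertex, which [lpt] counts and [wt] would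
    omit. *)
Lemma Xe_crossing r k z x : (r <= n * k)%N ->
  @Xe R r z x `<=` [set w | exists s,
     endp (pt 1 0) s = pt (1 + k%:Z * n%:Z) z /\ x < wt w (pt 1 0) s].
Proof.
move=> rnk w [s [hs hx]].
have [t ht] : exists t, endp (r%:Z - z, r%:Z + z) t = pt (1 + k%:Z * n%:Z) z.
  by apply: exists_path => /=; lia.
have e1 : pt 1 0 = (1, 1) by [].
exists (s ++ t); rewrite e1; split; first by rewrite endp_cat hs.
apply: (lt_le_trans hx); rewrite -cats1 !wt_cat lerD2l hs.
case: t ht => [|b t] /= ht; last by rewrite addr0 lerDl wt_ge0.
by case: ht => h1 h2; exfalso; move: h1 h2 rnk; lia.
Qed.

(** The path starts in cell 0, so the increments add up to [j']. The last premise is deterministic: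
    labels that allow a weight above [x] must have a large product of weights [v]. *)
Lemma Xe_union_bound r k z x j' (v p : int * nat -> R) (Y p0 : R) :
  (r <= n * k)%N -> in_cell wd j' z -> (forall q, 0 < v q) -> 0 < Y ->
  (forall a j q, q \in levels n lvl ->
     pr Q (level_event n wd thr a j q) <= p q) ->
  (forall a' j d, pr Q (cross wd n a' j (j + d) (thr d lvl)) <= p0) ->
  (forall qs : seq (int * nat), size qs = k -> \sum_(q <- qs) q.1 = j' ->
     x < \sum_(q <- qs) thr q.1 q.2 -> Y <= \prod_(q <- qs) v q) ->
  pr Q (Xe r z x) <= (\sum_(q <- levels n lvl) v q * p q) ^+ k / Y +
    (k * (k * n.+1).+1.*2 * n.+2.*2)%:R * p0.
Proof.
move=> rnk cz v0 Y0 hp hp0 hY.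
have mc : measurable (chain n (levels n lvl) (level_event n wd thr) v k 1 0 Y).
  apply: sigma_cylinder_measurable; apply: sigma_chain => *.
  exact: sigma_level_event.
apply: (@le_trans _ _ (pr Q (chain n (levels n lvl) (level_event n wd thr) v k 1 0 Y `|`
    overflow n wd thr lvl k 1 0))).
  apply: le_pr; first exact: measurable_lpt.
    by apply: measurableU => //; exact: measurable_overflow.
  move=> w /(Xe_crossing rnk)[s [hs hx]].
  have c0 : in_cell wd 0 0 by rewrite /in_cell; lia.
  have [[qs [sqs fol sumq hw]]|ov] := decompose lvl wd_gt0 c_gt0 thrS w hs c0 cz.
    left; rewrite -sqs; apply: (follows_chain _ fol) => //.
    apply: hY => //; first by rewrite -sumq add0r.
    exact: lt_le_trans hx hw.
  by right.
apply: (le_trans (prU _ mc (measurable_overflow _ _ _))); apply: lerD.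
  apply: (pr_chain QE) => // *; exact: sigma_level_event.
exact: pr_overflow.
Qed.

End union_bound.

(** * Tail and median hypotheses, and tails of crossings *)

Lemma cube_rootK {R : realType} (x : R) : 0 <= x -> (x `^ (3^-1)) ^+ 3 = x.
Proof.
by move=> x0; rewrite -powR_mulrn ?powR_ge0// -powRrM mulVf// powRr1.
Qed.

Lemma cube_root_ge1 {R : realType} (x : R) : 1 <= x -> 1 <= x `^ (3^-1).
Proof.
by move=> x1; rewrite -[leLHS](powRr0 x) ler_powR// invr_ge0.
Qed.

Lemma cube_root_le {R : realType} (x y : R) : 0 <= x -> x <= y -> x `^ (3^-1) <= y `^ (3^-1).
Proof. by move=> x0 xy; apply: ge0_ler_powR => //; rewrite nnegrE; lra. Qed.

(** The statement on which the iteration runs. [G] is existential because every round flattens the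
    parabola, and all [z] with a path are included because the increments of the pieces are
    arbitrary. *)
Definition tail_bound {R : realType} (Q : probability (env R) R) (mu beta eta : R) :=
  exists (G c th0 r0 : R), [/\ 0 < G, 0 < c, 0 < th0 &
    forall (r : nat) (z : int) (th : R), r0 < r%:R -> (`|z|%N <= r)%N ->
      th0 <= th -> th <= r%:R `^ eta ->
    pr Q (Xe r z (mu * r%:R - G * z%:~R ^+ 2 / r%:R + th * r%:R `^ (3^-1)))
      <= expR (- (c * th `^ beta))].

(** The factor 2 leaves room to round the cell width [n^(2/3)] to a natural number. *)
Definition median_bound {R : realType} (Q : probability (env R) R) (mu : R) :=
  exists (C r0 : R), 0 < C /\
    forall (r : nat) (z : int), r0 < r%:R ->
      `|z%:~R| <= 2 * (r%:R `^ (3^-1)) ^+ 2 :> R ->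
    2^-1 <= pr Q (Xe r z (mu * r%:R - C * r%:R `^ (3^-1))).

Section cross_tail.
Context {R : realType} {Q : probability (env R) R} {nu : probability R R}.
Hypothesis QE : iid_law Q nu.

Lemma Xe_out_of_range r z x : (r < `|z|)%N -> @Xe R r z x = set0.
Proof.
move=> rz; rewrite -subset0 => w [s [hs _]].
by have := endp_ge (1, 1) s; rewrite hs /=; lia.
Qed.

Lemma cross_tail (mu beta eta : R) : 0 < beta -> beta <= 1 -> 0 < eta ->
  tail_bound Q mu beta eta -> median_bound Q mu ->
  exists (G c th0 n0 : R), [/\ 0 < G, 0 < c, 1 <= th0 &
    forall (n wd : nat) (a j d : int) (th : R), n0 < n%:R ->
      (n%:R `^ (3^-1)) ^+ 2 <= wd%:R :> R -> wd%:R <= 2 * (n%:R `^ (3^-1)) ^+ 2 :> R ->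
      th0 <= th -> th <= n%:R `^ eta ->
    pr Q (cross wd n a j (j + d)
       (mu * n%:R + (th - G * d%:~R ^+ 2) * n%:R `^ (3^-1)))
      <= 4 * expR (- (c * th `^ beta))].
Proof.
move=> b0 b1 e0 [G [c [th0 [r0 [G0 c0 th00 HT]]]]] [C [r1 [C0 HM]]].
(* [G / 3] is the parabola at scale [3 n]. The tail is used at [th / 4]: as
   [(3 n)^(1/3) <= 2 n^(1/3)], this takes half of [th], and the other half covers the [2 C] lost in
   the two completing pieces. [c / 4] comes from [4^-beta >= 1/4]. *)
exists (G / 3), (c / 4), (1 + 4 * th0 + 4 * C), (1 + `|r0| + `|r1|); split.
- by rewrite divr_gt0.
- by rewrite divr_gt0.
- lra.
move=> n wd a j d th hn wd1 wd2 th1 th2.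
have n1 : 1 <= n%:R :> R.
  by have := normr_ge0 r0; have := normr_ge0 r1; lra.
set cb := n%:R `^ (3^-1) in wd1 wd2 *.
have cb1 : 1 <= cb by exact: cube_root_ge1.
have cb3 : cb ^+ 3 = n%:R by rewrite cube_rootK//; lra.
pose b := mu * n%:R - C * cb.
have hb (z : int) : (`|z|%N <= wd)%N -> 2^-1 <= pr Q (Xe n z b).
  move=> zwd; apply: HM; first by have := normr_ge0 r0; have := ler_norm r1; lra.
  apply: le_trans wd2; rewrite -intr_norm -abszE.
  by rewrite -(pmulrn 1) ler_nat.
apply: (le_trans (@backup _ _ _ QE n wd a j (j + d) _ b hb)).
rewrite ler_pM2l//.
have -> : j + d - j = d by rewrite addrAC subrr add0r.
(* Past this displacement there is no path to the completed endpoint. *)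
have [dn|dn] := leqP `|(d * wd%:Z)%R|%N (3 * n)%N; last first.
  by rewrite Xe_out_of_range// pr0 ltW ?expR_gt0.
have r0n : r0 < (3 * n)%:R.
  by rewrite natrM; have := normr_ge0 r1; have := ler_norm r0; lra.
have tth : th0 <= th / 4 by lra.
have tth2 : th / 4 <= (3 * n)%:R `^ eta.
  apply: (@le_trans _ _ (n%:R `^ eta)); first by lra.
  by apply: ge0_ler_powR; rewrite ?nnegrE ?ler0n ?ler_nat ?leq_pmull// ltW.
apply: (le_trans _ (le_trans (HT _ _ _ r0n dn tth tth2) _)); last first.
  rewrite ler_expR lerN2 powRM; [|lra|lra].
  have : 4^-1 <= 4^-1 `^ beta :> R by apply: ger1_powR => //; apply/andP; split; lra.
  have := powR_ge0 th beta; set u := th `^ beta; set v := 4^-1 `^ beta => u0 v4.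
  have : 0 <= (v - 4^-1) * u * c by rewrite !mulr_ge0// ?subr_ge0// ltW.
  by lra.
apply: le_pr; [exact: measurable_lpt|exact: measurable_lpt|].
apply: lpt_le.
have c3 : (3 * n)%:R `^ 3^-1 <= 2 * cb.
  have cb20 : 0 <= 2 * cb by lra.
  have -> : 2 * cb = ((2 * cb) ^+ 3) `^ 3^-1.
    by rewrite -powR_mulrn// -powRrM mulfV ?pnatr_eq0// powRr1.
  rewrite cube_root_le// exprMn cb3 natrM.
  by lra.
set c3n := (3 * n)%:R `^ 3^-1 in c3 *.
have c3n0 : 0 <= c3n by exact: powR_ge0.
have par : G / 3 * d%:~R ^+ 2 * cb <= G * (d * wd%:Z)%:~R ^+ 2 / (3 * n)%:R.
  rewrite ler_pdivlMr; last by rewrite natrM; lra.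
  rewrite natrM -cb3 intrM (_ : (wd%:Z)%:~R = wd%:R :> R)//.
  have w2 : cb ^+ 2 ^+ 2 <= wd%:R ^+ 2 :> R by rewrite lerXn2r// nnegrE ?exprn_ge0//; lra.
  have : 0 <= G * d%:~R ^+ 2 * (wd%:R ^+ 2 - cb ^+ 2 ^+ 2).
    by rewrite mulr_ge0 ?subr_ge0// mulr_ge0 ?sqr_ge0// ltW.
  by lra.
rewrite natrM in par *.
have thc : th / 4 * c3n <= (th - 2 * C) * cb.
  apply: (@le_trans _ _ (th / 4 * (2 * cb))); first by rewrite ler_wpM2l//; lra.
  have : 0 <= (th - 4 * C) * cb by rewrite mulr_ge0//; lra.
  by lra.
by rewrite /b; lra.
Qed.

End cross_tail.

(** * Inequalities for sums and real powers *)

Section real_lemmas.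
Context {R : realType}.

(** Inverse squares are summable, which is all that the sums over levels and increments require. The
    bound follows from [(y / m)^m <= exp y] with [m] so large that [b m >= 2]. *)
Lemma expR_decay (c b : R) : 0 < c -> 0 < b ->
  exists K : R, 0 < K /\ forall x, 0 <= x -> expR (- (c * x `^ b)) <= K / (1 + x) ^+ 2.
Proof.
move=> c0 b0.
have [m hm] : exists m : nat, 2 <= b * m.+1%:R.
  exists (Num.truncn (2 / b)); rewrite -ler_pdivrMl// mulrC.
  by rewrite ltW// truncnS_gt.
exists (4 + 4 * m.+1%:R ^+ m.+1 / c ^+ m.+1); split.
  by rewrite ltr_wpDr// !mulr_ge0// ?exprn_ge0// invr_ge0 exprn_ge0// ltW.
move=> x x0; rewrite ler_pdivlMr; last by rewrite exprn_gt0//; lra.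
have K0 : 0 <= m.+1%:R ^+ m.+1 / c ^+ m.+1 :> R.
  by rewrite divr_ge0// exprn_ge0// ltW.
have [x1|x1] := leP x 1.
  have e1 : expR (- (c * x `^ b)) <= 1.
    by rewrite -expR0 ler_expR oppr_le0 mulr_ge0 ?powR_ge0// ltW.
  apply: (@le_trans _ _ (1 * (1 + x) ^+ 2)).
    by rewrite ler_wpM2r ?sqr_ge0.
  have : (1 + x) ^+ 2 <= 4 by nra.
  by lra.
have y0 : 0 < c * x `^ b by rewrite mulr_gt0// powR_gt0//; lra.
set y := c * x `^ b in y0 *.
have m0 : 0 < m.+1%:R :> R by rewrite ltr0n.
have ey : (y / m.+1%:R) ^+ m.+1 <= expR y.
  have -> : expR y = expR (y / m.+1%:R) ^+ m.+1 by rewrite -expRM_natl mulrC divfK// gt_eqF.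
  apply: lerXn2r; rewrite ?nnegrE ?expR_ge0//.
    by rewrite divr_ge0 ?ltW.
  by apply: le_trans (expR_ge1Dx _); rewrite lerDr.
have xm : x ^+ 2 <= (x `^ b) ^+ m.+1.
  rewrite -powR_mulrn ?powR_ge0// -powRrM -powR_mulrn; last by lra.
  by apply: ler_powR => //; lra.
have hK : x ^+ 2 <= m.+1%:R ^+ m.+1 / c ^+ m.+1 * expR y.
  apply: (le_trans xm); rewrite -ler_pdivrMl; last first.
    by rewrite divr_gt0 ?exprn_gt0.
  apply: le_trans ey; rewrite invf_div /y !exprMn exprVn le_eqVlt; apply/orP; left.
  by apply/eqP; ring.
rewrite expRN ler_pdivrMl ?expR_gt0//.
set E := expR y in hK *; set M := (_ / _) in K0 hK *.
have E0 : 0 <= E by exact: expR_ge0.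
rewrite (_ : 4 * _ / _ = 4 * M); last by rewrite /M mulrA.
have -> : E * (4 + 4 * M) = 4 * E + 4 * (M * E) by ring.
by nra.
Qed.

Lemma sum_inv_sqr N : \sum_(i <- iota 0 N) (1 + i%:R : R) ^- 2 <= 2.
Proof.
(* The remainder term makes the induction telescope. *)
suff : \sum_(i <- iota 0 N) (1 + i%:R : R) ^- 2 <= 2 - 2 / (1 + N%:R).
  move=> h; apply: (le_trans h); rewrite gerBl.
  by rewrite divr_ge0 ?addr_ge0.
elim: N => [|N IH]; first by rewrite big_nil addr0; lra.
rewrite -addn1 iotaD big_cat big_seq1 /= add0n natrD.
set u := N%:R : R; have u0 : 0 <= u by exact: ler0n.
apply: (le_trans (lerD IH (lexx _))); rewrite -/u.
have e : 2 / (1 + u) - 2 / (1 + (u + 1)) = 2 / ((1 + u) * (2 + u)).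
  by field; apply/andP; split; lra.
have : (1 + u) ^- 2 <= 2 / ((1 + u) * (2 + u)).
  rewrite ler_pdivlMr; last by nra.
  rewrite mulrC ler_pdivrMr; nra.
by lra.
Qed.

Lemma powR_subadditive (x y b : R) : 0 <= x -> 0 <= y -> 0 < b -> b <= 1 ->
  (x + y) `^ b <= x `^ b + y `^ b.
Proof.
move=> x0 y0 b0 b1; have [s0|s0] := leP (x + y) 0.
  have [-> ->] : x = 0 /\ y = 0 by split; lra.
  by rewrite addr0 powR0 ?gt_eqF// addr0.
have part u : 0 <= u -> u <= x + y -> u / (x + y) * (x + y) `^ b <= u `^ b.
  move=> u0 us; have [->|un0] := eqVneq u 0; first by rewrite !mul0r powR_ge0.
  have {un0 u0} u0 : 0 < u by rewrite lt_neqAle eq_sym un0.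
  have sn0 : x + y != 0 by rewrite gt_eqF.
  rewrite -{2}(divfK sn0 u) powRM; [|by rewrite divr_ge0//; lra|lra].
  rewrite ler_wpM2r ?powR_ge0// ger1_powR//.
  by rewrite divr_gt0//= ler_pdivrMr// mul1r.
have px : x / (x + y) * (x + y) `^ b <= x `^ b by apply: part => //; lra.
have py : y / (x + y) * (x + y) `^ b <= y `^ b by apply: part => //; lra.
by apply: le_trans (lerD px py); rewrite -mulrDl -mulrDl divff ?mul1r// gt_eqF.
Qed.

Lemma powR_sum_le (T : Type) (s : seq T) (f : T -> R) (b : R) :
  (forall t, 0 <= f t) -> 0 < b -> b <= 1 ->
  (\sum_(t <- s) f t) `^ b <= \sum_(t <- s) f t `^ b.
Proof.
move=> f0 b0 b1; elim: s => [|t s IH]; first by rewrite !big_nil powR0 ?gt_eqF.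
rewrite !big_cons; apply: (le_trans (powR_subadditive _ _ b0 b1)) => //.
  exact: sumr_ge0.
by rewrite lerD2l.
Qed.

Lemma sum_powR_le (T : Type) (s : seq T) (f : T -> R) (b : R) :
  (forall t, 0 <= f t) -> 0 < b ->
  \sum_(t <- s) f t `^ b <= (size s)%:R * (\sum_(t <- s) f t) `^ b.
Proof.
move=> f0 b0; elim: s => [|t s IH]; first by rewrite !big_nil mul0r.
rewrite !big_cons /= -natr1 mulrDl mul1r addrC; apply: lerD.
  apply: (le_trans IH); rewrite ler_wpM2l//.
  apply: ge0_ler_powR; rewrite ?nnegrE ?addr_ge0 ?sumr_ge0 ?lerDr//; exact: ltW.
apply: ge0_ler_powR; rewrite ?nnegrE ?addr_ge0 ?sumr_ge0 ?lerDl ?sumr_ge0//; exact: ltW.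
Qed.

(** Cauchy-Schwarz, from the sum of [(f t - u)^2] being nonnegative at the mean [u]. *)
Lemma sqr_sum_le (T : Type) (s : seq T) (f : T -> R) :
  (\sum_(t <- s) f t) ^+ 2 <= (size s)%:R * \sum_(t <- s) f t ^+ 2.
Proof.
have key u : 2 * u * (\sum_(t <- s) f t) - (size s)%:R * u ^+ 2 <= \sum_(t <- s) f t ^+ 2.
  elim: s => [|t s IH]; first by rewrite !big_nil mulr0 mul0r subr0.
  rewrite !big_cons /= -natr1; have := sqr_ge0 (u - f t); lra.
have [s0|s0] := posnP (size s).
  by rewrite (size0nil s0) !big_nil expr0n mulr0.
have k0 : 0 < (size s)%:R :> R by rewrite ltr0n.
have := key ((\sum_(t <- s) f t) / (size s)%:R); set S := \sum_(t <- s) f t.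
set k := (size s)%:R in k0 *.
have -> : 2 * (S / k) * S - k * (S / k) ^+ 2 = S ^+ 2 / k by field; lra.
by rewrite ler_pdivrMr// mulrC.
Qed.

Lemma sum_int_range N (f : int -> R) (g : nat -> R) :
  (forall i : nat, f i%:Z = g i) -> (forall i : nat, f (- i%:Z) = g i) ->
  \sum_(i <- int_range N) f i = 2 * \sum_(i <- iota 0 N.+1) g i.
Proof.
move=> fg fg'; rewrite /int_range big_cat !big_map mulr2n mulrDl !mul1r.
by congr (_ + _); apply: eq_bigr.
Qed.

(** The sum over levels is bounded. In the increment, the decay has rate [1/k] and sets in at [|d|]
    of order [k^(1/(2b))]. The cruder [k^(1/b)] suffices because only its logarithm matters, and it
    is uniform in [n] and [lvl]. *)
Lemma sum_levels_le (c b g : R) : 0 < c -> 0 < b -> 0 < g ->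
  exists K, 1 <= K /\ forall n lvl k : nat, (0 < k)%N ->
    \sum_(q <- levels n lvl)
       expR (c / 2 * q.2%:R `^ b - c / 4 / k%:R * (g * q.1%:~R ^+ 2) `^ b) *
       (4 * expR (- (c * q.2%:R `^ b))) <= K * k%:R `^ b^-1.
Proof.
move=> c0 b0 g0.
have [K1 [K10 hK1]] : exists K : R, 0 < K /\ forall x, 0 <= x ->
    expR (- (c / 2 * x `^ b)) <= K / (1 + x) ^+ 2 by apply: expR_decay => //; lra.
have c30 : 0 < c / 4 * g `^ b by rewrite mulr_gt0 ?powR_gt0//; lra.
have [K2 [K20 hK2]] : exists K : R, 0 < K /\ forall x, 0 <= x ->
    expR (- (c / 4 * g `^ b * x `^ (2 * b))) <= K / (1 + x) ^+ 2.
  by apply: expR_decay => //; lra.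
exists (1 + 32 * K1 * K2); split; first by rewrite lerDl !mulr_ge0// ltW.
move=> n lvl k k0.
have k1 : 1 <= k%:R :> R by rewrite ler1n.
have km0 : 0 < k%:R :> R by lra.
pose A (d : int) := expR (- (c / 4 / k%:R * (g * d%:~R ^+ 2) `^ b)).
pose B (m : nat) := 4 * expR (- (c / 2 * m%:R `^ b)).
have -> : \sum_(q <- levels n lvl)
       expR (c / 2 * q.2%:R `^ b - c / 4 / k%:R * (g * q.1%:~R ^+ 2) `^ b) *
       (4 * expR (- (c * q.2%:R `^ b))) =
    (\sum_(d <- int_range n.+1) A d) * (\sum_(m <- iota 0 lvl.+1) B m).
  rewrite big_distrlr /= /levels big_allpairs.
  apply: eq_bigr => d _; apply: eq_bigr => m _ /=.
  by rewrite /A /B mulrCA -expRD [RHS]mulrCA -expRD; congr (_ * expR _); lra.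
have hB : \sum_(m <- iota 0 lvl.+1) B m <= 8 * K1.
  apply: (@le_trans _ _ (\sum_(m <- iota 0 lvl.+1) (4 * K1) * (1 + m%:R) ^- 2)).
    apply: ler_sum => m _; rewrite /B -[leRHS]mulrA ler_pM2l//.
    by apply: hK1.
  rewrite -mulr_sumr; have := sum_inv_sqr lvl.+1; set S := \sum_(_ <- _) _ => hS.
  have : 0 <= K1 * (2 - S) by rewrite mulr_ge0 ?subr_ge0// ltW.
  by lra.
(* [kp = k^(1/(2b))] is the increment scale; replacing [1 + m/kp] by [(1 + m)/kp] produces the
   factor [kp^2 = k^(1/b)]. *)
pose e := (2 * b)^-1.
pose kp := k%:R `^ e.
have kp1 : 1 <= kp by rewrite -[leLHS](powRr0 k%:R) ler_powR// invr_ge0; lra.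
have kp2 : kp ^+ 2 = k%:R `^ b^-1.
  rewrite /kp -powR_mulrn ?powR_ge0// -powRrM /e; congr (_ `^ _).
  by field; rewrite gt_eqF.
have kpb : kp `^ (2 * b) = k%:R.
  by rewrite /kp -powRrM /e mulVf ?powRr1 ?ltW// gt_eqF//; lra.
have hAm (m : nat) : expR (- (c / 4 / k%:R * (g * m%:R ^+ 2) `^ b)) <=
    K2 * kp ^+ 2 * (1 + m%:R) ^- 2.
  have mk : 0 <= m%:R / kp by rewrite divr_ge0//; lra.
  have := hK2 _ mk.
  have -> : c / 4 * g `^ b * (m%:R / kp) `^ (2 * b) =
      c / 4 / k%:R * (g * m%:R ^+ 2) `^ b.
    have kpi : (kp^-1) `^ (2 * b) = k%:R^-1.
      rewrite -(powR_inv1 (a := kp)); last by lra.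
      by rewrite -powRrM mulN1r powRN kpb.
    rewrite [(m%:R / kp) `^ _]powRM ?invr_ge0//; last by lra.
    rewrite kpi powRrM powR_mulrn// [in RHS]powRM ?sqr_ge0 ?ltW//.
    by ring.
  move=> /le_trans; apply.
  rewrite -mulrA ler_pM2l// ler_pdivlMr; last by rewrite exprn_gt0// ltr_wpDr.
  rewrite mulrC ler_pdivrMr; last by rewrite exprn_gt0// ltr_wpDr.
  rewrite -exprMn lerXn2r// ?nnegrE ?addr_ge0// ?mulr_ge0 ?addr_ge0//; try lra.
  by rewrite mulrDr mulr1 mulrC divfK ?gt_eqF//; lra.
have hA : \sum_(d <- int_range n.+1) A d <= 4 * K2 * kp ^+ 2.
  rewrite (@sum_int_range _ A (fun m => expR (- (c / 4 / k%:R * (g * m%:R ^+ 2) `^ b)))).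
  - apply: (@le_trans _ _ (2 * \sum_(m <- iota 0 n.+2) (K2 * kp ^+ 2) * (1 + m%:R) ^- 2)).
      by rewrite ler_pM2l//; apply: ler_sum => m _; exact: hAm.
    rewrite -mulr_sumr; have := sum_inv_sqr n.+2; set S := \sum_(_ <- _) _ => hS.
    have : K2 * kp ^+ 2 * S <= K2 * kp ^+ 2 * 2.
      by rewrite ler_wpM2l// mulr_ge0 ?sqr_ge0// ltW.
    by lra.
  - by [].
  - by move=> i; rewrite /A intrN sqrrN.
rewrite -kp2.
apply: (@le_trans _ _ (4 * K2 * kp ^+ 2 * (8 * K1))).
  apply: ler_pM => //; apply: sumr_ge0 => i _; rewrite ?expR_ge0//.
  by rewrite mulr_ge0 ?expR_ge0.
have : 0 <= kp ^+ 2 by exact: sqr_ge0.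
by lra.
Qed.

End real_lemmas.

(** * One round of the multiscale bound *)

Section step.
Context {R : realType}.

(* With [c = n^(1/3)], [kap = k^(1/3)], [rc = r^(1/3)], [Sm] and [D2] the sums of
   the levels and of the squared cell increments along a crossing. *)
Lemma level_sum_ge (mu G h th c kap rc n k r z2 Sm D2 J2 : R) :
  c ^+ 3 = n -> kap ^+ 3 = k -> rc ^+ 3 = r -> 1 <= c -> 1 <= kap -> 0 <= rc ->
  0 <= r -> r <= n * k -> n * k <= r + k -> n * k <= 2 * r ->
  0 < G -> 1 <= h -> 0 <= D2 -> 4 * G <= th -> 8 * (h + `|mu|) * kap ^+ 2 <= th ->
  z2 <= 8 * c ^+ 4 * (J2 + 1) -> J2 <= k * D2 ->
  mu * r - G / 32 * z2 / r + th * rc < k * (mu * n + h * c) + c * Sm - G * c * D2 ->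
  th * kap / 4 + G / 2 * D2 <= Sm.
Proof.
move=> c3 k3 r3 c1 kap1 rc0 r0 rnk nkr nk2r G0 h1 D20 thG thk hz hJ hlt.
have n0 : 1 <= n by rewrite -c3; nra.
have k0 : 1 <= k by rewrite -k3; nra.
have mu0 := normr_ge0 mu.
have rge : n * k / 2 <= r by lra.
have nk1 : 1 <= n * k by nra.
have rgt : 0 < r by lra.
have rcge : c * kap / 2 <= rc.
  rewrite leNgt; apply/negP => hlt'.
  have : rc ^+ 3 < (c * kap / 2) ^+ 3 by rewrite ltrXn2r// nnegrE; nra.
  have -> : (c * kap / 2) ^+ 3 = n * k / 8 by rewrite -c3 -k3; field.
  by rewrite r3; lra.
(* The baseline [h] of each piece and the rounding of [n k] against [r] together cost an eighth of
   [th * kap]. *)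
have e1 : (h + `|mu|) * k <= th * kap / 8.
  have : 0 <= (th - 8 * (h + `|mu|) * kap ^+ 2) * kap by rewrite mulr_ge0//; lra.
  by rewrite -k3; lra.
have e2 : - (`|mu| * k * c) <= mu * (r - n * k).
  have h2 : `|mu * (r - n * k)| <= `|mu| * k.
    by rewrite normrM ler_wpM2l// ler_norml; lra.
  have h3 := ler_norm (- (mu * (r - n * k))); rewrite normrN in h3.
  have : 0 <= `|mu| * k * (c - 1) by rewrite !mulr_ge0//; lra.
  by lra.
(* The endpoint lies about [J] cells away and [J^2 <= k D2]. With the factor [1/32] the parabola at
   scale [r] uses half of the parabolas of the pieces; the cell rounding [+ 1] is paid by another
   eighth of [th * kap]. *)
have e3 : G / 32 * z2 / r <= G / 2 * c * D2 + th * kap / 8 * c.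
  have q1 : z2 <= 8 * c ^+ 4 * (k * D2 + 1).
    apply: (le_trans hz); rewrite ler_wpM2l ?lerD2r//.
    by rewrite mulr_ge0// exprn_ge0//; lra.
  have q2 : 8 * c ^+ 4 * (k * D2 + 1) <= 16 * c * (D2 + 1) * r.
    have -> : 8 * c ^+ 4 * (k * D2 + 1) = 16 * c * (n / 2 * (k * D2 + 1)).
      by rewrite -c3; field.
    rewrite -[leRHS]mulrA ler_wpM2l//; first by lra.
    apply: (@le_trans _ _ (n * k / 2 * (D2 + 1))); last by rewrite mulrC ler_wpM2l//; lra.
    have : 0 <= n * (k - 1) by rewrite mulr_ge0//; lra.
    by lra.
  rewrite ler_pdivrMr//.
  have q3 : G / 32 * z2 <= G / 32 * (16 * c * (D2 + 1) * r).
    by rewrite ler_wpM2l ?(le_trans q1 q2)//; lra.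
  apply: (le_trans q3).
  have q4 : G / 2 <= th * kap / 8.
    have : 0 <= th * (kap - 1) by rewrite mulr_ge0//; lra.
    by lra.
  have : 0 <= (th * kap / 8 - G / 2) * (c * r) by rewrite !mulr_ge0//; lra.
  by lra.
have e4 : th * (c * kap / 2) <= th * rc by rewrite ler_wpM2l//; lra.
have e5 : (h + `|mu|) * k * c <= th * kap / 8 * c by rewrite ler_wpM2r//; lra.
(* Of the [th * kap / 2] given by [rc >= c * kap / 2], two eighths are spent and a quarter
   remains. *)
have : c * (th * kap / 4 + G / 2 * D2) <= c * Sm by lra.
by rewrite ler_pM2l//; lra.
Qed.

Lemma expR_sum_seq (T : Type) (s : seq T) (f : T -> R) :
  \prod_(t <- s) expR (f t) = expR (\sum_(t <- s) f t).
Proof.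
by elim: s => [|t s IH]; rewrite ?big_nil ?expR0// !big_cons expRD IH.
Qed.

(* Subadditivity of [x `^ b] turns the total level into a sum over pieces, while
   [(\sum g d^2) `^ b] dominates the average of the [(g d^2) `^ b]; the latter is
   what later makes the number of increments cost only a power of [k]. *)
Lemma weight_prod_ge (qs : seq (int * nat)) (c b g t : R) :
  0 < c -> 0 < b -> b <= 1 -> 0 < g -> 0 <= t -> (0 < size qs)%N ->
  t + g * (\sum_(q <- qs) q.1%:~R ^+ 2) <= \sum_(q <- qs) q.2%:R ->
  expR (c / 4 * t `^ b) <= \prod_(q <- qs)
     expR (c / 2 * q.2%:R `^ b - c / 4 / (size qs)%:R * (g * q.1%:~R ^+ 2) `^ b).
Proof.
move=> c0 b0 b1 g0 t0 sz hS.
rewrite expR_sum_seq ler_expR sumrB -!mulr_sumr.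
set k := (size qs)%:R : R; have k0 : 0 < k by rewrite ltr0n.
set M := \sum_(q <- qs) q.2%:R `^ b.
set D := \sum_(q <- qs) (g * q.1%:~R ^+ 2) `^ b.
have hM : (\sum_(q <- qs) q.2%:R) `^ b <= M by exact: powR_sum_le.
have gD0 : 0 <= g * (\sum_(q <- qs) q.1%:~R ^+ 2).
  by rewrite mulr_ge0 ?(ltW g0)// sumr_ge0// => q _; exact: sqr_ge0.
have hD : D <= k * (g * (\sum_(q <- qs) q.1%:~R ^+ 2)) `^ b.
  rewrite mulr_sumr; apply: (@sum_powR_le _ _ _ (fun q => g * q.1%:~R ^+ 2)) => // q.
  by rewrite mulr_ge0 ?sqr_ge0// ltW.
set gD := g * _ in gD0 hS hD.
have m1 : t `^ b <= M.
  apply: le_trans hM; apply: ge0_ler_powR; rewrite ?nnegrE ?sumr_ge0 ?(ltW b0)//.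
  by apply: le_trans hS; rewrite lerDl.
have m2 : gD `^ b <= M.
  apply: le_trans hM; apply: ge0_ler_powR; rewrite ?nnegrE ?sumr_ge0 ?(ltW b0)//.
  by apply: le_trans hS; rewrite lerDr.
have hDk : D / k <= M by rewrite ler_pdivrMr// mulrC (le_trans hD)// ler_pM2l.
have h1 : c / 4 * t `^ b <= c / 4 * M by rewrite ler_wpM2l//; lra.
have h2 : c / 4 * (D / k) <= c / 4 * M by rewrite ler_wpM2l//; lra.
rewrite (_ : c / 4 / k * D = c / 4 * (D / k)); last by rewrite mulrAC mulrA.
by lra.
Qed.

Lemma in_cell_sqr (c : R) (wd : nat) (J z : int) : wd%:R <= 2 * c ^+ 2 ->
  in_cell wd J z -> z%:~R ^+ 2 <= 8 * c ^+ 4 * (J%:~R ^+ 2 + 1).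
Proof.
move=> hw; rewrite /in_cell => /andP[h1 h2].
have hz : (`|z| <= (`|J| + 1) * wd%:Z)%R by clear -h1 h2; nia.
have hzR : `|z%:~R : R| <= (`|J%:~R| + 1) * (2 * c ^+ 2).
  rewrite -!intr_norm.
  apply: (@le_trans _ _ (((`|J| + 1) * wd%:Z)%:~R)); first by rewrite ler_int.
  by rewrite intrM intrD ler_wpM2l// addr_ge0// ler0z.
have h3 : z%:~R ^+ 2 <= ((`|J%:~R| + 1) * (2 * c ^+ 2)) ^+ 2.
  by rewrite -[leLHS]real_normK ?num_real// lerXn2r// nnegrE (le_trans _ hzR).
apply: (le_trans h3).
rewrite exprMn.
have -> : (2 * c ^+ 2) ^+ 2 = 4 * c ^+ 4 by ring.
have h4 : (`|J%:~R| + 1) ^+ 2 <= 2 * (J%:~R ^+ 2 + 1) :> R.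
  by rewrite -(@real_normK R J%:~R) ?num_real//; have := sqr_ge0 (`|J%:~R : R| - 1); lra.
have : 0 <= c ^+ 4 by rewrite exprn_even_ge0.
by nra.
Qed.

Lemma powR_large (a e : R) : 0 < e -> 0 <= a ->
  exists x0 : R, forall x, x0 < x -> a <= x `^ e.
Proof.
move=> e0 a0; exists (a `^ e^-1) => x hx.
have -> : a = (a `^ e^-1) `^ e by rewrite -powRrM mulVf ?powRr1// gt_eqF.
have h := powR_ge0 a e^-1.
by apply: ge0_ler_powR; rewrite ?nnegrE ?(ltW e0) ?(ltW hx)// (le_trans h)// ltW.
Qed.

Lemma powR_ge_id (x b : R) : 0 < x -> x <= 1 -> b <= 1 -> x <= x `^ b.
Proof. by move=> x0 x1 b1; apply: ger1_powR => //; rewrite x0 x1. Qed.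

(** The count is at most [36 (n k)^2 <= 36 (n k)^3], and [n k <= 2 r] gives [36 * 8 = 288]. *)
Lemma overflow_count_le (r n k : nat) : (0 < n)%N -> (0 < k)%N -> (n * k <= 2 * r)%N ->
  (k * (k * n.+1).+1.*2 * n.+2.*2)%:R <= 288 * r%:R ^+ 3 :> R.
Proof.
move=> n0 k0 nk2r.
have n1 : 1 <= n%:R :> R by rewrite ler1n.
have k1 : 1 <= k%:R :> R by rewrite ler1n.
have nk2rr : n%:R * k%:R <= 2 * r%:R :> R by rewrite -!natrM ler_nat.
have -> : (k * (k * n.+1).+1.*2 * n.+2.*2)%:R =
    k%:R * ((k%:R * (n%:R + 1) + 1) * 2) * ((n%:R + 2) * 2) :> R.
  by rewrite !natrM -!muln2 !natrM -!natr1 !natrM -!natr1; ring.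
have nk1 : 1 <= n%:R * k%:R :> R by rewrite -natrM ler1n muln_gt0 n0.
have nk3 : (n%:R * k%:R) ^+ 3 <= (2 * r%:R) ^+ 3 :> R.
  by rewrite lerXn2r// nnegrE//; lra.
have h : 0 <= k%:R * (n%:R - 1) :> R by rewrite mulr_ge0//; lra.
have q1 : (k%:R * (n%:R + 1) + 1) * 2 <= 6 * (n%:R * k%:R) :> R by lra.
have q2 : k%:R * ((n%:R + 2) * 2) <= 6 * (n%:R * k%:R) :> R by lra.
have q3 : k%:R * ((k%:R * (n%:R + 1) + 1) * 2) * ((n%:R + 2) * 2) <=
    36 * (n%:R * k%:R) ^+ 2 :> R.
  have -> : k%:R * ((k%:R * (n%:R + 1) + 1) * 2) * ((n%:R + 2) * 2) =
     ((k%:R * (n%:R + 1) + 1) * 2) * (k%:R * ((n%:R + 2) * 2)) :> R by ring.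
  rewrite (_ : 36 * _ = (6 * (n%:R * k%:R)) * (6 * (n%:R * k%:R))); last by ring.
  by apply: ler_pM => //; rewrite ?mulr_ge0// ?addr_ge0// ?mulr_ge0// ?addr_ge0.
have q4 : (n%:R * k%:R) ^+ 2 <= (n%:R * k%:R) ^+ 3 :> R by rewrite ler_weXn2l.
by rewrite exprMn in nk3; lra.
Qed.

Context {Q : probability (env R) R} {nu : probability R R}.
Hypothesis QE : iid_law Q nu.

Lemma step_bound (mu beta eta : R) : 0 < beta -> beta <= 1 -> 0 < eta ->
  tail_bound Q mu beta eta -> median_bound Q mu ->
  exists (G c K th1 n0 : R), [/\ 0 < G, 0 < c, 1 <= K, 1 <= th1 &
    forall (r n k : nat) (z : int) (th : R), n0 < n%:R -> (0 < k)%N ->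
      (r <= n * k)%N -> (n * k <= r + k)%N -> (n * k <= 2 * r)%N ->
      th1 <= th -> th1 * (k%:R `^ (3^-1)) ^+ 2 <= th ->
    pr Q (Xe r z (mu * r%:R - G * z%:~R ^+ 2 / r%:R + th * r%:R `^ (3^-1))) <=
      (K * k%:R `^ beta^-1) ^+ k * expR (- (c * (th * k%:R `^ (3^-1)) `^ beta)) +
      K * r%:R ^+ 3 * expR (- (c * n%:R `^ (eta * beta)))].
Proof.
move=> b0 b1 e0 HT HM.
have [G2 [c2 [h [n2 [G20 c20 h1 HC]]]]] := cross_tail QE b0 b1 e0 HT HM.
have g0 : 0 < G2 / 2 by lra.
have [K [K1 HK]] := sum_levels_le c20 b0 g0.
have [x0 hx0] : exists x0 : R, forall x, x0 < x -> h + 2 <= x `^ eta.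
  by apply: powR_large => //; lra.
have mu0 := normr_ge0 mu.
(* [1152 = 4 * 288]: the overflow count times the factor 4 of a crossing bound. *)
have K'0 : 0 <= K + 1152 by lra.
have KK' : K <= K + 1152 by lra.
exists (G2 / 32), (c2 / 16), (K + 1152), (1 + 4 * G2 + 8 * (h + `|mu|)), (1 + `|n2| + `|x0|).
split; [by clear -G20; lra|by clear -c20; lra|by clear -K1; lra|by clear -G20 h1 mu0; lra|].
move=> r n k z th hn k0 rnk nkr nk2r hth hthk.
have n1 : 1 <= n%:R :> R by clear -hn; have := normr_ge0 n2; have := normr_ge0 x0; lra.
have n0 : (0 < n)%N by rewrite -(ltr0n R) (lt_le_trans ltr01).
have hnn : n2 < n%:R by clear -hn; have := ler_norm n2; have := normr_ge0 x0; lra.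
have hnx : h + 2 <= n%:R `^ eta by apply: hx0; clear -hn; have := ler_norm x0; have := normr_ge0 n2; lra.
pose cb : R := n%:R `^ (3^-1).
have cb1 : 1 <= cb by exact: cube_root_ge1.
have cb3 : cb ^+ 3 = n%:R by rewrite cube_rootK//; lra.
set kap := k%:R `^ (3^-1) in hthk *.
have k1 : 1 <= k%:R :> R by rewrite ler1n.
have kap1 : 1 <= kap by exact: cube_root_ge1.
have kap3 : kap ^+ 3 = k%:R by rewrite cube_rootK//; lra.
pose wd := (Num.truncn (cb ^+ 2)).+1.
have wdl : cb ^+ 2 <= wd%:R by rewrite ltW// truncnS_gt.
have cb21 : 1 <= cb ^+ 2 by rewrite exprn_ege1.
have wdu : wd%:R <= 2 * cb ^+ 2.
  have hh : (Num.truncn (cb ^+ 2))%:R <= cb ^+ 2 by rewrite truncn_le (le_trans ler01).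
  by rewrite /wd -natr1; clear -hh cb21; lra.
(* The last level whose excess [h + lvl] is still in the range [n^eta] of the crossing tail. *)
pose lvl := Num.truncn (n%:R `^ eta - h).
have lvl1 : h + lvl%:R <= n%:R `^ eta.
  have hl : lvl%:R <= n%:R `^ eta - h by rewrite truncn_le subr_ge0; clear -hnx; lra.
  by clear -hl; lra.
have lvl2 : n%:R `^ eta / 2 <= h + lvl%:R.
  have := truncnS_gt (n%:R `^ eta - h); rewrite -/lvl -natr1; clear -hnx h1.
  by set m := _%:R; lra.
(* Levels are counted from the threshold [h] of [cross_tail], so its bound applies to each of
   them. *)
pose thr (d : int) (m : nat) := mu * n%:R + (h + m%:R - G2 * d%:~R ^+ 2) * cb.
have thrS d m : thr d m.+1 = thr d m + cb by rewrite /thr -natr1; ring.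
have [J cJ] := @exists_cell wd z isT.
(* The tilt spends half of the decay in the level and allots each piece [1/k] of the parabola;
   [v * p] still decays in both variables. *)
pose v (q : int * nat) := expR (c2 / 2 * q.2%:R `^ beta -
   c2 / 4 / k%:R * (G2 / 2 * q.1%:~R ^+ 2) `^ beta).
pose p (q : int * nat) := 4 * expR (- (c2 * q.2%:R `^ beta)).
pose t := th * kap / 4.
have th0 : 0 < th by clear -hth mu0 h1 G20; lra.
have t0 : 0 <= t by rewrite /t !mulr_ge0// ?ltW// (lt_le_trans ltr01).
pose Y := expR (c2 / 4 * t `^ beta).
have hcross a j d (m : nat) : (m <= lvl)%N ->
    pr Q (cross wd n a j (j + d) (thr d m)) <= 4 * expR (- (c2 * (h + m%:R) `^ beta)).
  move=> ml; apply: HC => //; first by rewrite lerDl.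
  by apply: le_trans lvl1; rewrite lerD2l ler_nat.
have hp a j q : q \in levels n lvl -> pr Q (level_event n wd thr a j q) <= p q.
  move=> /allpairsP[[d m] [_ mm ->]] /=; rewrite /level_event /p /=.
  have {mm} mm : (m <= lvl)%N by move: mm; rewrite mem_iota.
  (* Level 0 is the sure event, within the bound 4. At level [m + 1] the excess is [h + m >= m + 1],
     since [h >= 1]. *)
  case: m mm => [|m] mm.
    by rewrite powR0 ?gt_eqF// mulr0 oppr0 expR0 prT mulr1 ler1n.
  apply: (le_trans (hcross _ _ _ _ (ltnW mm))); rewrite ler_pM2l// ler_expR lerN2 ler_pM2l//.
  have m0 := ler0n R m; rewrite -natr1.
  by clear -m0 b0 h1; apply: ge0_ler_powR; rewrite ?nnegrE; lra.
pose p0 := 4 * expR (- (c2 / 2 * n%:R `^ (eta * beta))).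
have hp0 a j d : pr Q (cross wd n a j (j + d) (thr d lvl)) <= p0.
  apply: (le_trans (hcross _ _ _ _ (leqnn _))); rewrite ler_pM2l// ler_expR lerN2.
  rewrite -mulrA ler_pM2l// powRrM.
  have h2 : 2^-1 <= 2^-1 `^ beta :> R by apply: powR_ge_id => //; rewrite invf_le1// ler1n.
  have u0 := powR_ge0 (n%:R `^ eta) beta.
  apply: (@le_trans _ _ ((n%:R `^ eta / 2) `^ beta)).
    by rewrite powRM ?powR_ge0// mulrC ler_wpM2l.
  by apply: ge0_ler_powR; rewrite ?nnegrE ?(ltW b0) ?divr_ge0 ?powR_ge0// (le_trans _ lvl2)// divr_ge0 ?powR_ge0.
have rr : r%:R <= n%:R * k%:R :> R by rewrite -natrM ler_nat.
have nkrr : n%:R * k%:R <= r%:R + k%:R :> R by rewrite -natrM -natrD ler_nat.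
have nk2rr : n%:R * k%:R <= 2 * r%:R :> R by rewrite -!natrM ler_nat.
have hY (qs : seq (int * nat)) : size qs = k -> \sum_(q <- qs) q.1 = J ->
    mu * r%:R - G2 / 32 * z%:~R ^+ 2 / r%:R + th * r%:R `^ 3^-1 <
      \sum_(q <- qs) thr q.1 q.2 -> Y <= \prod_(q <- qs) v q.
  move=> sqs hJ hx; rewrite /v -sqs; apply: weight_prod_ge => //; first by rewrite sqs.
  apply: (level_sum_ge (mu := mu) (h := h) (c := cb) (rc := r%:R `^ 3^-1) (n := n%:R)
    (k := k%:R) (r := r%:R) (z2 := z%:~R ^+ 2) (J2 := J%:~R ^+ 2)) => //.
  - by rewrite cube_rootK.
  - by apply: sumr_ge0 => q _; exact: sqr_ge0.
  - by clear -hth mu0 h1; lra.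
  - have G21 : 0 <= 1 + 4 * G2 by clear -G20; lra.
    have := mulr_ge0 G21 (sqr_ge0 kap).
    by clear -hthk; lra.
  - exact: in_cell_sqr wdu cJ.
  - rewrite -hJ -sqs (_ : (\sum_(q <- qs) q.1)%:~R = \sum_(q <- qs) q.1%:~R :> R).
      exact: sqr_sum_le.
    by elim: (qs) => [|q qs' IH]; rewrite ?big_nil// !big_cons intrD IH.
  - apply: (lt_le_trans hx); rewrite /thr le_eqVlt; apply/orP; left; apply/eqP.
    rewrite -sqs; elim: (qs) => [|q qs' IH]; first by rewrite !big_nil /=; ring.
    by rewrite !big_cons /= -natr1 IH; ring.
have cb0 : 0 < cb by rewrite (lt_le_trans ltr01).
have wd0 : (0 < wd)%N by [].
have v0 q : 0 < v q by exact: expR_gt0.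
have Y0 : 0 < Y by exact: expR_gt0.
apply: (le_trans (Xe_union_bound QE wd0 cb0 thrS rnk cJ v0 Y0 hp hp0 hY)).
apply: lerD.
  apply: ler_pM; rewrite ?invr_ge0 ?expR_ge0//.
  - by rewrite exprn_ge0// sumr_ge0// => q _; rewrite !mulr_ge0 ?expR_ge0.
  - apply: lerXn2r; rewrite ?nnegrE.
    + by rewrite sumr_ge0// => q _; rewrite !mulr_ge0 ?expR_ge0.
    + by apply: mulr_ge0; [exact: K'0|exact: powR_ge0].
    by apply: (le_trans (HK _ _ _ k0)); apply: ler_wpM2r; [exact: powR_ge0|exact: KK'].
  - rewrite -expRN ler_expR lerN2.
    have h4 : 4^-1 <= 4^-1 `^ beta :> R by apply: powR_ge_id => //; rewrite invf_le1// ler1n.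
    have u0 := powR_ge0 (th * kap) beta.
    have thk0 : 0 <= th * kap by rewrite mulr_ge0 ?(ltW th0)// (le_trans ler01).
    rewrite /t [(th * kap / 4) `^ _]powRM//.
    have : 0 <= c2 / 4 * ((th * kap) `^ beta * (4^-1 `^ beta - 4^-1)).
      by apply: mulr_ge0; [clear -c20; lra|apply: mulr_ge0; rewrite ?subr_ge0].
    by clear; lra.
rewrite /p0 mulrA; apply: ler_pM; rewrite ?expR_ge0 ?mulr_ge0//.
  have hK3 : 0 <= K * r%:R ^+ 3 by rewrite mulr_ge0 ?exprn_ge0// (le_trans ler01).
  have := overflow_count_le n0 k0 nk2r; set N := (_ * _)%:R => hN.
  by clear -hK3 hN; lra.
rewrite ler_expR lerN2; apply: ler_wpM2r; first exact: powR_ge0.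
by clear -c20; lra.
Qed.

End step.

(** * Improving the tail exponent *)

Section iteration.
Context {R : realType}.

Lemma ln_le_self (y : R) : 0 < y -> ln y <= y.
Proof.
move=> y0; have := expR_ge1Dx (ln y); rewrite lnK ?posrE//.
by apply: le_trans; rewrite lerDr.
Qed.

Lemma ln_le_powR (C e c : R) : 0 <= C -> 0 < e -> 0 < c ->
  exists x0 : R, forall x, x0 < x -> C + ln x <= c * x `^ e.
Proof.
move=> C0 e0 c0; have e2 : 0 < e / 2 by lra.
have [x0 hx0] : exists x0 : R, forall x, x0 < x -> (C + 2 / e) / c <= x `^ (e / 2).
  by apply: powR_large => //; rewrite divr_ge0 ?addr_ge0 ?divr_ge0 ?(ltW e0) ?(ltW c0).
exists (1 + `|x0|) => x hx.
have x1 : 1 < x by have := normr_ge0 x0; lra.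
have hxx : x0 < x by have := ler_norm x0; lra.
set y := x `^ (e / 2).
have y1 : 1 <= y by rewrite -[leLHS](powRr0 x) ler_powR ?ltW.
have -> : x `^ e = y ^+ 2.
  by rewrite -powR_mulrn ?powR_ge0// /y -powRrM divfK// pnatr_eq0.
have ly : ln x <= 2 / e * y.
  have -> : ln x = 2 / e * ln y by rewrite ln_powR; field; rewrite gt_eqF.
  by rewrite ler_wpM2l ?divr_ge0 ?(ltW e0)// ln_le_self// (lt_le_trans ltr01).
have h := hx0 x hxx; rewrite -/y ler_pdivrMr// in h.
have q1 : (C + 2 / e) * y <= y * c * y by rewrite ler_wpM2r//; lra.
have q2 : C <= C * y by rewrite ler_peMr.
by rewrite expr2; lra.
Qed.

Lemma powRD_gt0 (x a b : R) : 0 < x -> x `^ (a + b) = x `^ a * x `^ b.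
Proof. by move=> x0; rewrite powRD// (gt_eqF x0) implybT. Qed.

Lemma le_of_cube_le (x y : R) : 0 <= x -> 0 <= y -> x ^+ 3 <= y ^+ 3 -> x <= y.
Proof. by move=> x0 y0; rewrite ler_pXn2r// nnegrE. Qed.

Lemma ceil_div (r k : nat) : (0 < k)%N -> exists n, (r <= n * k)%N /\ (n * k <= r + k)%N.
Proof.
move=> k0; exists (r %/ k).+1; rewrite mulSn; have := divn_eq r k.
by have := ltn_pmod r k0; lia.
Qed.

Context {Q : probability (env R) R} {nu : probability R R}.
Hypothesis QE : iid_law Q nu.

(** As [k <= r^(1/2)], the pieces have scale [n >= r^(1/2)] and the overflow is at most a power of
    [r] times [exp (- c r^(eta beta / 2))]. Halving the exponent once more absorbs the power and the
    constant. *)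
Lemma step_tail (mu beta eta : R) : 0 < beta -> beta <= 1 -> 0 < eta ->
  tail_bound Q mu beta eta -> median_bound Q mu ->
  exists (G c K th1 r1 : R), [/\ 0 < G, 0 < c, 1 <= K, 1 <= th1 &
    forall (r k : nat) (z : int) (th : R), r1 < r%:R -> (0 < k)%N ->
      k%:R <= r%:R `^ 2^-1 :> R -> th1 <= th -> th1 * (k%:R `^ (3^-1)) ^+ 2 <= th ->
    pr Q (Xe r z (mu * r%:R - G * z%:~R ^+ 2 / r%:R + th * r%:R `^ (3^-1))) <=
      (K * k%:R `^ beta^-1) ^+ k * expR (- (c * (th * k%:R `^ (3^-1)) `^ beta)) +
      expR (- r%:R `^ (eta * beta / 4))].
Proof.
move=> b0 b1 e0 HT HM.
have [G [c [K [th1 [n0 [G0 c0 K1 th11 H]]]]]] := step_bound QE b0 b1 e0 HT HM.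
have eb0 : 0 < eta * beta by rewrite mulr_gt0.
have eb4 : 0 < eta * beta / 4 by lra.
have eb2 : 0 < eta * beta / 2 by lra.
have [x1 hx1] : exists x0 : R, forall x, x0 < x -> 1 + `|n0| <= x `^ 2^-1.
  by apply: powR_large => //; rewrite addr_ge0.
have [x2 hx2] : exists x0 : R, forall x, x0 < x -> 2 / c <= x `^ (eta * beta / 4).
  by apply: powR_large => //; rewrite divr_ge0 ?ltW.
have lnK0 : 0 <= ln K by rewrite ln_ge0.
have [x3 hx3] : exists x0 : R, forall x, x0 < x ->
    ln K / 3 + ln x <= c / 6 * x `^ (eta * beta / 2).
  by apply: ln_le_powR => //; lra.
exists G, c, K, th1, (1 + `|x1| + `|x2| + `|x3|); split => // r k z th hr k0 hk hth hthk.
have r1 : 1 < r%:R :> R.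
  by clear -hr; have := normr_ge0 x1; have := normr_ge0 x2; have := normr_ge0 x3; lra.
have hr1 : x1 < r%:R.
  by clear -hr; have := ler_norm x1; have := normr_ge0 x2; have := normr_ge0 x3; lra.
have hr2 : x2 < r%:R.
  by clear -hr; have := ler_norm x2; have := normr_ge0 x1; have := normr_ge0 x3; lra.
have hr3 : x3 < r%:R.
  by clear -hr; have := ler_norm x3; have := normr_ge0 x2; have := normr_ge0 x1; lra.
have r0 : 0 < r%:R :> R by apply: lt_trans r1.
have [n [rnk nkr]] := ceil_div r k0.
set sq := r%:R `^ 2^-1 in hk.
have sq2 : sq * sq = r%:R.
  by rewrite -expr2 -powR_mulrn ?powR_ge0// /sq -powRrM mulVf ?pnatr_eq0// powRr1// ltW.
have sq0 : 0 < sq by rewrite powR_gt0.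
have sq1 : 1 <= sq by have := hx1 _ hr1; rewrite -/sq; apply: le_trans; rewrite lerDl.
have kr : (k <= r)%N.
  by rewrite -(ler_nat R) -sq2 (le_trans hk)// ler_peMr// ltW.
have sqn : sq <= n%:R.
  have h1 : sq * sq <= n%:R * k%:R by rewrite sq2 -natrM ler_nat.
  have h2 : n%:R * k%:R <= n%:R * sq by rewrite ler_wpM2l.
  by have := le_trans h1 h2; rewrite ler_pM2r.
have n0n : n0 < n%:R.
  apply: lt_le_trans sqn; apply: lt_le_trans (hx1 _ hr1).
  by rewrite (le_lt_trans (ler_norm _))// ltrDr.
have nk2r : (n * k <= 2 * r)%N by rewrite (leq_trans nkr)// mul2n -addnn leq_add2l.
apply: (le_trans (H r n k z th n0n k0 rnk nkr nk2r hth hthk)).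
rewrite lerD2l.
have K0 : 0 < K by apply: lt_le_trans K1.
have -> : K * r%:R ^+ 3 = expR (ln K + 3 * ln r%:R).
  by rewrite expRD lnK ?posrE// expRM_natl lnK ?posrE.
rewrite -expRD ler_expR.
set u := r%:R `^ (eta * beta / 4).
have u2 : r%:R `^ (eta * beta / 2) = u * u.
  by rewrite -expr2 -powR_mulrn ?powR_ge0// /u -powRrM; congr (_ `^ _); field.
have nu2 : u * u <= n%:R `^ (eta * beta).
  have -> : u * u = sq `^ (eta * beta) by rewrite -u2 /sq -powRrM; congr (_ `^ _); field.
  by apply: ge0_ler_powR; rewrite ?nnegrE ?(ltW eb0) ?(ltW sq0).
have h3 := hx3 _ hr3; rewrite u2 in h3.
have h2 := hx2 _ hr2; rewrite -/u ler_pdivrMr// in h2.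
have u0 : 0 <= u by exact: powR_ge0.
have q1 : 2 * u <= u * c * u by rewrite ler_wpM2r.
have q2 : c * (u * u) <= c * n%:R `^ (eta * beta) by rewrite ler_pM2l.
by clear -h3 q1 q2; lra.
Qed.

Lemma tail_bound_weaken (mu b b' e e' : R) : b' <= b -> e' <= e ->
  tail_bound Q mu b e -> tail_bound Q mu b' e'.
Proof.
move=> bb ee [G [c [th0 [r0 [G0 c0 th00 H]]]]].
exists G, c, (1 + th0), (1 + `|r0|); split => //; first by lra.
move=> r z th hr hz h1 h2.
have r1 : 1 <= r%:R :> R by have := normr_ge0 r0; lra.
apply: (le_trans (H r z th _ hz _ _)).
- by have := ler_norm r0; lra.
- by lra.
- by rewrite (le_trans h2)// ler_powR.
by rewrite ler_expR lerN2 ler_pM2l// ler_powR//; lra.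
Qed.

(* With [k = th `^ beta] pieces. *)
Lemma tail_improve (mu beta eta : R) : 0 < beta -> beta <= 1 -> 0 < eta ->
  tail_bound Q mu beta eta -> median_bound Q mu ->
  tail_bound Q mu (beta + beta ^+ 2 / 3) (Num.min 2^-1 (eta * beta / 8)).
Proof.
move=> b0 b1 e0 HT HM.
have [G [c [K [th1 [r1 [G0 c0 K1 th11 H]]]]]] := step_tail b0 b1 e0 HT HM.
have b2 : 0 < beta ^+ 2 / 3 by rewrite divr_gt0// exprn_gt0.
pose b'' := beta + beta ^+ 2 / 3.
have b''0 : 0 < b'' by rewrite addr_gt0.
have b''2 : b'' <= 2.
  have : beta ^+ 2 <= 1 by rewrite exprn_ile1// ltW.
  by rewrite /b''; clear -b1; lra.
pose c' := Num.min (c / 4) 1.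
have c'0 : 0 < c' by rewrite lt_min ltr01 divr_gt0.
have lnK0 : 0 <= ln K by rewrite ln_ge0.
have [x1 hx1] : exists x0 : R, forall x, x0 < x ->
    ln K + ln x <= c / 4 * x `^ (beta ^+ 2 / 3) by apply: ln_le_powR => //; lra.
have [x2 hx2] : exists x0 : R, forall x, x0 < x -> 2 / c' <= x `^ b''.
  by apply: powR_large => //; rewrite divr_ge0 ?ltW.
exists G, (c' / 2), (2 + th1 ^+ 3 + `|x1| + `|x2|), (1 + `|r1|); split.
- by [].
- by rewrite divr_gt0.
- by rewrite -!addrA ltr_wpDr// !addr_ge0 ?exprn_ge0//; lra.
move=> r z th hr hz hth hthr.
have th13 : th1 <= th1 ^+ 3 by rewrite ler_eXnr.
have th2 : 2 <= th by clear -hth th11 th13; have := normr_ge0 x1; have := normr_ge0 x2; lra.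
have thth1 : th1 ^+ 3 <= th by clear -hth; have := normr_ge0 x1; have := normr_ge0 x2; lra.
have thx1 : x1 < th by clear -hth th11 th13; have := ler_norm x1; have := normr_ge0 x2; lra.
have thx2 : x2 < th by clear -hth th11 th13; have := ler_norm x2; have := normr_ge0 x1; lra.
have r11 : 1 <= r%:R :> R by clear -hr; have := normr_ge0 r1; lra.
have r1r : r1 < r%:R by clear -hr; have := ler_norm r1; lra.
have th0 : 0 < th by lra.
have thge1 : 1 <= th by lra.
pose A := th `^ beta.
have A1 : 1 <= A by rewrite -[leLHS](powRr0 th) ler_powR// ltW.
pose k := Num.truncn A.
have kA : k%:R <= A by rewrite truncn_le (le_trans ler01).
have k0 : (0 < k)%N by rewrite truncn_gt0.
have Ak : A / 2 <= k%:R.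
  have := truncnS_gt A; rewrite -/k -natr1.
  have : 1 <= k%:R :> R by rewrite ler1n.
  by clear; lra.
pose kap : R := k%:R `^ (3^-1).
have Ath : A <= th by rewrite -[leRHS](powRr1 (ltW th0)) ler_powR.
have kap3 : kap ^+ 3 = k%:R by rewrite cube_rootK.
have kap1 : 1 <= kap by rewrite cube_root_ge1// ler1n.
(* Both factors reduce to cube roots: [kap <= th^(1/3)] from [k <= th^beta <= th], and
   [th1 <= th^(1/3)] from the choice of the threshold. *)
have hthk : th1 * kap ^+ 2 <= th.
  pose tt : R := th `^ (3^-1).
  have tt3 : tt ^+ 3 = th by rewrite cube_rootK// ltW.
  have tt0 : 0 <= tt by exact: powR_ge0.
  have ktt : kap <= tt by apply: cube_root_le => //; exact: le_trans kA Ath.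
  have t1t : th1 <= tt.
    by apply: le_of_cube_le => //; [exact: le_trans th11|rewrite tt3].
  rewrite -tt3 exprS; apply: ler_pM => //; [lra|by rewrite sqr_ge0|].
  by rewrite expr1; apply: ler_pM => //; exact: le_trans kap1.
have hk : k%:R <= r%:R `^ 2^-1 :> R.
  apply: (le_trans kA); apply: (le_trans Ath); apply: (le_trans hthr).
  by rewrite ler_powR// ge_min lexx.
have hth1 : th1 <= th by exact: le_trans thth1.
apply: (le_trans (H r k z th r1r k0 hk hth1 hthk)).
have T1 : (K * k%:R `^ beta^-1) ^+ k * expR (- (c * (th * kap) `^ beta)) <=
    expR (- (c' * th `^ b'')).
  have K0 : 0 < K by apply: lt_le_trans K1.
  (* An increment has about [k^(1/beta) <= th] effective values, so the entropy is at most
     [th^beta (ln K + ln th)]. The gain [th^(beta + beta^2/3)] beats it by a power of [th]. *)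
  have kt : k%:R `^ beta^-1 <= th.
    have -> : th = A `^ beta^-1 by rewrite -powRrM mulfV ?powRr1 ?gt_eqF// ltW.
    by apply: ge0_ler_powR; rewrite ?nnegrE ?invr_ge0 ?powR_ge0// ltW.
  have p1 : (K * k%:R `^ beta^-1) ^+ k <= expR (A * (ln K + ln th)).
    apply: (@le_trans _ _ ((K * th) ^+ k)).
      by rewrite lerXn2r ?nnegrE ?mulr_ge0 ?powR_ge0 ?(ltW K0) ?(ltW th0)// ler_pM2l.
    have -> : K * th = expR (ln K + ln th) by rewrite expRD !lnK ?posrE.
    rewrite -expRM_natl ler_expR ler_wpM2r// addr_ge0// ln_ge0//.
  have p2 : (th `^ b'') / 2 <= (th * kap) `^ beta.
    have kl : th `^ (beta / 3) / 2 <= kap.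
      have -> : th `^ (beta / 3) = A `^ (3^-1) by rewrite -powRrM.
      have a3 : (A `^ (3^-1)) ^+ 3 = A by exact: cube_rootK (powR_ge0 _ _).
      have a0 : 0 <= A `^ (3^-1) by exact: powR_ge0.
      move: a3 a0; set B := A `^ (3^-1) => a3 a0.
      apply: le_of_cube_le; [by rewrite divr_ge0|exact: le_trans kap1|].
      rewrite kap3 expr_div_n a3; apply: le_trans Ak.
      by move: A1; clear; lra.
    apply: (@le_trans _ _ ((th * (th `^ (beta / 3) / 2)) `^ beta)); last first.
      apply: ge0_ler_powR; rewrite ?nnegrE ?(ltW b0)//.
      - by rewrite mulr_ge0 ?divr_ge0 ?powR_ge0// ltW.
      - by rewrite mulr_ge0 ?powR_ge0// ltW.
      - by rewrite ler_pM2l.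
    have -> : th * (th `^ (beta / 3) / 2) = th `^ (1 + beta / 3) * 2^-1.
      by rewrite powRD_gt0// powRr1 ?mulrA// ltW.
    rewrite powRM ?powR_ge0// -powRrM.
    have -> : (1 + beta / 3) * beta = b'' by rewrite /b''; field.
    by rewrite ler_wpM2l ?powR_ge0// powR_ge_id// invf_le1// ler1n.
  apply: (@le_trans _ _ (expR (A * (ln K + ln th)) * expR (- (c * (th * kap) `^ beta)))).
    by rewrite ler_wpM2r ?expR_ge0.
  rewrite -expRD ler_expR.
  have p3 : A * (ln K + ln th) <= c / 4 * th `^ b''.
    have -> : th `^ b'' = A * th `^ (beta ^+ 2 / 3).
      by rewrite powRD_gt0.
    by rewrite mulrCA ler_pM2l ?hx1// (lt_le_trans ltr01).
  have p4 : c * (th `^ b'' / 2) <= c * (th * kap) `^ beta by rewrite ler_pM2l.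
  have p5 : c' * th `^ b'' <= c / 4 * th `^ b''.
    by rewrite ler_wpM2r ?powR_ge0// ge_min lexx.
  by clear -p3 p4 p5; lra.
(* Since the new exponent is at most 2, [th <= r^(eta beta / 8)] makes the overflow negligible. *)
have T2 : expR (- r%:R `^ (eta * beta / 4)) <= expR (- (c' * th `^ b'')).
  rewrite ler_expR lerN2.
  apply: (@le_trans _ _ (th `^ b'')).
    by rewrite ler_piMl ?powR_ge0// ge_min lexx orbT.
  apply: (@le_trans _ _ (th `^ 2)); first by rewrite ler_powR.
  apply: (@le_trans _ _ ((r%:R `^ (eta * beta / 8)) `^ 2)).
    apply: ge0_ler_powR; rewrite ?nnegrE ?powR_ge0//; first by rewrite ltW.
    by rewrite (le_trans hthr)// ler_powR// ge_min lexx orbT.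
  by rewrite -powRrM (_ : eta * beta / 8 * 2 = eta * beta / 4)//; field.
apply: (le_trans (lerD T1 T2)).
have hx := hx2 _ thx2; rewrite ler_pdivrMr// mulrC in hx.
set E := c' * th `^ b'' in hx *.
(* Two equal terms merge at half the rate: [2 <= exp (E / 2)] as [E >= 2]. *)
have -> : expR (- E) + expR (- E) = expR (- (E / 2)) * (2 * expR (- (E / 2))).
  have -> : expR (- E) = expR (- (E / 2)) * expR (- (E / 2)).
    by rewrite -expRD; congr expR; field.
  by ring.
have -> : c' / 2 * th `^ b'' = E / 2 by rewrite mulrAC.
rewrite ler_piMr ?expR_ge0// expRN ler_pdivrMr ?expR_gt0// mul1r.
by apply: le_trans (expR_ge1Dx _); clear -hx; lra.
Qed.

End iteration.

(** Exponents only grow, so each round gains at least [beta^2 / 3] for the initial [beta]. The range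
    [eta'] is fixed before [Q], so that it depends on the exponents alone. *)
Lemma tail_to_one (R : realType) (m : nat) (beta eta : R) :
  0 < beta -> beta <= 1 -> 0 < eta -> 1 <= beta + m%:R * (beta ^+ 2 / 3) ->
  exists eta' : R, 0 < eta' /\ forall (Q : probability (env R) R) (nu : probability R R) mu,
    iid_law Q nu -> median_bound Q mu -> tail_bound Q mu beta eta -> tail_bound Q mu 1 eta'.
Proof.
elim: m beta eta => [|m IH] beta eta b0 b1 e0 hm.
  rewrite mul0r addr0 in hm; exists eta; split => // Q nu mu _ _.
  exact: tail_bound_weaken.
have bb : 0 < beta ^+ 2 by rewrite exprn_gt0.
pose b' := Num.min 1 (beta + beta ^+ 2 / 3).
pose e' := Num.min 2^-1 (eta * beta / 8).
have b'0 : 0 < b' by rewrite lt_min ltr01 addr_gt0// divr_gt0.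
have b'1 : b' <= 1 by rewrite ge_min lexx.
have e'0 : 0 < e' by rewrite lt_min invr_gt0 ltr0n divr_gt0// mulr_gt0.
have bb' : beta <= b' by rewrite le_min b1 lerDl divr_ge0// ltW.
have hm' : 1 <= b' + m%:R * (b' ^+ 2 / 3).
  have sq : beta ^+ 2 / 3 <= b' ^+ 2 / 3 by rewrite ler_pM2r// lerXn2r// nnegrE ltW.
  have ms : m%:R * (beta ^+ 2 / 3) <= m%:R * (b' ^+ 2 / 3) by rewrite ler_wpM2l.
  have m0 : 0 <= m%:R * (b' ^+ 2 / 3) by rewrite mulr_ge0// divr_ge0// sqr_ge0.
  rewrite -natr1 mulrDl mul1r in hm; rewrite {1}/b' minEle; case: ifP => _.
    by rewrite lerDl.
  by apply: (le_trans hm); rewrite [m%:R * _ + _]addrC addrA lerD2l.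
have [eta' [e'' H]] := IH b' e' b'0 b'1 e'0 hm'.
exists eta'; split => // Q nu mu QE HM HT; apply: (H Q nu mu QE HM).
apply: tail_bound_weaken (tail_improve QE b0 b1 e0 HT HM) => //.
by rewrite /b' ge_min lexx orbT.
Qed.

Section final_tail.
Context {R : realType} {Q : probability (env R) R} {nu : probability R R}.
Hypothesis QE : iid_law Q nu.

(* With [k = (ep th / ln th) `^ (3 / 2)] pieces; [ln K + 2 ln th] per piece is the
   entropy of the chains. *)
Lemma tail_final (mu eta zeta : R) : 0 < eta -> 0 < zeta -> zeta <= 2 / 25 ->
  zeta <= eta / 6 -> tail_bound Q mu 1 eta -> median_bound Q mu ->
  exists (c r0 th0 : R), [/\ 0 < c, 1 < th0 &
    forall (r : nat) (th : R), r0 < r%:R -> th0 <= th -> th <= r%:R `^ zeta ->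
    pr Q (Xe r 0 (mu * r%:R + th * r%:R `^ (3^-1))) <=
      expR (- (c * th `^ (3 / 2) * (ln th) `^ (- 2^-1)))].
Proof.
move=> e0 z0 z1 ze HT HM.
have n32 : 3 / 2 <= 2 :> R by lra.
(* Both [k] and the target exponent are at most [th^(3/2) <= r^(3 zeta / 2)]. The two bounds keep
   [k] below [r^(1/2)] and the target below the overflow rate [r^(eta / 4)]. *)
have z2 : zeta * (3 / 2) <= 2^-1 by lra.
have z3 : zeta * (3 / 2) <= eta / 4 by lra.
have [G [c [K [th1 [r1 [G0 c0 K1 th11 H]]]]]] := step_tail QE ltr01 (lexx 1) e0 HT HM.
have K0 : 0 < K by apply: lt_le_trans K1.
have lnK0 : 0 <= ln K by rewrite ln_ge0.
(* The first entry ensures [th1 * kap^2 <= th]; the second bounds the entropy by half of the gain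
   [c * th * kap]. *)
pose ep := Num.min (th1^-1) (c / (2 * (ln K + 2))).
have ep0 : 0 < ep.
  by rewrite lt_min invr_gt0 (lt_le_trans ltr01)//= divr_gt0// mulr_gt0// ltr_wpDl.
have ep1 : ep <= th1^-1 by rewrite ge_min lexx.
have ep2 : ep <= c / (2 * (ln K + 2)) by rewrite ge_min lexx orbT.
have ep3 : ep <= 1 by apply: (le_trans ep1); rewrite invf_le1// (lt_le_trans ltr01).
pose cc := c / 4 * ep `^ 2^-1.
have cc0 : 0 < cc by rewrite mulr_gt0 ?powR_gt0// divr_gt0.
pose c' := Num.min cc 1.
have c'0 : 0 < c' by rewrite lt_min cc0 ltr01.
have [x1 hx1] : exists x0 : R, forall x, x0 < x -> 0 + ln x <= ep * x `^ 1.
  by apply: ln_le_powR.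
exists (c' / 2), (1 + `|r1|), (expR 1 + th1 + 2 / c' + `|x1|); split.
- by rewrite divr_gt0.
- rewrite -!addrA ltr_pwDl ?expR_gt0//; have := normr_ge0 x1.
  have : 0 <= 2 / c' by rewrite divr_ge0 ?ltW.
  by move: th11; clear; lra.
move=> r th hr hth hthr.
have c'2 : 0 <= 2 / c' by rewrite divr_ge0 ?ltW.
have e1 := expR_gt0 (1 : R); have x10 := normr_ge0 x1.
have the : expR 1 <= th by move: hth th11 c'2 x10; clear; lra.
have th1th : th1 <= th by move: hth e1 c'2 x10; clear; lra.
have thc : 2 / c' <= th by move: hth e1 th11 x10; clear; lra.
have thx : x1 < th by have := ler_norm x1; move: hth th11 e1 c'2; clear; lra.
have th1' : 1 <= th by exact: le_trans th1th.
have th0 : 0 < th by exact: lt_le_trans th1'.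
have r11 : 1 <= r%:R :> R by move: hr; clear; have := normr_ge0 r1; lra.
have r1r : r1 < r%:R by move: hr; clear; have := ler_norm r1; lra.
pose l := ln th.
have l1 : 1 <= l by rewrite -[leLHS](expRK 1) ler_ln ?posrE.
have l0 : 0 < l by exact: lt_le_trans l1.
have lth : l <= th by exact: ln_le_self.
pose q := ep * th / l.
have q1 : 1 <= q.
  by rewrite ler_pdivlMr// mul1r; have := hx1 _ thx; rewrite add0r (powRr1 (ltW th0)).
have q0 : 0 < q by exact: lt_le_trans q1.
have qth : q <= th.
  rewrite ler_pdivrMr//; apply: (@le_trans _ _ (1 * th)); first by rewrite ler_pM2r.
  by rewrite mul1r ler_peMr// ltW.
pose A := q `^ (3 / 2).
have A1 : 1 <= A by rewrite -[leLHS](powRr0 q) ler_powR// divr_ge0.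
pose k := Num.truncn A.
have kA : k%:R <= A by rewrite truncn_le (le_trans ler01).
have k0 : (0 < k)%N by rewrite truncn_gt0.
have Ak : A / 2 <= k%:R.
  have := truncnS_gt A; rewrite -/k -natr1.
  have : 1 <= k%:R :> R by rewrite ler1n.
  by move: (k%:R : R) => kk; clear; lra.
pose kap : R := k%:R `^ (3^-1).
have kap3 : kap ^+ 3 = k%:R by rewrite cube_rootK.
have kap1 : 1 <= kap by rewrite cube_root_ge1// ler1n.
have kap0 : 0 < kap by exact: lt_le_trans kap1.
pose sq := q `^ 2^-1.
have sq0 : 0 <= sq by exact: powR_ge0.
have sq2 : sq ^+ 2 = q.
  by rewrite -powR_mulrn// /sq -powRrM mulVf ?pnatr_eq0// powRr1// ltW.
have sq3 : sq ^+ 3 = A.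
  by rewrite -powR_mulrn// /sq -powRrM; congr (_ `^ _); field.
have ksq : kap <= sq by apply: le_of_cube_le => //; [exact: ltW|rewrite kap3 sq3].
have sqk : sq / 2 <= kap.
  apply: le_of_cube_le; [by rewrite divr_ge0|exact: ltW|].
  rewrite expr_div_n kap3 sq3; apply: le_trans Ak.
  by move: A1; clear; lra.
have kap2 : kap ^+ 2 <= q by rewrite -sq2 lerXn2r// nnegrE ltW.
have hthk : th1 * kap ^+ 2 <= th.
  have th10 : 0 < th1 by exact: lt_le_trans th11.
  apply: (@le_trans _ _ (th1 * q)); first by rewrite ler_pM2l.
  rewrite mulrA ler_pdivrMr// mulrA; apply: (@le_trans _ _ (1 * th)).
    by rewrite ler_pM2r// -ler_pdivlMl// mulr1.
  by rewrite mul1r ler_peMr// ltW.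
have kth : k%:R <= th `^ (3 / 2).
  apply: (le_trans kA); apply: ge0_ler_powR; rewrite ?nnegrE ?(ltW q0) ?(ltW th0) ?divr_ge0//.
have hk : k%:R <= r%:R `^ 2^-1 :> R.
  apply: (le_trans kth); apply: (@le_trans _ _ ((r%:R `^ zeta) `^ (3 / 2))).
    by apply: ge0_ler_powR; rewrite ?nnegrE ?divr_ge0 ?powR_ge0//; exact: ltW.
  by rewrite -powRrM ler_powR.
have := H r k 0 th r1r k0 hk th1th hthk.
rewrite expr0n /= mulr0 mul0r subr0 invr1 !powRr1 ?mulr_ge0 ?(ltW th0) ?(ltW kap0)// mulr1.
rewrite -/kap => /le_trans; apply.
pose W := th `^ (3 / 2) * l `^ (- 2^-1).
have thh : th `^ (3 / 2) = th * th `^ 2^-1.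
  by rewrite -{2}(powRr1 (ltW th0)) -powRD_gt0//; congr (_ `^ _); field.
have l20 : 0 < l `^ 2^-1 by rewrite powR_gt0.
have thW : th <= W.
  rewrite /W thh -mulrA ler_peMr ?(ltW th0)// powRN ler_pdivlMr// mul1r.
  by apply: ge0_ler_powR; rewrite ?nnegrE ?invr_ge0//; exact: ltW.
have W0 : 0 < W by exact: lt_le_trans thW.
(* The gain [th * kap] is comparable to [th * q^(1/2)], which is the claimed exponent up to a
   constant. *)
have thsq : th * sq = ep `^ 2^-1 * W.
  have li : (l^-1) `^ 2^-1 = l `^ (- 2^-1).
    by rewrite -(powR_inv1 (ltW l0)) -powRrM mulN1r.
  have eth : 0 <= ep * th by rewrite mulr_ge0 ?(ltW ep0) ?(ltW th0).
  rewrite /sq /q powRM ?invr_ge0 ?(ltW l0)// powRM ?(ltW ep0) ?(ltW th0)// li /W thh.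
  by ring.
have T1 : (K * k%:R) ^+ k * expR (- (c * (th * kap))) <= expR (- (c' * W)).
  have kR0 : 0 < k%:R :> R by rewrite ltr0n.
  have lk : ln k%:R <= 2 * l.
    apply: (@le_trans _ _ (ln (th `^ (3 / 2)))).
      by rewrite ler_ln ?posrE ?powR_gt0.
    by rewrite ln_powR -/l ler_pM2r.
  (* Since [k = kap^3 <= kap * q] and [q * l = ep * th], the logarithm in the entropy cancels
     against the one in [q]. *)
  have p1 : k%:R * (ln K + ln k%:R) <= c / 2 * (th * kap).
    have h1 : ln K + ln k%:R <= l * (ln K + 2).
      have : ln K <= l * ln K by rewrite ler_peMl.
      by move: lk; clear; lra.
    have h2 : k%:R <= kap * q by rewrite -kap3 exprS ler_pM2l.
    have h3 : ep * (ln K + 2) <= c / 2.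
      have d0 : 0 < ln K + 2 by rewrite ltr_wpDl.
      have -> : c / 2 = c / (2 * (ln K + 2)) * (ln K + 2).
        by field; rewrite gt_eqF.
      by rewrite ler_pM2r.
    apply: (@le_trans _ _ ((kap * q) * (l * (ln K + 2)))).
      apply: ler_pM => //.
      by rewrite addr_ge0// ln_ge0// ler1n.
    have -> : kap * q * (l * (ln K + 2)) = ep * (ln K + 2) * (th * kap).
      by rewrite /q; field; rewrite gt_eqF.
    by rewrite ler_pM2r// mulr_gt0.
  have -> : (K * k%:R) ^+ k = expR (k%:R * (ln K + ln k%:R)).
    by rewrite expRM_natl expRD !lnK ?posrE.
  rewrite -expRD ler_expR.
  have p2 : c / 4 * (th * sq) <= c / 2 * (th * kap).
    have -> : c / 4 * (th * sq) = c / 2 * (th * (sq / 2)) by field.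
    by rewrite ler_pM2l ?divr_gt0// ler_pM2l.
  have p3 : c' * W <= c / 4 * (th * sq).
    by rewrite thsq mulrA -/cc ler_pM2r// ge_min lexx.
  by move: p1 p2 p3; clear; lra.
have T2 : expR (- r%:R `^ (eta / 4)) <= expR (- (c' * W)).
  rewrite ler_expR lerN2.
  apply: (@le_trans _ _ W); first by rewrite ler_piMl ?(ltW W0)// ge_min lexx orbT.
  apply: (@le_trans _ _ (th `^ (3 / 2))).
    rewrite /W powRN ler_piMr ?powR_ge0// invf_le1//.
    by rewrite -[leLHS](powRr0 l) ler_powR.
  apply: (@le_trans _ _ ((r%:R `^ zeta) `^ (3 / 2))).
    by apply: ge0_ler_powR; rewrite ?nnegrE ?divr_ge0 ?powR_ge0//; exact: ltW.
  by rewrite -powRrM ler_powR.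
apply: (le_trans (lerD T1 T2)).
have hx : 2 <= c' * W.
  rewrite -ler_pdivrMl// mulrC; exact: le_trans thW.
rewrite -!mulrA -/W; set E := c' * W in hx *.
have -> : c' * (2^-1 * W) = E / 2 by rewrite /E; ring.
have -> : expR (- E) + expR (- E) = expR (- (E / 2)) * (2 * expR (- (E / 2))).
  have -> : expR (- E) = expR (- (E / 2)) * expR (- (E / 2)).
    by rewrite -expRD; congr expR; field.
  by ring.
rewrite ler_piMr ?expR_ge0// expRN ler_pdivrMr ?expR_gt0// mul1r.
by apply: le_trans (expR_ge1Dx _); move: hx; clear; lra.
Qed.

End final_tail.

(** * Base case *)

Section lpp_facts.
Context {R : realType}.
Implicit Types (f : vtx -> R) (u v : vtx) (s : seq bool).

Lemma lpp_leP f u v (y : \bar R) :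
  (lpp f u v <= y)%E <-> forall s, endp u s = v -> ((\sum_(q <- verts u s) f q)%:E <= y)%E.
Proof.
rewrite /lpp; case: ifPn => [/andP[h1 h2]|huv]; last first.
  split=> [_ s hs|_]; last exact: leNye.
  by exfalso; move: huv; have := endp_ge u s; rewrite hs; lia.
split=> [/bigmax_leP[_ h] s hs|h].
  have [sz ct] := (endp_eqP u v s).1 hs.
  have hsz : size s == (`|(v.1 - u.1)%R| + `|(v.2 - u.2)%R|)%N.
    by move: sz; rewrite /height; lia.
  have := h (Tuple hsz); apply => /=; lia.
apply/bigmax_leP; split; first exact: leNye.
move=> s /eqP hs; apply: h; apply/endp_eqP; rewrite hs size_tuple /height; lia.
Qed.

Lemma lpp_gtP f u v (x : R) :
  (x%:E < lpp f u v)%E <-> exists s, endp u s = v /\ x < \sum_(q <- verts u s) f q.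
Proof.
split=> [h|[s [hs hx]]].
  apply: contrapT => /forallNP hn; move: h; apply/negP; rewrite -leNgt.
  apply/lpp_leP => s hs; rewrite lee_fin leNgt; apply/negP => hx.
  by apply: (hn s).
have /lpp_leP/(_ s hs) := lexx (lpp f u v).
by apply: lt_le_trans; rewrite lte_fin.
Qed.

Lemma lpp_attained f u v : (u.1 <= v.1)%R -> (u.2 <= v.2)%R ->
  exists s, endp u s = v /\ lpp f u v = (\sum_(q <- verts u s) f q)%:E.
Proof.
move=> h1 h2; rewrite /lpp h1 h2 /=.
have [s0 /endp_eqP[hs1 hs2]] := exists_path h1 h2.
have sz0 : size s0 == (`|(v.1 - u.1)%R| + `|(v.2 - u.2)%R|)%N.
  by move: hs1; rewrite /height; lia.
have c0 : count id (Tuple sz0) == `|(v.1 - u.1)%R|%N by rewrite /=; lia.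
have [s hs ->] := @eq_bigmax _ _ _ _ (Tuple sz0) (fun s : _.-tuple bool => count id s == `|(v.1 - u.1)%R|%N) (fun s : _.-tuple bool => (\sum_(w <- verts u s) f w)%:E)
  c0 (fun _ _ => leNye _).
exists s; split => //; apply/endp_eqP.
by move: hs => /= /eqP ->; rewrite size_tuple /height; lia.
Qed.

Lemma sum_verts (w : env R) u s :
  \sum_(q <- verts u s) Num.max (w q) 0 = wt w u (rcons s true).
Proof.
elim: s u => [|b s IH] u /=; first by rewrite big_seq1 addr0.
by rewrite big_cons IH.
Qed.

(** Truncated weights match [lpt] for every [w], not only almost surely. *)
Definition lppe u v (w : env R) : \bar R := lpp (fun q => Num.max (w q) 0) u v.

Lemma lppe_gtP u v x w : (x%:E < lppe u v w)%E <-> lpt u v x w.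
Proof.
rewrite /lppe lpp_gtP; split=> -[s [hs hx]]; exists s; split => //.
  by rewrite -sum_verts.
by rewrite sum_verts.
Qed.

Lemma lppe_ge0 u v w : (u.1 <= v.1)%R -> (u.2 <= v.2)%R -> (0 <= lppe u v w)%E.
Proof.
move=> h1 h2; have [s [_ e]] := lpp_attained (fun q => Num.max (w q) 0) h1 h2.
by rewrite /lppe e sum_verts lee_fin wt_ge0.
Qed.

(** The optimal paths are joined through one intermediate vertex, whose nonnegative truncated weight
    is dropped. *)
Lemma lppe_superadditive u v v' y w : (u.1 <= v.1)%R -> (u.2 <= v.2)%R ->
  (v'.1 <= y.1)%R -> (v'.2 <= y.2)%R -> v' = (v.1 + 1, v.2 + 1) ->
  (lppe u v w + lppe v' y w <= lppe u y w)%E.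
Proof.
move=> h1 h2 h3 h4 ev'; set f := fun q => Num.max (w q) 0.
have [s [hs e]] := lpp_attained f h1 h2.
have [t [ht e']] := lpp_attained f h3 h4.
have vt : endp v [:: true; false] = v'.
  by rewrite ev' /endp/= /step /=.
have hst : endp u (s ++ [:: true; false] ++ t) = y.
  by rewrite endp_cat hs endp_cat vt.
have /lpp_leP/(_ _ hst) := lexx (lpp f u y).
apply: le_trans; rewrite /lppe -/f e e' -EFinD lee_fin !sum_verts.
rewrite !rcons_cat -[rcons s true]cats1 !wt_cat hs vt /=.
by rewrite -!addrA lerD2l lerD2l !add0r lerDr le_max lexx orbT.
Qed.

Lemma measurable_lpp d (T : measurableType d) (f : vtx -> T -> R) u v :
  (forall q, measurable_fun setT (f q)) ->
  measurable_fun setT (fun t => lpp (fun q => f q t) u v).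
Proof.
move=> mf; apply: (measurability _ (ErealGenOInfty.measurableE R)) => //.
move=> _ [_ [x ->] <-]; rewrite setTI.
pose F s := if endp u s == v then [set t | x < \sum_(q <- verts u s) f q t] else set0.
have mF s : measurable (F s).
  rewrite /F; case: ifP => // _.
  have mS : measurable_fun setT (fun t => \sum_(q <- verts u s) f q t).
    by apply: measurable_sum => q; exact: mf.
  have := mS measurableT _ (measurable_itv (Interval (BRight x) (BInfty _ false))).
  rewrite setTI; congr (_ _); apply/seteqP; split=> t /=;
    by rewrite in_itv/= andbT.
rewrite (_ : _ @^-1` _ = [set t | exists s, F s t]); first exact: measurable_exists.
apply/seteqP; split=> t /=; rewrite in_itv /= andbT.
  by move=> /lpp_gtP[s [hs hx]]; exists s; rewrite /F hs eqxx.
move=> [s]; rewrite /F; case: eqP => // hs hx.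
by apply/lpp_gtP; exists s.
Qed.

Lemma measurable_coord (q : vtx) : measurable_fun setT (fun w : env R => w q).
Proof.
move=> _ B mB; rewrite setTI; apply: sub_sigma_algebra.
exists [:: q], (fun=> B); split => //.
apply/seteqP; split=> w /=; first by move=> h v; rewrite inE => /eqP ->.
by apply; rewrite inE.
Qed.

Lemma measurable_lppe u v : measurable_fun setT (lppe u v).
Proof.
apply: measurable_lpp => q; apply: measurable_maxr; last exact: measurable_cst.
exact: measurable_coord.
Qed.

Lemma lppe_shift u v (a : vtx) w :
  lppe u v (env_shift a w) = lppe (u.1 + a.1, u.2 + a.2) (v.1 + a.1, v.2 + a.2) w.
Proof.
apply/eqP; rewrite eq_le; apply/andP; split; apply/lpp_leP => s hs; rewrite sum_verts.
  have hs' : endp (u.1 + a.1, u.2 + a.2) s = (v.1 + a.1, v.2 + a.2).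
    by rewrite endp_shift hs.
  have /lpp_leP/(_ s hs') := lexx (lppe (u.1 + a.1, u.2 + a.2) (v.1 + a.1, v.2 + a.2) w).
  by rewrite sum_verts wt_shift.
have hs' : endp u s = v.
  move: hs; rewrite endp_shift; case: (endp u s) => x y; case: (v) => x' y' /=.
  by case=> /addIr -> /addIr ->.
have /lpp_leP/(_ s hs') := lexx (lppe u v (env_shift a w)).
by rewrite sum_verts wt_shift.
Qed.

End lpp_facts.

(** * Lower deviations from the upper tail *)

Section lower_deviation.
Context {R : realType} (Q : probability (env R) R).

Lemma integral_scaled_indic (s : R) (B : set (env R)) : 0 <= s -> measurable B ->
  (\int[Q]_w (s * \1_B w)%:E)%E = (s * pr Q B)%:E.
Proof.
move=> s0 mB; under eq_integral do rewrite EFinM.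
rewrite ge0_integralZl ?lee_fin//.
- by rewrite integral_indic// setIT EFinM -prE.
- by apply/measurable_EFinP; exact: measurable_indic.
Qed.

(* Since [f] has mean [E], mass below [E - C s] has to be compensated by the
   upper tail, which contributes at most [(th + 1 + S) s]. *)
Lemma lower_deviation (f : env R -> R) (E s th S C : R) :
  measurable_fun setT f -> (forall w, 0 <= f w) -> (\int[Q]_w (f w)%:E = E%:E)%E ->
  0 < s -> 0 <= th -> 0 <= C ->
  (forall N, \sum_(m <- iota 0 N) pr Q [set w | E + (th + m%:R) * s < f w] <= S) ->
  C * pr Q [set w | f w <= E - C * s] <= th + 1 + S.
Proof.
move=> mf f0 intf s0 th0 C0 hS.
have mray (b : interval R) : measurable (f @^-1` [set` b]).
  by rewrite -[X in measurable X]setTI; apply: mf => //; exact: measurable_itv.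
pose A := [set w | f w <= E - C * s].
have mA : measurable A.
  rewrite (_ : A = f @^-1` [set` Interval (BInfty _ true) (BRight (E - C * s))]); first exact: mray.
  by apply/seteqP; split=> w; rewrite /A /= in_itv.
pose B (m : nat) := [set w | E + (th + m%:R) * s < f w].
have mB m : measurable (B m).
  rewrite (_ : B m = f @^-1` [set` Interval (BRight (E + (th + m%:R) * s)) (BInfty _ false)]); first exact: mray.
  by apply/seteqP; split=> w; rewrite /B /= in_itv /= andbT.
have E0 : 0 <= E.
  by rewrite -lee_fin -intf; apply: integral_ge0 => w _; rewrite lee_fin.
have Cs0 : 0 <= C * s by rewrite mulr_ge0// ltW.
have b0 : 0 <= E + (th + 1) * s by rewrite addr_ge0// mulr_ge0 ?addr_ge0// ltW.
have phi0 m w : (0 <= (s * \1_(B m) w)%:E :> \bar R)%E.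
  by rewrite lee_fin mulr_ge0// ltW.
have mphi m : measurable_fun setT (fun w => (s * \1_(B m) w)%:E).
  by apply/measurable_EFinP; apply: measurable_funM => //; exact: measurable_indic.
have mind : measurable_fun setT (fun w => (C * s * \1_A w)%:E).
  by apply/measurable_EFinP; apply: measurable_funM => //; exact: measurable_indic.
have mfE : measurable_fun setT (fun w => (f w)%:E) by exact/measurable_EFinP.
(* Layer-cake bound: above [E + (th + 1) s], the indicators count the excess in units of [s]. On [A]
   the gap [C s] fits below [E]. After integration [E] cancels. *)
have pointwise w : ((f w)%:E + (C * s * \1_A w)%:E <=
    (E + (th + 1) * s)%:E + \sum_(0 <= m <oo) (s * \1_(B m) w)%:E)%E.
  have [Aw|nAw] := pselect (A w).
    rewrite indicE mem_set// mulr1 -EFinD.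
    apply: (@le_trans _ _ (E + (th + 1) * s)%:E).
      rewrite lee_fin; move: Aw; rewrite /A /= => Aw.
      have : 0 <= (th + 1) * s by rewrite mulr_ge0 ?addr_ge0// ltW.
      by move: Aw; clear; lra.
    by rewrite leeDl// nneseries_ge0.
  rewrite indicE memNset// mulr0 adde0.
  have [small|big] := leP (f w) (E + (th + 1) * s).
    by apply: (@le_trans _ _ (E + (th + 1) * s)%:E); rewrite ?lee_fin// leeDl// nneseries_ge0.
  pose D := (f w - E - th * s) / s.
  have fD : f w = E + th * s + D * s by rewrite /D divfK ?gt_eqF//; ring.
  have D1 : 1 < D.
    by rewrite ltr_pdivlMr//; move: big; clear; lra.
  pose M := Num.truncn D.
  have MD : M%:R <= D by rewrite truncn_le ltW// (lt_trans ltr01).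
  have DM : D < M%:R + 1 by have := truncnS_gt D; rewrite -natr1.
  apply: (@le_trans _ _ ((E + (th + 1) * s)%:E + \sum_(0 <= m < M) (s * \1_(B m) w)%:E)%E); last first.
    by rewrite leeD2l// nneseries_lim_ge.
  have -> : (\sum_(0 <= m < M) (s * \1_(B m) w)%:E = (M%:R * s)%:E :> \bar R)%E.
    rewrite sumEFin (eq_big_nat _ _ (F2 := fun=> s)); last first.
      move=> m /andP[_ mM]; rewrite indicE mem_set ?mulr1// /B /= fD mulrDl addrA ltrD2l ltr_pM2r//.
      by rewrite (lt_le_trans _ MD)// ltr_nat.
    by rewrite sumr_const_nat subn0 mulr_natl.
  rewrite -EFinD lee_fin fD.
  have : D * s <= (M%:R + 1) * s by rewrite ler_pM2r// ltW.
  by clear; lra.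
have := @ge0_le_integral _ _ _ Q setT measurableT _ _ _ _ _ (fun w _ => pointwise w).
have ser0 w : (0 <= \sum_(0 <= m <oo) (s * \1_(B m) w)%:E :> \bar R)%E by exact: nneseries_ge0.
have mser : measurable_fun setT (fun w => \sum_(0 <= m <oo) (s * \1_(B m) w)%:E)%E.
  by apply: ge0_emeasurable_sum => //; move=> *; exact: mphi.
have -> : (\int[Q]_w ((f w)%:E + (C * s * \1_A w)%:E) = E%:E + (C * s * pr Q A)%:E)%E.
  rewrite ge0_integralD//.
  - by rewrite intf integral_scaled_indic.
  - by move=> w _; rewrite lee_fin.
  - by move=> w _; rewrite lee_fin mulr_ge0.
have -> : (\int[Q]_w ((E + (th + 1) * s)%:E + \sum_(0 <= m <oo) (s * \1_(B m) w)%:E) =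
    (E + (th + 1) * s)%:E + \sum_(0 <= m <oo) (s * pr Q (B m))%:E)%E.
  rewrite ge0_integralD//.
  rewrite integral_cst//; congr (_ + _)%E.
    by rewrite -[RHS]mule1; congr (_ * _)%E; exact: (@probability_setT _ _ _ Q).
  rewrite integral_nneseries//; apply: eq_eseriesr => m _.
  by rewrite integral_scaled_indic// ltW.
move=> hint.
have hser : (\sum_(0 <= m <oo) (s * pr Q (B m))%:E <= (s * S)%:E)%E.
  apply: lime_le.
    by apply: is_cvg_nneseries => m _ _; rewrite lee_fin mulr_ge0 ?pr_ge0// ltW.
  apply: nearW => N; rewrite sumEFin lee_fin -mulr_sumr ler_pM2l//.
  by have := hS N; rewrite /index_iota subn0.
have : (E%:E + (C * s * pr Q A)%:E <= (E + (th + 1) * s)%:E + (s * S)%:E)%E.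
  apply: (le_trans (hint _ _ _)).
  - by move=> w _; rewrite adde_ge0// lee_fin// mulr_ge0.
  - exact: emeasurable_funD.
  - by apply: emeasurable_funD => //; exact: measurable_cst.
  - by rewrite leeD2l.
rewrite -!EFinD lee_fin => h.
rewrite -(ler_pM2r s0); move: h; rewrite /A; set p := pr Q _.
by clear; lra.
Qed.

End lower_deviation.

(** * Mean bounds on the canonical space *)

Section moment_assumptions.
Context {R : realType} {Q : probability (env R) R} {nu : probability R R}.
Hypothesis QE : iid_law Q nu.

Definition EX (r : nat) (z : int) : \bar R :=
  (\int[Q]_w lppe (1, 1)%R (r%:Z - z, r%:Z + z)%R w)%E.

Lemma integral_lppe_shift u v (a : vtx) : (u.1 <= v.1)%R -> (u.2 <= v.2)%R ->
  (\int[Q]_w lppe (u.1 + a.1, u.2 + a.2)%R (v.1 + a.1, v.2 + a.2)%R w =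
   \int[Q]_w lppe u v w)%E.
Proof.
move=> h1 h2.
transitivity (\int[Q]_w (lppe u v \o env_shift a) w)%E.
  by apply: eq_integral => w _ /=; rewrite lppe_shift.
have := @ge0_integral_pushforward _ _ (env R) (env R) R _ (@measurable_shift R a) Q setT (lppe u v)
  measurableT (measurable_lppe u v) (fun w _ => lppe_ge0 w h1 h2).
rewrite preimage_setT => <-.
apply: eq_measure_integral => [|mf A mA _]; first exact: measurable_shift.
exact: (shift_law QE a mA).
Qed.

Lemma EX_ge0 r z : (`|z| < r)%N -> (0 <= EX r z)%E.
Proof. by move=> zr; apply: integral_ge0 => w _; apply: lppe_ge0 => /=; lia. Qed.

Lemma EX_superadditive r m z : (`|z| < r)%N -> (0 < m)%N ->
  (EX r z + EX m 0 <= EX (r + m) z)%E.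
Proof.
move=> zr m0.
have h1 : (1 <= r%:Z - z)%R by lia.
have h2 : (1 <= r%:Z + z)%R by lia.
have -> : EX m 0 = (\int[Q]_w lppe (1 + (r%:Z - z), 1 + (r%:Z + z))%R
    ((m%:Z - 0) + (r%:Z - z), (m%:Z + 0) + (r%:Z + z))%R w)%E.
  by rewrite /EX -(@integral_lppe_shift _ _ (r%:Z - z, r%:Z + z)) //=; lia.
have p2 w : (0 <= lppe (1 + (r%:Z - z), 1 + (r%:Z + z))%R
    ((m%:Z - 0) + (r%:Z - z), (m%:Z + 0) + (r%:Z + z))%R w :> \bar R)%E.
  by apply: lppe_ge0 => /=; lia.
have p1 w : (0 <= lppe (1, 1)%R (r%:Z - z, r%:Z + z)%R w :> \bar R)%E by exact: lppe_ge0.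
rewrite -ge0_integralD//; try exact: measurable_lppe.
apply: ge0_le_integral => //.
- by move=> w _; rewrite adde_ge0.
- by apply: emeasurable_funD; exact: measurable_lppe.
- exact: measurable_lppe.
move=> w _; apply: (@le_trans _ _ (lppe (1, 1)%R
    ((m%:Z - 0) + (r%:Z - z), (m%:Z + 0) + (r%:Z + z))%R w)).
  by apply: lppe_superadditive => //=; try lia; congr pair; lia.
by rewrite le_eqVlt; apply/orP; left; apply/eqP; congr lppe; congr pair; lia.
Qed.

Definition law_LS (mu : R) : Prop :=
  exists (rho G H g1 : R), [/\ 0 < rho, 0 < G, 0 < H, 0 < g1 &
  exists r1 : nat, forall r : nat, (r1 <= r)%N ->
  forall z : int, `|z%:~R| <= rho * r%:R ->
    ((mu * r%:R - G * z%:~R ^+ 2 / r%:R - H * z%:~R ^+ 4 / r%:R ^+ 3 -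
       g1 * r%:R `^ (3^-1))%:E <= EX r z)%E /\
    (EX r z <= (mu * r%:R - G * z%:~R ^+ 2 / r%:R)%:E)%E].

Definition law_UT (alpha : R) : Prop :=
  forall eps : R, 0 < eps ->
  exists (c theta0 r0 : R), [/\ 0 < c, 0 < theta0, 0 < r0 &
  forall (r : nat) (theta : R) (z : int) (m : R),
    r0 < r%:R -> theta0 < theta -> `|z%:~R| <= (1 - eps) * r%:R -> EX r z = m%:E ->
    pr Q (Xe r z (m + theta * r%:R `^ (3^-1))) <= expR (- (c * theta `^ alpha))].

(* Appending a diagonal path of length [N r] with [N >= 1 / rho] brings every [z] into
   the range where the upper bound on the mean is assumed, and the diagonal piece
   has mean at least [mu N r - g1 (N r)^(1/3)]. *)
Lemma EX_upper mu : law_LS mu ->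
  exists G C r0 : R, [/\ 0 < G, 0 < C & forall (r : nat) (z : int), r0 < r%:R -> (`|z| < r)%N ->
    exists m : R, [/\ EX r z = m%:E, 0 <= m &
      m <= mu * r%:R - G * z%:~R ^+ 2 / r%:R + C * r%:R `^ (3^-1)]].
Proof.
move=> [rho [G [H [g1 [rho0 G0 H0 g10 [r1 hLS]]]]]].
pose N := (Num.truncn rho^-1).+1.
have rN : 1 <= rho * N%:R by rewrite -ler_pdivrMl// mulr1 ltW// truncnS_gt.
have N1 : 1 <= N%:R :> R by rewrite ler1n.
exists (G / (N%:R + 1)), (g1 * N%:R), (r1%:R); split.
- by rewrite divr_gt0// ltr_wpDl.
- by rewrite mulr_gt0// (lt_le_trans ltr01).
move=> r z; rewrite ltr_nat => hr zr.
have r0 : (0 < r)%N by exact: leq_ltn_trans zr.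
have rR : 0 < r%:R :> R by rewrite ltr0n.
have m0 : (0 < N * r)%N by rewrite muln_gt0 r0.
have sup := EX_superadditive zr m0.
have rA : (r1 <= r + N * r)%N by rewrite (leq_trans (ltnW hr))// leq_addr.
have zA : `|z%:~R| <= rho * (r + N * r)%:R.
  apply: (@le_trans _ _ r%:R).
    by rewrite -intr_norm -abszE -(pmulrn 1) ler_nat; exact: ltnW.
  rewrite natrD natrM mulrDr.
  have : r%:R <= rho * N%:R * r%:R by rewrite ler_peMl.
  have : 0 <= rho * r%:R by rewrite mulr_ge0// ltW.
  by clear; lra.
have rB : (r1 <= N * r)%N by rewrite (leq_trans (ltnW hr))// leq_pmull.
have zB : `|(0 : int)%:~R| <= rho * (N * r)%:R by rewrite normr0 mulr_ge0// ltW.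
have [_ up] := hLS _ rA z zA.
have [lo _] := hLS _ rB 0 zB.
have f1 := EX_ge0 zr.
have f2 : (0 <= EX (N * r) 0)%E by apply: EX_ge0.
(* The two means are nonnegative and their sum is bounded by a real number, so both are finite. *)
move: sup up lo f1 f2.
case: (EX r z) => [m| |]; case: (EX (N * r) 0) => [m'| |]; case: (EX (r + N * r) z) => [M| |] //=.
rewrite -?EFinD !lee_fin => sup up lo f1 f2.
exists m; split => //.
move: up lo; rewrite !expr0n /= !mulr0 !mul0r !subr0 natrD natrM => up lo.
set s := r%:R `^ 3^-1.
have s0 : 0 <= s by exact: powR_ge0.
have Ns : (N%:R * r%:R) `^ 3^-1 <= N%:R * s.
  rewrite powRM// ler_wpM2r// -[leRHS]powRr1// ler_powR// invf_le1// ler1n//.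
have h1 : g1 * (N%:R * r%:R) `^ 3^-1 <= g1 * (N%:R * s) by rewrite ler_pM2l.
have e : G * z%:~R ^+ 2 / (r%:R + N%:R * r%:R) = G / (N%:R + 1) * z%:~R ^+ 2 / r%:R.
  have d0 : N%:R + 1 != 0 :> R by rewrite gt_eqF// ltr_wpDl.
  have d1 : r%:R + N%:R * r%:R != 0 :> R by rewrite gt_eqF// ltr_pwDl// mulr_ge0.
  by field; rewrite d0 d1 gt_eqF.
by rewrite e in up; move: sup up lo h1; clear; lra.
Qed.

(** For [|z|] up to [2 r^(2/3)], both [z^2 / r] and [z^4 / r^3] are [O(r^(1/3))]. *)
Lemma EX_lower mu : law_LS mu ->
  exists C r0 : R, 0 < C /\ forall (r : nat) (z : int), r0 < r%:R ->
    `|z%:~R| <= 2 * (r%:R `^ (3^-1)) ^+ 2 :> R ->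
    ((mu * r%:R - C * r%:R `^ (3^-1))%:E <= EX r z)%E.
Proof.
move=> [rho [G [H [g1 [rho0 G0 H0 g10 [r1 hLS]]]]]].
have [x0 hx0] : exists x0 : R, forall x, x0 < x -> 2 / rho <= x `^ 3^-1.
  by apply: powR_large => //; rewrite divr_ge0// ltW.
exists (4 * G + 16 * H + g1), (1 + r1%:R + `|x0|); split.
  by rewrite !addr_gt0// mulr_gt0.
move=> r z hr hz.
have x00 := normr_ge0 x0; have r10 : 0 <= r1%:R :> R by [].
have r11 : 1 <= r%:R :> R by move: hr x00 r10; clear; lra.
have hrx : x0 < r%:R by have := ler_norm x0; move: hr r10; clear; lra.
have hr1 : (r1 <= r)%N by rewrite -(ler_nat R); move: hr x00; clear; lra.
have := hx0 _ hrx; set s := r%:R `^ 3^-1 in hz * => hs.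
have s3 : s ^+ 3 = r%:R by rewrite cube_rootK.
have s1 : 1 <= s by exact: cube_root_ge1.
have s0 : 0 < s by exact: lt_le_trans s1.
have zr : `|z%:~R| <= rho * r%:R.
  apply: (le_trans hz); rewrite -s3 (exprS s 2) mulrA ler_pM2r ?exprn_gt0//.
  by rewrite -ler_pdivrMl// mulrC.
have [lo _] := hLS r hr1 z zr.
apply: le_trans lo; rewrite lee_fin -/s -s3.
set Z := z%:~R : R in hz zr *.
have hz2 : Z ^+ 2 <= 4 * s ^+ 4.
  have : `|Z| ^+ 2 <= (2 * s ^+ 2) ^+ 2.
    by rewrite lerXn2r// nnegrE mulr_ge0 ?exprn_ge0// ltW.
  by rewrite real_normK ?num_real// exprMn -exprM; clear; lra.
have hz4 : Z ^+ 4 <= 16 * s ^+ 8.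
  have : (Z ^+ 2) ^+ 2 <= (4 * s ^+ 4) ^+ 2.
    by rewrite lerXn2r// nnegrE ?sqr_ge0 ?mulr_ge0 ?exprn_ge0// ltW.
  by rewrite -exprM [(4 * _) ^+ 2]exprMn -exprM /=; clear; lra.
have q1 : G * Z ^+ 2 / s ^+ 3 <= 4 * G * s.
  rewrite ler_pdivrMr ?exprn_gt0// -[leRHS]mulrA -exprS.
  have : G * Z ^+ 2 <= G * (4 * s ^+ 4) by rewrite ler_pM2l.
  by clear; lra.
have q2 : H * Z ^+ 4 / (s ^+ 3) ^+ 3 <= 16 * H * s.
  rewrite ler_pdivrMr ?exprn_gt0// -exprM -[leRHS]mulrA -exprS.
  apply: (@le_trans _ _ (H * (16 * s ^+ 8))); first by rewrite ler_pM2l.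
  have : H * s ^+ 8 <= H * s ^+ 10 by rewrite ler_pM2l// ler_weXn2l.
  by rewrite /=; clear; lra.
by move: q1 q2; clear; lra.
Qed.

End moment_assumptions.

Lemma range_coord (r : nat) (z : int) : (`|z| < r)%N ->
  (1 <= r%:Z - z)%R /\ (1 <= r%:Z + z)%R.
Proof. by split; lia. Qed.

Section base_bounds.
Context {R : realType} {Q : probability (env R) R} {nu : probability R R}.
Hypothesis QE : iid_law Q nu.

Lemma prC (A : set (env R)) : measurable A -> pr Q (~` A) = 1 - pr Q A.
Proof.
move=> mA; apply: EFin_inj; rewrite EFinB -prE//; last exact: measurableC.
by rewrite -prE// probability_setC.
Qed.

Lemma median_of_LS_UT (mu alpha : R) : 0 < alpha ->
  @law_LS R Q mu -> @law_UT R Q alpha -> median_bound Q mu.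
Proof.
move=> alpha0 LS UT.
have [C1 [r1 [C10 hlow]]] := EX_lower LS.
have [G [C' [r2 [_ _ hup]]]] := EX_upper QE LS.
have half0 : 0 < 2^-1 :> R by [].
have [c [th0 [r0 [c0 th00 r00 hUT]]]] := UT _ half0.
have [K [K0 hK]] := expR_decay c0 alpha0.
(* Twice the bound of [lower_deviation] at [th0 + 1], where [2 * K] sums the upper tail; the lower
   event then has probability at most one half. *)
pose C2 := 2 * (th0 + 1 + 1 + 2 * K).
have C20 : 0 < C2 by rewrite mulr_gt0// !addr_gt0// mulr_gt0.
(* [r >= 64] gives [r^(1/3) >= 4], hence [2 r^(2/3) <= r / 2] and the tail assumption applies with
   [eps = 1/2]. *)
exists (C1 + C2), (64 + `|r1| + `|r2| + r0); split; first by rewrite addr_gt0.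
move=> r z hr hz.
have r10 := normr_ge0 r1; have r20 := normr_ge0 r2.
have hr1 : r1 < r%:R by have := ler_norm r1; clear -hr r20 r00; lra.
have hr2 : r2 < r%:R by have := ler_norm r2; clear -hr r10 r00; lra.
have hr0 : r0 < r%:R by clear -hr r10 r20; lra.
have r64 : 64 <= r%:R :> R by clear -hr r10 r20 r00; lra.
have h1 := hlow r z hr1 hz.
set s := r%:R `^ 3^-1 in hz h1 *.
have s3 : s ^+ 3 = r%:R by rewrite cube_rootK.
have s4 : 4 <= s.
  apply: le_of_cube_le => //; first exact: powR_ge0.
  by rewrite s3; apply: le_trans r64; rewrite -natrX ler_nat.
have s0 : 0 < s by apply: lt_le_trans s4.
have zhalf : `|z%:~R| <= (1 - 2^-1) * r%:R :> R.
  apply: (le_trans hz); rewrite -s3 (exprS s 2) [leRHS]mulrA ler_pM2r ?exprn_gt0//.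
  by clear -s4; lra.
have zr : (`|z| < r)%N.
  have : `|z%:~R| < r%:R :> R.
    by apply: (le_lt_trans zhalf); clear -r64; lra.
  by rewrite -intr_norm -abszE -(pmulrn 1) ltr_nat.
have [m [em m0 _]] := hup r z hr2 zr.
rewrite em lee_fin in h1.
have coord := range_coord zr.
pose F := @lppe R (1, 1) (r%:Z - z, r%:Z + z).
pose f w := fine (F w).
have fF w : (f w)%:E = F w.
  have [t [_ e]] := @lpp_attained R (fun q => Num.max (w q) 0) (1, 1)
     (r%:Z - z, r%:Z + z) coord.1 coord.2.
  by rewrite /f /F /lppe e.
have fFE : EFin \o f = F by apply/funext => w; exact: fF.
have mf : measurable_fun setT f.
  by apply/measurable_EFinP; rewrite fFE; exact: measurable_lppe.
have f0 w : 0 <= f w by apply: fine_ge0; apply: lppe_ge0; case: coord.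
have intf : (\int[Q]_w (f w)%:E = m%:E)%E.
  by rewrite -em /EX; apply: eq_integral => w _; rewrite fF.
have fXe x : [set w | x < f w] = Xe r z x.
  apply/seteqP; split=> w /=.
    by move=> h; apply/lppe_gtP; rewrite -/F -fF lte_fin.
  by move=> /lppe_gtP h; rewrite -lte_fin fF.
have th1 : 0 <= th0 + 1 by rewrite addr_ge0// ltW.
have hS N : \sum_(i <- iota 0 N) pr Q [set w | m + (th0 + 1 + i%:R) * s < f w] <= 2 * K.
  apply: (@le_trans _ _ (\sum_(i <- iota 0 N) K * (1 + i%:R) ^- 2)).
    apply: ler_sum => i _; rewrite fXe.
    have i0 : 0 <= i%:R :> R by [].
    have ti : th0 < th0 + 1 + i%:R by rewrite -addrA ltrDl ltr_pwDl.
    have ti0 : 0 <= th0 + 1 + i%:R by rewrite addr_ge0.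
    apply: (le_trans (hUT r _ z m hr0 ti zhalf em)); apply: (le_trans (hK _ ti0)).
    rewrite ler_pM2l// lef_pV2 ?posrE ?exprn_gt0 ?ltr_pwDl//.
    have le1 : 1 + i%:R <= 1 + (th0 + 1 + i%:R) by rewrite lerD2l lerDr.
    by apply: lerXn2r => //; rewrite nnegrE addr_ge0.
  by rewrite -mulr_sumr mulrC ler_pM2r// sum_inv_sqr.
have := lower_deviation mf f0 intf s0 th1 (ltW C20) hS.
have mX : measurable (Xe r z (m - C2 * s) : set (env R)) by exact: measurable_lpt.
have -> : [set w | f w <= m - C2 * s] = ~` Xe r z (m - C2 * s).
  by rewrite -fXe; apply/seteqP; split=> w /=; rewrite leNgt => /negP.
rewrite prC// => hp.
apply: (@le_trans _ _ (pr Q (Xe r z (m - C2 * s)))); last first.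
  apply: le_pr => //; first exact: measurable_lpt.
  by apply: lpt_le; clear -h1; lra.
have : C2 * (1 - pr Q (Xe r z (m - C2 * s))) <= C2 * 2^-1.
  by apply: (le_trans hp); rewrite /C2; clear; lra.
by rewrite ler_pM2l//; clear; lra.
Qed.

(* Near the axes, where no tail is assumed, the endpoint is moved up to
   [(r + e, z -/+ e)]; the cost [mu e] is absorbed by the parabola. *)
Lemma tail_of_LS_UT (mu alpha eta : R) : 0 < alpha ->
  @law_LS R Q mu -> @law_UT R Q alpha -> tail_bound Q mu alpha eta.
Proof.
move=> alpha0 LS UT.
have [G [C [r1 [G0 C0 hup]]]] := EX_upper QE LS.
have mu0 := normr_ge0 mu.
(* [1/16] gives [r + e <= 9/8 r] and [|z'| >= 13/16 r]; the other entry gives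
   [|mu| e <= G r / 4]. *)
pose eps := Num.min 16^-1 (G / (8 * (`|mu| + 1))).
have eps0 : 0 < eps by rewrite lt_min invr_gt0 ltr0n divr_gt0// mulr_gt0// ltr_wpDl.
have eps1 : eps <= 16^-1 by rewrite ge_min lexx.
have eps2 : eps * `|mu| * 8 <= G.
  have : eps <= G / (8 * (`|mu| + 1)) by rewrite ge_min lexx orbT.
  rewrite ler_pdivlMr; last by rewrite mulr_gt0// ltr_wpDl.
  by apply: le_trans; clear -eps0; lra.
have [c [th0 [r0 [c0 th00 r00 hUT]]]] := UT _ eps0.
pose c' := c * 4^-1 `^ alpha.
have c'0 : 0 < c' by rewrite mulr_gt0// powR_gt0.
have red th : 0 <= th -> c * (th / 4) `^ alpha = c' * th `^ alpha.
  by move=> t0; rewrite powRM// mulrAC mulrA.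
exists (G / 4), c', (1 + 4 * th0 + 4 * C), (1 + `|r1| + r0 + eps^-1); split => //.
- by rewrite divr_gt0.
- by rewrite !addr_gt0// mulr_gt0.
move=> r z th hr hz hth _.
have ei0 : 0 < eps^-1 by rewrite invr_gt0.
have r10 := normr_ge0 r1.
have hr1 : r1 < r%:R by have := ler_norm r1; clear -hr r00 ei0; lra.
have hr0 : r0 < r%:R by clear -hr r10 ei0; lra.
have r11 : 1 <= r%:R :> R by clear -hr r10 r00 ei0; lra.
have re : eps^-1 <= r%:R by clear -hr r10 r00; lra.
have re1 : 1 <= eps * r%:R by rewrite -ler_pdivrMl// mulr1.
have r0' : 0 < r%:R :> R by exact: lt_le_trans r11.
have th4 : th0 < th / 4 by clear -hth C0; lra.
have thC : 4 * C <= th by clear -hth th00; lra.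
have th0' : 0 <= th by clear -hth th00 C0; lra.
set s := r%:R `^ 3^-1.
have s0 : 0 <= s by exact: powR_ge0.
have zR : `|z%:~R| = `|z|%N%:R :> R by rewrite -intr_norm -abszE -(pmulrn 1).
have [zsmall|zbig] := leP `|z%:~R : R| ((1 - eps) * r%:R).
  have zr : (`|z| < r)%N.
    rewrite -(ltr_nat R) -zR (le_lt_trans zsmall)// gtr_pMl//.
    by clear -eps0; lra.
  have [m [em m0 hm]] := hup r z hr1 zr.
  rewrite -red//; apply: le_trans (hUT r (th / 4) z m hr0 th4 zsmall em).
  apply: le_pr; [exact: measurable_lpt|exact: measurable_lpt|].
  apply: lpt_le; rewrite -/s in hm *.
  have q1 : (C + th / 4) * s <= th * s by rewrite ler_wpM2r//; clear -thC th0'; lra.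
  have q2 : 0 <= G * z%:~R ^+ 2 / r%:R.
    by apply: divr_ge0 => //; apply: mulr_ge0; [exact: ltW|exact: sqr_ge0].
  have -> : G / 4 * z%:~R ^+ 2 / r%:R = (G * z%:~R ^+ 2 / r%:R) / 4 by ring.
  by clear -hm q1 q2; lra.
pose e := (Num.truncn (eps * r%:R)).+1.
have e1 : eps * r%:R <= e%:R by rewrite ltW// truncnS_gt.
have e2 : e%:R <= 2 * (eps * r%:R).
  have : (Num.truncn (eps * r%:R))%:R <= eps * r%:R by rewrite truncn_le (le_trans ler01).
  by rewrite /e -natr1; clear -re1; lra.
have er8 : eps * r%:R <= r%:R / 16.
  by rewrite mulrC ler_pM2l.
have ez : (e <= `|z|)%N.
  rewrite -(ler_nat R) -zR (le_trans e2)// (le_trans _ (ltW zbig))//.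
  by clear -er8 r0'; lra.
(* For [z >= 0] the new endpoint is [(r - z + 2 e, r + z)]: only the coordinate near the axis
   grows. *)
pose z' : int := if (0 <= z)%R then z - e%:Z else z + e%:Z.
have z'E : `|z'|%N = (`|z| - e)%N by rewrite /z'; clear -ez; case: ifP; lia.
have z'R : `|z'%:~R| = `|z|%N%:R - e%:R :> R.
  by rewrite -intr_norm -abszE -(pmulrn 1) z'E natrB.
have zrR : `|z|%N%:R <= r%:R :> R by rewrite ler_nat.
have sub x : @Xe R r z x `<=` @Xe R (r + e) z' x.
  have [k1 k2] : (r%:Z - z <= (r + e)%:Z - z')%R /\ (r%:Z + z <= (r + e)%:Z + z')%R.
    by rewrite /z'; clear -ez; case: ifP; split; lia.
  exact: lpt_mono.
have z're : (`|z'| < r + e)%N.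
  by rewrite z'E (leq_ltn_trans (leq_subr _ _))// -[X in (X < _)%N]addn0 -addnS leq_add.
have hre : r%:R <= (r + e)%:R :> R by rewrite ler_nat leq_addr.
have z'small : `|z'%:~R| <= (1 - eps) * (r + e)%:R :> R.
  rewrite z'R natrD.
  have : eps * e%:R <= e%:R by rewrite ler_piMl// (le_trans eps1)// invf_le1// ler1n.
  by clear -zrR e1; lra.
have [m [em m0 hm]] := hup (r + e)%N z' (lt_le_trans hr1 hre) z're.
rewrite -red//; apply: le_trans (hUT (r + e)%N (th / 4) z' m (lt_le_trans hr0 hre) th4 z'small em).
apply: le_pr; [exact: measurable_lpt|exact: measurable_lpt|].
apply: subset_trans (sub _) _.
apply: lpt_le; set s' := (r + e)%:R `^ 3^-1 in hm *.
have s's : s' <= 2 * s.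
  have -> : 2 * s = ((2 * s) ^+ 3) `^ 3^-1.
    by rewrite -powR_mulrn ?mulr_ge0// -powRrM mulfV ?pnatr_eq0// powRr1// mulr_ge0.
  apply: cube_root_le => //; rewrite exprMn cube_rootK// natrD.
  by clear -e2 er8 r0'; lra.
have q1 : (C + th / 4) * s' <= th * s.
  apply: (@le_trans _ _ ((C + th / 4) * (2 * s))).
    by rewrite ler_wpM2l// addr_ge0 ?(ltW C0)// divr_ge0.
  have : 0 <= (th - 4 * C) * s by rewrite mulr_ge0// subr_ge0.
  by clear; lra.
have q2 : z%:~R ^+ 2 / r%:R <= r%:R :> R.
  rewrite ler_pdivrMr// -expr2 -[X in X <= _]real_normK ?num_real// zR.
  by rewrite lerXn2r// nnegrE.
(* The parabola is worth at least [G r / 2]: half of it pays for [mu e], the rest dominates the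
   final parabola [G / 4 * z^2 / r]. *)
have q3 : r%:R / 2 <= z'%:~R ^+ 2 / (r + e)%:R :> R.
  have zb : 13 / 16 * r%:R <= `|z'%:~R| :> R.
    by rewrite z'R; rewrite zR in zbig; clear -zbig e2 er8; lra.
  have re0 : 0 < (r + e)%:R :> R by exact: lt_le_trans hre.
  rewrite ler_pdivlMr//.
  apply: (@le_trans _ _ ((13 / 16 * r%:R) ^+ 2)).
    have : (r + e)%:R <= 9 / 8 * r%:R :> R by rewrite natrD; clear -e2 er8; lra.
    have := sqr_ge0 (r%:R : R).
    by clear -r0'; nra.
  by rewrite -[leRHS]real_normK ?num_real// lerXn2r// nnegrE//.
have q4 : `|mu| * e%:R <= G / 4 * r%:R.
  apply: (@le_trans _ _ (`|mu| * (2 * (eps * r%:R)))); first by rewrite ler_wpM2l.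
  have : 0 <= (G - eps * `|mu| * 8) * r%:R by rewrite mulr_ge0// subr_ge0.
  by clear; lra.
have q5 : mu * e%:R <= `|mu| * e%:R by rewrite ler_wpM2r// ler_norm.
have q6 : G * (r%:R / 2) <= G * z'%:~R ^+ 2 / (r + e)%:R.
  by rewrite -[leRHS]mulrA ler_pM2l.
have q7 : G / 4 * z%:~R ^+ 2 / r%:R <= G / 4 * r%:R.
  by rewrite -mulrA ler_pM2l// divr_gt0.
rewrite natrD mulrDr in hm.
rewrite -/s; rewrite natrD in q6.
by clear -hm q1 q4 q5 q6 q7; lra.
Qed.

End base_bounds.

(** * Transfer between the given weights and the canonical space *)

Section transfer.
Context {R : realType} {d : measure_display} {T : measurableType d}.
Variables (P : probability T R) (nu : probability R R) (xi : vtx -> T -> R).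
Hypothesis nu_ge0 : nu `[0, +oo[ = 1%E.
Hypothesis xi_law : forall v, has_law P (xi v) nu.
Hypothesis xi_indep : mutually_independent P xi.

Definition env_of (t : T) : env R := fun v => xi v t.

Lemma measurable_xi v : measurable_fun setT (xi v).
Proof. by case: (xi_law v). Qed.

Lemma measurable_env_of : measurable_fun setT env_of.
Proof.
apply: (@measurability _ _ T (env R) setT env_of (cylinder setT)) => //.
move=> _ [_ [s [B [mB _ ->]]] <-]; rewrite setTI.
rewrite (_ : _ @^-1` _ = [set t | forall v, v \in s -> B v (xi v t)])//.
elim: s => [|v s IH].
  by rewrite (_ : mkset _ = setT)//; apply/seteqP; split.
rewrite (_ : mkset _ = (xi v @^-1` B v) `&` [set t | forall v, v \in s -> B v (xi v t)]).
  apply: measurableI => //; rewrite -[X in measurable X]setTI.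
  exact: measurable_xi.
apply/seteqP; split=> t /=.
  move=> h; split; first by apply: h; rewrite mem_head.
  by move=> q qs; apply: h; rewrite inE qs orbT.
by move=> [hv h] q; rewrite inE => /orP[/eqP ->//|/h].
Qed.

Definition env_rv : {mfun T >-> env R} := mfun_Sub (mem_set measurable_env_of).

Definition env_law : probability (env R) R := distribution P env_rv.

Lemma env_lawE (E : set (env R)) : env_law E = P (env_of @^-1` E).
Proof. by []. Qed.

Lemma env_law_iid : iid_law env_law nu.
Proof.
move=> s B us mB; rewrite env_lawE.
have := xi_indep us mB.
rewrite (_ : \bigcap_(v in [set` s]) (xi v @^-1` B v) =
  env_of @^-1` [set w | forall v, v \in s -> B v (w v)]).
  by move=> ->; apply: eq_bigr => v _; case: (xi_law v) => _ ->.
by apply/seteqP; split=> t /= h v vs; apply: h.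
Qed.

Lemma xi_ge0_ae : {ae P, forall t, forall v, 0 <= xi v t}.
Proof.
have h v : {ae P, forall t, 0 <= xi v t}.
  exists (xi v @^-1` ~` `[0, +oo[); split.
  - rewrite -[X in measurable X]setTI; apply: measurable_xi => //.
    by apply: measurableC; exact: measurable_itv.
  - have [_ ->] := xi_law v; last by apply: measurableC; exact: measurable_itv.
    rewrite probability_setC ?measurable_itv// nu_ge0 subee//.
  - by move=> t /= ; rewrite in_itv/= andbT.
have : {ae P, forall t, forall n, if unpickle n is Some v then 0 <= xi v t else true}.
  apply/ae_foralln => n; case: unpickle => [v|]; first exact: h.
  exact: filterE.
apply: filterS => t ht v.
by have := ht (pickle v); rewrite pickleK.
Qed.

Lemma Xrz_env r z : {ae P, forall t,
  Xrz xi r z t = lppe (1, 1) (r%:Z - z, r%:Z + z) (env_of t)}.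
Proof.
apply: filterS xi_ge0_ae => t ht; rewrite /Xrz /lppe; congr lpp.
by apply/funext => v; rewrite /env_of max_l.
Qed.

Lemma measurable_Xrz r z : measurable_fun setT (Xrz xi r z).
Proof. by apply: measurable_lpp => v; exact: measurable_xi. Qed.

Lemma Ex_Xrz r z : (`|z| < r)%N -> Ex P (Xrz xi r z) = @EX R env_law r z.
Proof.
move=> /range_coord[h1 h2]; rewrite /Ex /EX.
rewrite ge0_integral_distribution; last 2 first.
- exact: measurable_lppe.
- by move=> w; exact: lppe_ge0.
apply: ae_eq_integral => //.
- exact: measurable_Xrz.
- apply: measurableT_comp; [exact: measurable_lppe|exact: measurable_env_of].
apply: filterS (Xrz_env r z) => t -> _ //.
Qed.

Lemma le_measure_ae (A B : set T) : measurable A -> measurable B ->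
  {ae P, forall t, A t -> B t} -> (P A <= P B)%E.
Proof.
move=> mA mB [N [mN N0 hN]].
apply: (@le_trans _ _ (P (B `|` N))).
  apply: le_measure; rewrite ?inE//; first exact: measurableU.
  move=> t At; have [Bt|nBt] := pselect (B t); [by left|right].
  by apply: hN => /(_ At).
have N0' : (P N <= 0)%E by rewrite -N0.
apply: (le_trans (measureU2 P mB mN)); apply: (le_trans (leeD2l _ N0')).
by rewrite adde0.
Qed.

Lemma law_LS_of (mu : R) : Assumption_LS P xi mu -> @law_LS R env_law mu.
Proof.
move=> [rho [G [H [g1 [g2 [rho0 [G0 [H0 [g10 [g20 [r1 hLS]]]]]]]]]]].
(* The cap [1/2] and [r1.+1] force [|z| < r], so that both coordinates of the endpoint are at least
   1. *)
exists (Num.min rho 2^-1), G, H, g1; split => //.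
  by rewrite lt_min rho0 invr_gt0 ltr0n.
exists r1.+1 => r hr z hz.
have r0 : (0 < r)%N by exact: leq_trans hr.
have rR : 0 < r%:R :> R by rewrite ltr0n.
have zr : (`|z| < r)%N.
  have : `|z%:~R| < r%:R :> R.
    apply: (le_lt_trans hz); apply: (@le_lt_trans _ _ (2^-1 * r%:R)).
      by rewrite ler_pM2r// ge_min lexx orbT.
    by rewrite gtr_pMl// invf_lt1// ltr1n.
  by rewrite -intr_norm -abszE -(pmulrn 1) ltr_nat.
have hz' : `|z%:~R| <= rho * r%:R.
  by apply: (le_trans hz); rewrite ler_pM2r// ge_min lexx.
have := hLS r (ltnW hr) z hz'; rewrite /= Ex_Xrz// => -[lo up]; split => //.
apply: (le_trans up); rewrite lee_fin gerBl mulr_ge0 ?powR_ge0//; exact: ltW.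
Qed.

Lemma law_UT_of (alpha : R) : Assumption_UT P xi alpha -> @law_UT R env_law alpha.
Proof.
move=> hUT eps eps0.
have [c [th0 [r0 [c0 [th00 [r00 h]]]]]] := hUT eps eps0.
exists c, th0, r0; split => // r th z m hr hth hz em.
have zr : (`|z| < r)%N.
  have : `|z%:~R| < r%:R :> R.
    apply: (le_lt_trans hz); rewrite gtr_pMl; last exact: lt_trans hr.
    by rewrite gtrBl.
  by rewrite -intr_norm -abszE -(pmulrn 1) ltr_nat.
have := h r th z hr hth hz; rewrite Ex_Xrz// em => hP.
rewrite -lee_fin -prE; last exact: measurable_lpt.
apply: le_trans hP; rewrite env_lawE.
have eE : [set w | ((th * r%:R `^ 3^-1)%:E < Xrz xi r z w - m%:E)%E] =
    [set w | ((m + th * r%:R `^ 3^-1)%:E < Xrz xi r z w)%E].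
  by apply/seteqP; split=> w; rewrite /mkset lteBrDr// -EFinD addrC.
apply: le_measure_ae.
- rewrite -[X in measurable X]setTI; apply: measurable_env_of => //.
  exact: measurable_lpt.
- rewrite eE -[X in measurable X]setTI.
  apply: emeasurable_fun_o_infty => //; exact: measurable_Xrz.
apply: filterS (Xrz_env r z) => t et; rewrite eE /= et.
by move=> /lppe_gtP.
Qed.

(** Recentring from the mean to [mu r] loses [C < th / 2]; the strict slack also turns the
    non-strict event into a strict one. *)
Lemma upper_tail_transfer (mu C : R) (r : nat) (th : R) :
  (0 < r)%N -> 0 < th -> 2 * C < th ->
  ((mu * r%:R - C * r%:R `^ (3^-1))%:E <= @EX R env_law r 0)%E ->
  (@EX R env_law r 0 \is a fin_num) ->
  (P [set w | ((th * r%:R `^ (3^-1))%:E <= Xrz xi r 0 w - Ex P (Xrz xi r 0))%E] <=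
    (pr env_law (Xe r 0 (mu * r%:R + th / 2 * r%:R `^ (3^-1))))%:E)%E.
Proof.
move=> r0 th0 thC lo fin; rewrite Ex_Xrz//.
move: lo fin; case: (@EX R env_law r 0) => [m| |]// lo _; rewrite lee_fin in lo.
rewrite -prE; last exact: measurable_lpt.
rewrite env_lawE.
have eE : [set w | ((th * r%:R `^ 3^-1)%:E <= Xrz xi r 0 w - m%:E)%E] =
    [set w | ((m + th * r%:R `^ 3^-1)%:E <= Xrz xi r 0 w)%E].
  by apply/seteqP; split=> w; rewrite /mkset leeBrDr// -EFinD addrC.
apply: le_measure_ae.
- rewrite eE -[X in measurable X]setTI.
  apply: emeasurable_fun_c_infty => //; exact: measurable_Xrz.
- rewrite -[X in measurable X]setTI; apply: measurable_env_of => //.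
  exact: measurable_lpt.
apply: filterS (Xrz_env r 0) => t et; rewrite eE /= et => h.
apply/lppe_gtP; apply: lt_le_trans h; rewrite lte_fin.
have s0 : 0 < r%:R `^ 3^-1 :> R by rewrite powR_gt0// ltr0n.
have : 0 < (th - 2 * C) * r%:R `^ 3^-1 by rewrite mulr_gt0// subr_gt0.
by move: lo; set s := _ `^ _; lra.
Qed.

End transfer.

(** * Choice of [zeta] and conclusion *)

Unset Implicit Arguments.
Set Strict Implicit.
Theorem theorem1 (R : realType) :
  exists zeta : R -> R,
    (forall alpha : R, 0 < alpha -> 0 < zeta alpha /\ zeta alpha <= 2 / 25) /\
    (forall alpha : R, 1 <= alpha -> zeta alpha = 2 / 25) /\
    (zeta x @[x --> (0 : R)^'+] --> (0 : R)) /\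
    forall (alpha : R) (d : measure_display) (T : measurableType d)
           (P : probability T R) (nu : probability R R)
           (xi : vtx -> T -> R) (mu : R),
      0 < alpha ->
      nu `[0, +oo[ = 1%E ->
      (forall v, has_law P (xi v) nu) ->
      mutually_independent P xi ->
      (fun r : nat => (Ex P (Xrz xi r 0) * (r%:R^-1)%:E)%E) @ \oo --> mu%:E ->
      Assumption_LS P xi mu ->
      Assumption_UT P xi alpha ->
      exists (c r0 theta0 : R), 0 < c /\ 1 < theta0 /\
        forall (r : nat) (theta : R),
          r0 < r%:R -> theta0 <= theta -> theta <= r%:R `^ zeta alpha ->
          (P [set w | ((theta * r%:R `^ (3^-1))%:E <=
                         Xrz xi r 0 w - Ex P (Xrz xi r 0))%E]
            <= (expR (- (c * theta `^ (3 / 2) * (ln theta) `^ (- (2^-1)))))%:E)%E.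
Proof.
(* Choice makes the range a function of [alpha] before any probability space is introduced; outside
   [(0, 1)] its value is 0. *)
have [eta heta] : {eta : R -> R & forall alpha : R, 0 < alpha -> alpha < 1 ->
    0 < eta alpha /\ forall (Q : probability (env R) R) (nu : probability R R) mu,
    iid_law Q nu -> median_bound Q mu -> tail_bound Q mu alpha 1 ->
    tail_bound Q mu 1 (eta alpha)}.
  apply: (@choice R R (fun alpha e => 0 < alpha -> alpha < 1 ->
    0 < e /\ forall (Q : probability (env R) R) (nu : probability R R) mu,
    iid_law Q nu -> median_bound Q mu -> tail_bound Q mu alpha 1 ->
    tail_bound Q mu 1 e)) => alpha.
  have [[a0 a1]|na] := pselect (0 < alpha /\ alpha < 1); last first.
    by exists 0 => a0 a1; case: na.
  have b0 : 0 < alpha ^+ 2 / 3 by rewrite divr_gt0// exprn_gt0.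
  have hm : 1 <= alpha +
      (Num.truncn (alpha ^+ 2 / 3)^-1).+1%:R * (alpha ^+ 2 / 3).
    apply: (@le_trans _ _ ((Num.truncn (alpha ^+ 2 / 3)^-1).+1%:R * (alpha ^+ 2 / 3))).
      by rewrite -ler_pdivrMr// div1r ltW// truncnS_gt.
    by rewrite lerDr ltW.
  have [eta [eta0 heta]] := tail_to_one a0 (ltW a1) ltr01 hm.
  by exists eta => _ _; split.
(* The entry [alpha] forces the limit 0 by squeezing, and [eta alpha / 6] is the range required by
   [tail_final]. *)
pose zeta (alpha : R) : R := if 1 <= alpha then 2 / 25
  else Num.min (2 / 25) (Num.min alpha (eta alpha / 6)).
exists zeta; split; last split; last split.
- move=> alpha alpha0; rewrite /zeta; case: (leP 1 alpha) => [_|a1].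
    by split=> //; rewrite divr_gt0.
  have [eta0 _] := heta alpha alpha0 a1.
  by rewrite !lt_min alpha0 !divr_gt0// ge_min lexx.
- by move=> alpha a1; rewrite /zeta a1.
- apply: (@squeeze_cvgr _ _ _ _ (fun=> 0) id).
  + near=> x.
    have x0 : 0 < x by near: x; exact: nbhs_right_gt.
    have x1 : x < 1 by near: x; exact: nbhs_right_lt.
    have [eta0 _] := heta x x0 x1.
    rewrite /zeta (lt_geF x1) !le_min !divr_ge0 ?(ltW x0) ?(ltW eta0)//=.
    by rewrite !ge_min lexx orbT.
  + exact: cvg_cst.
  + exact: cvg_at_right_filter cvg_id.
move=> alpha d T P nu xi mu alpha0 nu0 law indep _ LS UT.
have QE := env_law_iid law indep.
have LSQ := law_LS_of nu0 law LS.
have UTQ := law_UT_of nu0 law UT.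
set Q := env_law law in QE LSQ UTQ.
have HM := median_of_LS_UT QE alpha0 LSQ UTQ.
have HT := tail_of_LS_UT QE 1 alpha0 LSQ UTQ.
have [e [e0 ze z0 z1 HT1]] : exists e, [/\ 0 < e, zeta alpha <= e / 6, 0 < zeta alpha,
    zeta alpha <= 2 / 25 & tail_bound Q mu 1 e].
  rewrite /zeta; case: (leP 1 alpha) => [a1|a1].
    (* For [alpha >= 1] the base tail already has exponent 1, with range [eta = 1], and
       [2/25 <= 1/6]. *)
    exists 1; split=> //; try lra.
    exact: tail_bound_weaken HT.
  have [eta0 heta'] := heta alpha alpha0 a1.
  exists (eta alpha); split => //.
  - by rewrite !ge_min lexx !orbT.
  - by rewrite !lt_min alpha0 !divr_gt0.
  - by rewrite ge_min lexx.
  - exact: (heta' Q nu mu QE HM HT).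
have [c [r0 [th0 [c0 th01 H]]]] := tail_final QE e0 z0 z1 ze HT1 HM.
have [C [r1 [C0 hlow]]] := EX_lower LSQ.
have [G [C' [r2 [_ _ hup]]]] := EX_upper QE LSQ.
(* The tail is applied at [th / 2], whence the factor [2^(-3/2)]. *)
exists (c * 2^-1 `^ (3 / 2)), (1 + `|r0| + `|r1| + `|r2|), (2 * th0 + 2 * C + 1).
split; first by rewrite mulr_gt0// powR_gt0.
split; first by move: th01 C0; clear; lra.
move=> r th hr hth hthr.
have r00 := normr_ge0 r0; have r10 := normr_ge0 r1; have r20 := normr_ge0 r2.
have hr0 : r0 < r%:R by have := ler_norm r0; clear -hr r10 r20; lra.
have hr1 : r1 < r%:R by have := ler_norm r1; clear -hr r00 r20; lra.
have hr2 : r2 < r%:R by have := ler_norm r2; clear -hr r00 r10; lra.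
have rR : 0 < r%:R :> R by clear -hr r00 r10 r20; lra.
have rn : (0 < r)%N by rewrite -(ltr0n R).
have thc : 2 * C < th by clear -hth th01; lra.
have th2 : th0 <= th / 2 by clear -hth C0; lra.
have th2' : 1 < th / 2 by exact: lt_le_trans th2.
have th1 : 1 < th by clear -th2'; lra.
have th0' : 0 < th by clear -th1; lra.
have zlow : `|(0 : int)%:~R| <= 2 * (r%:R `^ (3^-1)) ^+ 2 :> R.
  by rewrite normr0 mulr_ge0// exprn_ge0// powR_ge0.
have [m [em _ _]] := hup r 0 hr2 rn.
have efin : @EX R Q r 0 \is a fin_num by rewrite em.
apply: (le_trans (upper_tail_transfer nu0 rn th0' thc (hlow r 0 hr1 zlow) efin)).
rewrite lee_fin; apply: (le_trans (H r (th / 2) hr0 th2 _)).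
  by apply: le_trans hthr; clear -th0'; lra.
rewrite ler_expR lerN2.
have -> : (th / 2) `^ (3 / 2) = 2^-1 `^ (3 / 2) * th `^ (3 / 2).
  by rewrite powRM ?(ltW th0')// mulrC.
rewrite mulrA ler_wpM2l//.
  by rewrite !mulr_ge0 ?powR_ge0// ltW.
(* The logarithm enters with a negative power, so [ln (th / 2) <= ln th] only helps. *)
rewrite !powRN lef_pV2 ?posrE ?powR_gt0 ?ln_gt0//.
apply: ge0_ler_powR; rewrite ?nnegrE ?ln_ge0// ?(ltW th1) ?(ltW th2')//.
rewrite ler_ln ?posrE ?divr_gt0//.
by clear -th0'; lra.
Unshelve. all: by end_near.
Qed.
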